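(* Let $\lambda\in\mathbb R$ be a constant, and let $\Omega(t)$, $\Gamma(t)$, $D_r(t)$, $t\ge 0$, be continuous and bounded, where $\Omega(t)$ is an antisymmetric real $3\times 3$ matrix, $\Gamma(t)$ is a symmetric real $3\times3$ matrix with $\operatorname{tr}\Gamma(t)=0$, and $D_r(t)\ge 0$ is a scalar. Let $B_0$ be a symmetric positive definite $3\times3$ matrix with $\det B_0=1$ and put $A_0=A(B_0)$. Consider the Fast Exact Closure system with isotropic diffusion $$\frac{dA}{dt}=\tfrac12\,\mathbb C(B):\big[B\cdot(\Omega+\lambda\Gamma)+(-\Omega+\lambda\Gamma)\cdot B\big]+D_r\,(2I-6A),$$ $$\frac{dB}{dt}=-\tfrac12\big(B\cdot(\Omega+\lambda\Gamma)+(-\Omega+\lambda\Gamma)\cdot B\big)-D_r\,\mathbb D(B):(2I-6A),$$ with $A(0)=A_0$, $B(0)=B_0$. Then this system has a solution defined for all $t\ge0$ which stays physical: for every $t\ge 0$, $B(t)$ is symmetric positive definite and finite (none of its eigenvalues becomes $0$ or infinite in finite time), $\det B(t)=1$, and $A(t)=A(B(t))$ is positive definite with $\operatorname{tr}A(t)=1$.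
   Context: All matrices are real $3\times3$. For a symmetric positive definite matrix $B$ define $$A(B)=\tfrac12\int_0^\infty \frac{(B+sI)^{-1}\,ds}{\sqrt{\det(B+sI)}},\qquad \mathbb C(B)=\tfrac34\int_0^\infty\frac{\mathcal S\big((B+sI)^{-1}\otimes(B+sI)^{-1}\big)\,ds}{\sqrt{\det(B+sI)}},$$ where for a rank-4 tensor $\mathbb T$, $\mathcal S(\mathbb T)_{ijkl}$ is the average of $\mathbb T_{mnpq}$ over all permutations $(m,n,p,q)$ of $(i,j,k,l)$. For a rank-4 tensor $\mathbb T$ and a matrix $M$, $(\mathbb T:M)_{ij}=\sum_{k,l}\mathbb T_{ijkl}M_{kl}$. The linear map $M\mapsto \mathbb C(B):M$ on symmetric matrices is invertible; $\mathbb D(B)$ denotes the rank-4 tensor with $\mathbb D_{ijkl}=\mathbb D_{jikl}=\mathbb D_{ijlk}$ representing its inverse, i.e. $\mathbb C(B):\mathbb D(B):M=\mathbb D(B):\mathbb C(B):M=M$ for every symmetric $M$. Here $t$ plays the role of time along a material (Lagrangian) trajectory, so $D/Dt$ becomes $d/dt$. *)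

(* Defs.v *)
From HB Require Import structures.
From mathcomp Require Import all_boot all_order all_algebra all_fingroup.
From mathcomp Require Import all_classical all_reals all_analysis.
From Stdlib Require Import ClassicalEpsilon.
Set Implicit Arguments. Unset Strict Implicit. Unset Printing Implicit Defensive.
Import Order.TTheory GRing.Theory Num.Theory.
Import numFieldNormedType.Exports.
Local Open Scope classical_set_scope.
Local Open Scope ring_scope.

Section Defs.
Variable R : realType.

Definition tensor4 := 'I_3 -> 'I_3 -> 'I_3 -> 'I_3 -> R.

Definition tcontract (T : tensor4) (M : 'M[R]_3) : 'M[R]_3 :=
  \matrix_(i, j) \sum_(k < 3) \sum_(l < 3) T i j k l * M k l.

Definition tprod (M N : 'M[R]_3) : tensor4 := fun i j k l => M i j * N k l.

Definition Ssym (T : tensor4) : tensor4 := fun i j k l =>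
  let x : 4.-tuple 'I_3 := [tuple i; j; k; l] in
  (24%:R)^-1 * \sum_(s : 'S_4) T (tnth x (s ord0)) (tnth x (s (inord 1)))
                                 (tnth x (s (inord 2))) (tnth x (s (inord 3))).

Definition mx_sym (M : 'M[R]_3) : Prop := M^T = M.
Definition mx_skew (M : 'M[R]_3) : Prop := M^T = - M.
Definition mx_posdef (M : 'M[R]_3) : Prop :=
  forall v : 'cV[R]_3, v != 0 -> 0 < (v^T *m M *m v) 0 0.
Definition mx_spd (M : 'M[R]_3) : Prop := mx_sym M /\ mx_posdef M.

Definition int0oo (f : R -> R) : R :=
  Rintegral (@lebesgue_measure R) `[0%R, +oo[%classic f.

Definition Bs (B : 'M[R]_3) (s : R) : 'M[R]_3 := B + s%:M.

Definition Amap (B : 'M[R]_3) : 'M[R]_3 :=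
  \matrix_(i, j) (2%:R^-1 *
     int0oo (fun s => invmx (Bs B s) i j / Num.sqrt (\det (Bs B s)))).

Definition Cten (B : 'M[R]_3) : tensor4 := fun i j k l =>
  (3%:R / 4%:R) *
    int0oo (fun s => Ssym (tprod (invmx (Bs B s)) (invmx (Bs B s))) i j k l
                     / Num.sqrt (\det (Bs B s))).

(* D(B): the rank-4 tensor with minor symmetries representing the inverse
   of M |-> C(B):M on mx_sym matrices (chosen by Hilbert's epsilon;
   it is unique whenever that map is invertible). *)
Definition is_Dten (B : 'M[R]_3) (D : tensor4) : Prop :=
  (forall i j k l, D i j k l = D j i k l /\ D i j k l = D i j l k) /\
  (forall M, mx_sym M ->
     tcontract (Cten B) (tcontract D M) = M /\
     tcontract D (tcontract (Cten B) M) = M).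

Definition Dten (B : 'M[R]_3) : tensor4 :=
  epsilon (inhabits (fun _ _ _ _ => 0)) (is_Dten B).

End Defs.

(* Main.v *)
Require Import Defs.
From HB Require Import structures.
From mathcomp Require Import all_boot all_order all_algebra all_fingroup.
From mathcomp Require Import all_classical all_reals all_analysis.
From mathcomp Require Import measurable_realfun.
From mathcomp Require Import ring lra.
Set Implicit Arguments. Unset Strict Implicit. Unset Printing Implicit Defensive.
Import Order.TTheory GRing.Theory Num.Theory.
Import numFieldNormedType.Exports.
Local Open Scope classical_set_scope.
Local Open Scope ring_scope.

(* Write [P = (B + s)^-1] and [w = det (B + s) ^ (-1/2)].  Then
   [C(B) : H = int (P H P / 2 + tr (P H) P / 4) w ds] is minus the derivative of
   [A] at [B] in the direction [H], so the equation for [A] follows from the one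
   for [B].  Since [d/ds (P w) = - (P P + tr P P / 2) w], the fundamental theorem
   of calculus applied to [P w] and to [s P w] gives
   [C(B) : I = B^-1 / (2 sqrt (det B))] and [C(B) : B = 3/2 A(B)].  Hence
   [D(B) : (2 I - 6 A(B)) = 2 F - 4 B] with [F = D(B) : I], where
   [tr F = <F, C : F> >= 0] and [tr (B^-1 F) = 6 sqrt (det B)].  The last identity
   makes [(det B - 1)^2] nonincreasing, so [det B = 1]; a symmetric path with
   positive determinant stays positive definite; and [tr F >= 0] gives
   [(tr B)' <= k tr B].  An upper bound on [tr B] together with [det B = 1] bounds
   [B] away from singular matrices on every bounded time interval.

   These estimates survive multiplying [2 F - 4 B] by any cutoff with values in
   [0, 1] that vanishes off the positive definite matrices.  A time dependent
   cutoff makes the field globally Lipschitz, Picard iteration in a weighted norm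
   solves the truncated equation on [0, +oo), and the estimates then show that
   the cutoff equals 1 along the solution. *)

(** * Symmetric 3x3 matrices *)

(** The obstacle is that [Dten B] carries no information when [B] is not positive definite, being
    then only a value of [epsilon], and that its bounds degenerate at the boundary of the positive
    cone. All estimates are therefore phrased with a single constant [rho] ([ellip]) that bounds [B]
    from above and its quadratic form from below. The numerical constants are crude, but they are
    explicit polynomials in [rho]: Picard iteration needs a Lipschitz constant that depends
    continuously on time, and it inherits continuity from [rho].

    The radius of the cutoff at time [t] is computed from the a priori bound [tr B0 * exp (k t)],
    hence fixed before any solution exists. This replaces the usual argument with a maximal interval
    of existence: the truncated equation is solved once on the whole half-line.

    The order of the a priori estimates matters: symmetry, then the determinant, then positivity,
    then the trace, then the lower bound. Each uses only the preceding ones and, where the cutoff is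
    nonzero, the ellipticity that the cutoff itself provides. *)

Section Matrix3.
Variable R : realType.
Implicit Types (X Y P M H : 'M[R]_3) (v u : 'cV[R]_3) (a b c : R).

Definition o0 : 'I_3 := @Ordinal 3 0 isT.
Definition o1 : 'I_3 := @Ordinal 3 1 isT.
Definition o2 : 'I_3 := @Ordinal 3 2 isT.

Lemma ord3_ind (Q : 'I_3 -> Prop) : Q o0 -> Q o1 -> Q o2 -> forall i, Q i.
Proof.
move=> q0 q1 q2 [[|[|[|//]]] hi].
- by rewrite (_ : Ordinal hi = o0)//; apply/val_inj.
- by rewrite (_ : Ordinal hi = o1)//; apply/val_inj.
- by rewrite (_ : Ordinal hi = o2)//; apply/val_inj.
Qed.

Lemma sum3 (V : nmodType) (f : 'I_3 -> V) : \sum_(i < 3) f i = f o0 + f o1 + f o2.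
Proof.
rewrite !big_ord_recl big_ord0 addr0 addrA.
by congr (f _ + f _ + f _); apply/val_inj.
Qed.

Lemma det3 X : \det X =
  X o0 o0 * (X o1 o1 * X o2 o2 - X o1 o2 * X o2 o1)
  - X o0 o1 * (X o1 o0 * X o2 o2 - X o1 o2 * X o2 o0)
  + X o0 o2 * (X o1 o0 * X o2 o1 - X o1 o1 * X o2 o0).
Proof.
(* Passing to natural-number indices lets the nested [lift]s of the cofactor expansion compute to
   numerals. *)
pose f (a b : nat) := X (inord a) (inord b).
have E i j : X i j = f i j by rewrite /f !inord_val.
rewrite !E (expand_det_row _ o0) sum3 /cofactor.
rewrite !(expand_det_row _ ord0) !big_ord_recl !big_ord0 /cofactor !det_mx11 !mxE.
rewrite !E /= /bump /= !addn0 ?addn1 ?expr0.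
ring.
Qed.

Definition cyc3 (i : 'I_3) : 'I_3 :=
  match val i with 0 => o1 | 1 => o2 | _ => o0 end.

(** The adjugate; taking the two complementary indices in cyclic order absorbs the cofactor
    signs. *)
Definition adj3 X : 'M[R]_3 := \matrix_(i, j)
  (X (cyc3 j) (cyc3 i) * X (cyc3 (cyc3 j)) (cyc3 (cyc3 i))
   - X (cyc3 j) (cyc3 (cyc3 i)) * X (cyc3 (cyc3 j)) (cyc3 i)).

Lemma mul_adj3_mx X : adj3 X *m X = (\det X)%:M.
Proof.
apply/matrixP; apply: ord3_ind; apply: ord3_ind; rewrite !mxE sum3 !mxE /cyc3 /= det3; ring.
Qed.

Lemma invmx3 X : \det X != 0 -> invmx X = (\det X)^-1 *: adj3 X.
Proof.
move=> d0; have uX : X \in unitmx by rewrite unitmxE unitfE.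
have := congr1 (fun Z => Z *m invmx X) (mul_adj3_mx X).
rewrite /= -mulmxA mulmxV// mulmx1 mul_scalar_mx => ->.
by rewrite scalerA mulVf// scale1r.
Qed.

Definition qf X v : R := (v^T *m X *m v) 0 0.
Definition sqnorm v : R := (v^T *m v) 0 0.

Lemma qfE X v : qf X v = \sum_(i < 3) \sum_(j < 3) v i 0 * X i j * v j 0.
Proof.
rewrite /qf mxE exchange_big/=; apply: eq_bigr => j _; rewrite mxE big_distrl/=.
by apply: eq_bigr => i _; rewrite mxE.
Qed.

Lemma sqnormE v : sqnorm v = v o0 0 ^+ 2 + v o1 0 ^+ 2 + v o2 0 ^+ 2.
Proof. by rewrite /sqnorm mxE sum3 !mxE -!expr2. Qed.

Lemma sqnorm_ge0 v : 0 <= sqnorm v.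
Proof. by rewrite sqnormE !addr_ge0// sqr_ge0. Qed.

Lemma sqnorm_gt0 v : v != 0 -> 0 < sqnorm v.
Proof.
move=> v0; rewrite lt_neqAle sqnorm_ge0 andbT eq_sym; apply: contra v0 => /eqP h.
have {}h : v o0 0 ^+ 2 + v o1 0 ^+ 2 + v o2 0 ^+ 2 = 0 by rewrite -sqnormE.
have := sqr_ge0 (v o0 0); have := sqr_ge0 (v o1 0); have := sqr_ge0 (v o2 0).
move=> h2 h1 h0; apply/eqP/matrixP => i j; rewrite (ord1 j) mxE {j}.
by move: i; apply: ord3_ind; apply/eqP; rewrite -sqrf_eq0; apply/eqP; lra.
Qed.

Lemma qfD X Y v : qf (X + Y) v = qf X v + qf Y v.
Proof. by rewrite /qf mulmxDr mulmxDl mxE. Qed.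

Lemma qf_scalar a v : qf a%:M v = a * sqnorm v.
Proof. by rewrite /qf /sqnorm mul_mx_scalar -scalemxAl mxE. Qed.

Definition vec3 (a b c : R) : 'cV[R]_3 :=
  \col_i (match val i with 0 => a | 1 => b | _ => c end).

Lemma qf_vec3 X a b c : qf X (vec3 a b c) =
  a * X o0 o0 * a + a * X o0 o1 * b + a * X o0 o2 * c
  + (b * X o1 o0 * a + b * X o1 o1 * b + b * X o1 o2 * c)
  + (c * X o2 o0 * a + c * X o2 o1 * b + c * X o2 o2 * c).
Proof. by rewrite qfE !sum3 !mxE /=. Qed.

Lemma vec3_eq0 a b c : (vec3 a b c == 0) = [&& a == 0, b == 0 & c == 0].
Proof.
apply/eqP/and3P => [/matrixP h|[/eqP -> /eqP -> /eqP ->]].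
  by have := h o0 0; have := h o1 0; have := h o2 0; rewrite !mxE /= => -> -> ->.
by apply/matrixP => i j; rewrite !mxE; case: (val i) => [|[|]].
Qed.

Lemma sym_entry X i j : mx_sym X -> X j i = X i j.
Proof. by move=> h; rewrite -[in LHS]h mxE. Qed.

Definition minor2 X i j := X i i * X j j - X i j * X i j.

Lemma posdef_diag X i : mx_posdef X -> 0 < X i i.
Proof.
move=> pX; have v0 : delta_mx i 0 != 0 :> 'cV[R]_3.
  by apply/eqP => /matrixP /(_ i 0); rewrite !mxE !eqxx /= => /eqP; rewrite oner_eq0.
by have := pX _ v0; rewrite trmx_delta -rowE -colE !mxE.
Qed.

Lemma posdef_minor2 X i j : mx_spd X -> i != j -> 0 < minor2 X i j.
Proof.
(* Component [i] of [X *m v] vanishes by design, and the form at [v] is [X i i * minor2 X i j]. *)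
move=> [sX pX] ij; pose v : 'cV[R]_3 := X i j *: delta_mx i 0 - X i i *: delta_mx j 0.
have v0 : v != 0.
  apply/eqP => /matrixP /(_ j 0); rewrite !mxE !eqxx /= eq_sym (negbTE ij) /= => /eqP.
  by rewrite mulr0 sub0r mulr1 oppr_eq0 gt_eqF// posdef_diag.
have vT : v^T = X i j *: delta_mx 0 i - X i i *: delta_mx 0 j.
  by rewrite /v linearB/= !linearZ/= !trmx_delta.
have := pX v v0; rewrite vT /v mulmxBl -!scalemxAl -!rowE mulmxBr -!scalemxAr -!colE !mxE (sym_entry i j sX).
rewrite (_ : _ - _ = X i i * minor2 X i j); last by rewrite /minor2; ring.
by rewrite pmulr_rgt0// posdef_diag.
Qed.

Lemma posdef_det X : mx_spd X -> 0 < \det X.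
Proof.
move=> sp; have [sX pX] := sp.
have m2 := posdef_minor2 sp (isT : o0 != o1).
have E10 := sym_entry o0 o1 sX; have E20 := sym_entry o0 o2 sX.
have E21 := sym_entry o1 o2 sX.
(* [(a, b, minor2 X o0 o1)] is the last column of the adjugate. [X] sends it to [det X] times the
   last basis vector, so the form there is [minor2 X o0 o1 * det X]. *)
pose a := X o0 o1 * X o1 o2 - X o0 o2 * X o1 o1.
pose b := X o0 o1 * X o0 o2 - X o0 o0 * X o1 o2.
have v0 : vec3 a b (minor2 X o0 o1) != 0 by rewrite vec3_eq0 (gt_eqF m2) !andbF.
have := pX _ v0; rewrite -/(qf _ _) qf_vec3 => h.
rewrite -(pmulr_rgt0 _ m2); move: h; congr (_ < _).
by rewrite det3 E10 E20 E21 /a /b /minor2; ring.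
Qed.

(** Gaussian elimination: [G] is unit lower triangular and the pivots in [D] are quotients of
    successive leading minors, so positive minors allow the square roots of the pivots to be
    absorbed into [L]. *)
Lemma cholesky X : mx_sym X -> 0 < X o0 o0 -> 0 < minor2 X o0 o1 -> 0 < \det X ->
  exists2 L : 'M[R]_3, X = L *m L^T & L \in unitmx.
Proof.
move=> sX a0 m0 d0.
have E10 := sym_entry o0 o1 sX; have E20 := sym_entry o0 o2 sX.
have E21 := sym_entry o1 o2 sX.
pose G : 'M[R]_3 := \matrix_(i, j) match val i, val j with
  | 0, 0 => 1 | 1, 1 => 1 | 2, 2 => 1
  | 1, 0 => X o0 o1 / X o0 o0 | 2, 0 => X o0 o2 / X o0 o0
  | 2, 1 => (X o0 o0 * X o1 o2 - X o0 o1 * X o0 o2) / minor2 X o0 o1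
  | _, _ => 0 end.
pose D : 'rV[R]_3 := \row_i match val i with
  | 0 => X o0 o0 | 1 => minor2 X o0 o1 / X o0 o0 | _ => \det X / minor2 X o0 o1 end.
have D0 i : 0 < D 0 i.
  by rewrite mxE; case: (val i) => [//|[|k]]; rewrite divr_gt0.
pose S : 'M[R]_3 := diag_mx (\row_i Num.sqrt (D 0 i)).
have SS : S *m S = diag_mx D.
  rewrite /S mulmx_diag; congr diag_mx; apply/rowP => i; rewrite !mxE.
  by rewrite -expr2 sqr_sqrtr//; have := D0 i; rewrite mxE => /ltW.
have XE : X = G *m diag_mx D *m G^T.
  have a1 : X o0 o0 != 0 by rewrite gt_eqF.
  have m1 : minor2 X o0 o1 != 0 by rewrite gt_eqF.
  have e k (M : 'M[R]_3) l : (M *m diag_mx D) k l = M k l * D 0 l.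
    by rewrite mul_mx_diag !mxE.
  apply/matrixP; apply: ord3_ind; apply: ord3_ind;
    rewrite !mxE sum3 !e !mxE /= ?E10 ?E20 ?E21 ?det3 ?E10 ?E20 ?E21;
    move: m1; rewrite /minor2 => m1; field; rewrite ?a1 ?m1 //.
exists (G *m S).
  rewrite trmx_mul {1}XE -SS /S tr_diag_mx -/S; by rewrite !mulmxA.
rewrite unitmxE unitfE det_mulmx; apply/eqP => h.
have := d0; rewrite XE !det_mulmx -SS det_mulmx det_tr.
have -> : \det G * (\det S * \det S) * \det G = (\det G * \det S) ^+ 2 by ring.
by rewrite h expr0n/= ltxx.
Qed.

Lemma spd_cholesky X : mx_spd X -> exists2 L : 'M[R]_3, X = L *m L^T & L \in unitmx.
Proof.
move=> sp; apply: cholesky; first exact: sp.1.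
- exact/posdef_diag/sp.2.
- exact: posdef_minor2.
- exact: posdef_det.
Qed.

(** Sylvester's criterion: by [cholesky] the form at [v] is the squared length of [L^T *m v]. *)
Lemma minors_spd X : mx_sym X -> 0 < X o0 o0 -> 0 < minor2 X o0 o1 -> 0 < \det X ->
  mx_spd X.
Proof.
move=> sX a0 m0 d0; split=> // v v0; have [L -> uL] := cholesky sX a0 m0 d0.
have -> : v^T *m (L *m L^T) *m v = (L^T *m v)^T *m (L^T *m v).
  by rewrite trmx_mul trmxK !mulmxA.
apply: sqnorm_gt0; apply: contra v0 => /eqP h.
by rewrite -[v]mul1mx -(@mulVmx _ _ L^T) ?unitmx_tr// -mulmxA h mulmx0.
Qed.

Lemma qf_ge0 X v : mx_posdef X -> 0 <= qf X v.
Proof.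
move=> pX; have [->|v0] := eqVneq v 0; first by rewrite /qf mulmx0 mxE.
exact/ltW/pX.
Qed.

Lemma spd_unit X : mx_spd X -> X \in unitmx.
Proof. by move=> sp; rewrite unitmxE unitfE gt_eqF// posdef_det. Qed.

Lemma sym_inv X : mx_sym X -> mx_sym (invmx X).
Proof. by move=> sX; rewrite /mx_sym trmx_inv sX. Qed.

Lemma qf_inv X v : mx_sym X -> X \in unitmx -> qf X (invmx X *m v) = qf (invmx X) v.
Proof.
move=> sX uX; rewrite /qf trmx_mul (sym_inv sX).
by rewrite -!mulmxA (mulmxA X) mulmxV// mul1mx.
Qed.

Lemma spd_inv X : mx_spd X -> mx_spd (invmx X).
Proof.
move=> sp; split; first exact: (sym_inv sp.1).
move=> v v0; rewrite -/(qf _ _) -(qf_inv _ sp.1 (spd_unit sp)).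
apply: sp.2; apply: contra v0 => /eqP h.
by rewrite -[v]mul1mx -(mulmxV (spd_unit sp)) -mulmxA h mulmx0.
Qed.

Lemma tr_sym_sqr Y : mx_sym Y -> \tr (Y *m Y) = \sum_(i < 3) \sum_(j < 3) Y i j ^+ 2.
Proof.
move=> sY; apply: eq_bigr => i _; rewrite mxE; apply: eq_bigr => j _.
by rewrite (sym_entry i j sY) expr2.
Qed.

Lemma tr_sym_sqr_ge0 Y : mx_sym Y -> 0 <= \tr (Y *m Y).
Proof.
move=> sY; rewrite tr_sym_sqr//; apply: sumr_ge0 => i _; apply: sumr_ge0 => j _.
exact: sqr_ge0.
Qed.

(** With [P = L L^T] the trace is that of the square of the symmetric matrix [L^T Y L]. *)
Lemma tr_conj_sqr_ge0 P Y : mx_spd P -> mx_sym Y -> 0 <= \tr (P *m Y *m P *m Y).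
Proof.
move=> /spd_cholesky[L -> uL] sY.
have -> : \tr (L *m L^T *m Y *m (L *m L^T) *m Y) =
    \tr ((L^T *m Y *m L) *m (L^T *m Y *m L)).
  by rewrite -!mulmxA mxtrace_mulC !mulmxA.
by apply: tr_sym_sqr_ge0; rewrite /mx_sym !trmx_mul trmxK sY mulmxA.
Qed.

(** Each of the nine terms is at most [b (v_i^2 + v_j^2) / 2]; the sum is [3 b] times the squared
    length. *)
Lemma qf_bound X v b : (forall i j, `|X i j| <= b) -> `|qf X v| <= 3 * b * sqnorm v.
Proof.
move=> Xb; rewrite qfE sqnormE.
have K i j : `|v i 0 * X i j * v j 0| <= b * ((v i 0 ^+ 2 + v j 0 ^+ 2) / 2).
  rewrite mulrAC normrM mulrC ler_pM// normrM.
  rewrite -(real_normK (num_real (v i 0))) -(real_normK (num_real (v j 0))).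
  by have := sqr_ge0 (`|v i 0| - `|v j 0|); rewrite sqrrB; lra.
apply: (le_trans (ler_norm_sum _ _ _)).
apply: (le_trans (ler_sum _ (fun i _ => ler_norm_sum _ _ _))).
apply: (@le_trans _ _ (\sum_(i < 3) \sum_(j < 3) b * ((v i 0 ^+ 2 + v j 0 ^+ 2) / 2))).
  by apply: ler_sum => i _; apply: ler_sum => j _; exact: K.
by rewrite !sum3; lra.
Qed.

(** With [K = 3 b] and [P = X^-1], the form is nonnegative at [K v - P v], which reads
    [0 <= K^2 qf X v - 2 K |v|^2 + qf P v]; [qf_bound] gives [qf P v <= K |v|^2]. *)
Lemma qf_lower X v b : mx_spd X -> 0 < b -> (forall i j, `|invmx X i j| <= b) ->
  sqnorm v <= 3 * b * qf X v.
Proof.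
move=> sp b0 Pb; have [sX pX] := sp.
pose K := 3 * b; pose P := invmx X.
have K0 : 0 < K by rewrite mulr_gt0.
have uX := spd_unit sp.
have h : qf X (K *: v - P *m v) = K ^+ 2 * qf X v - 2 * K * sqnorm v + qf P v.
  have uT : (K *: v - P *m v)^T = K *: v^T - v^T *m P.
    by rewrite linearB/= linearZ/= trmx_mul (sym_inv sX).
  rewrite -(qf_inv v sX uX) /qf /sqnorm uT trmx_mul (sym_inv sX) -/P.
  rewrite !mulmxBl !mulmxBr -!scalemxAl -!scalemxAr !mulmxA.
  rewrite -[_ *m X *m P]mulmxA mulmxV// mulmx1.
  have -> : v^T *m invmx X *m X *m v = v^T *m v by rewrite -[_ *m X]mulmxA mulVmx// mulmx1.
  by rewrite !mxE; ring.
have := qf_ge0 (K *: v - P *m v) pX; rewrite h => h1.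
have h2 := qf_bound v Pb; rewrite -/P -/K in h2.
have h3 := ler_norm (qf P v).
rewrite -/K -(ler_pM2l K0); nra.
Qed.

(** The lower bound applied to column [l] of the inverse [P] gives [a * P k l ^+ 2 <= P l l]. The
    case [k = l] yields [P l l <= a^-1], and then the general case follows. *)
Lemma inv_bound X a i j : mx_spd X -> 0 < a -> (forall v, a * sqnorm v <= qf X v) ->
  `|invmx X i j| <= a^-1.
Proof.
move=> sp a0 Xa; have [sX pX] := sp; have uX := spd_unit sp; set P := invmx X.
have key k l : a * P k l ^+ 2 <= P l l.
  have := Xa (P *m delta_mx l 0); rewrite qf_inv// /qf trmx_delta -rowE -!colE.
  rewrite [in X in _ <= X]mxE [in X in _ <= X]mxE => le1; apply: le_trans le1; rewrite ler_wpM2l ?(ltW a0)//.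
  have -> : sqnorm (col l P) = \sum_(m < 3) P m l ^+ 2.
    by rewrite sqnormE sum3 !mxE.
  rewrite (bigD1 k)//= lerDl; apply: sumr_ge0 => m _; exact: sqr_ge0.
have d l : P l l <= a^-1.
  have P0 := posdef_diag l (spd_inv sp).2; rewrite -/P in P0.
  by rewrite -[a^-1]mul1r ler_pdivlMr// -(ler_pM2r P0) mul1r [_ * a]mulrC -mulrA -expr2 key.
have : P i j ^+ 2 <= a^-1 ^+ 2.
  rewrite -(ler_pM2l a0) [a^-1 ^+ 2]expr2 [a * (a^-1 * _)]mulrA mulfV ?gt_eqF// mul1r.
  exact: le_trans (key i j) (d j).
rewrite -(real_normK (num_real (P i j))) ler_sqr// nnegrE ?normr_ge0// ltW//.
by rewrite invr_gt0.
Qed.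

(** The argument of [qf_lower] one level up: [tr (P Y P Y) >= 0] is expanded at [Y = X H X - K H]
    with [K = 9 b^2], and [tr (X H X H) <= K tr (H H)] holds by bounding entries. *)
Lemma tr_conj_sqr_lower X H b : mx_spd X -> mx_sym H -> 0 < b ->
  (forall i j, `|X i j| <= b) ->
  \tr (H *m H) <= 9 * b ^+ 2 * \tr (invmx X *m H *m invmx X *m H).
Proof.
move=> sp sH b0 Xb; have [sX pX] := sp; set P := invmx X; have uX := spd_unit sp.
pose K := 9 * b ^+ 2.
have K0 : 0 < K by rewrite mulr_gt0// exprn_gt0.
have sY : mx_sym (X *m H *m X - K *: H).
  by rewrite /mx_sym linearB/= linearZ/= !trmx_mul sX sH mulmxA.
have := tr_conj_sqr_ge0 (spd_inv sp) sY; rewrite -/P.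
have -> : \tr (P *m (X *m H *m X - K *: H) *m P *m (X *m H *m X - K *: H)) =
   \tr (X *m H *m X *m H) - 2 * K * \tr (H *m H) + K ^+ 2 * \tr (P *m H *m P *m H).
  have PY : P *m (X *m H *m X - K *: H) = H *m X - K *: (P *m H).
    by rewrite mulmxBr -scalemxAr !mulmxA mulVmx// mul1mx.
  rewrite -mulmxA PY mulmxBl !mulmxBr -!scalemxAl -!scalemxAr !mulmxA.
  rewrite -[H *m X *m P]mulmxA mulmxV// mulmx1 !linearB/= !linearZ/=.
  rewrite [\tr (P *m H *m H *m X)]mxtrace_mulC !mulmxA mulmxV// mul1mx.
  rewrite [\tr (H *m X *m H *m X)]mxtrace_mulC !mulmxA -![_ *: _]/(_ * _); ring.
move=> h1.
have : \tr (X *m H *m X *m H) <= K * \tr (H *m H).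
  have -> : \tr (X *m H *m X *m H) = \sum_(i < 3) \sum_(j < 3) \sum_(k < 3) \sum_(l < 3)
      X i j * H j k * X k l * H l i.
    rewrite /mxtrace; apply: eq_bigr => i _; rewrite !mxE !sum3 !mxE !sum3 !mxE !sum3; ring.
  rewrite tr_sym_sqr//.
  apply: (@le_trans _ _ (\sum_(i < 3) \sum_(j < 3) \sum_(k < 3) \sum_(l < 3)
      b ^+ 2 * ((H j k ^+ 2 + H l i ^+ 2) / 2))).
    apply: ler_sum => i _; apply: ler_sum => j _; apply: ler_sum => k _; apply: ler_sum => l _.
    apply: (le_trans (ler_norm _)).
    have -> : X i j * H j k * X k l * H l i = (X i j * X k l) * (H j k * H l i) by ring.
    rewrite normrM ler_pM//; first by rewrite normrM expr2 ler_pM.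
    rewrite normrM -(real_normK (num_real (H j k))) -(real_normK (num_real (H l i))).
    by have := sqr_ge0 (`|H j k| - `|H l i|); rewrite sqrrB; lra.
  by rewrite !sum3 /K le_eqVlt; apply/orP; left; apply/eqP; field.
rewrite -/K => h2; rewrite -(ler_pM2l K0).
move: K0 h1 h2; rewrite -/P; clearbody K.
move: (\tr (X *m H *m X *m H)) (\tr (H *m H)) (\tr (P *m H *m P *m H)) => x y z.
by move=> K0 h1 h2; rewrite mulrA -expr2; lra.
Qed.
End Matrix3.

(** * Symmetrisation over the permutations of four indices *)

Section Perm4.
Variable R : realType.

(** A permutation is the image of [0] together with a permutation of the remaining points, as in the
    row expansion of a determinant. Four uses turn a sum over ['S_4] into 24 explicit terms. *)
Lemma sum_perm_lift (V : nmodType) n (f : 'S_n.+1 -> V) :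
  \sum_(s : 'S_n.+1) f s = \sum_(j < n.+1) \sum_(s : 'S_n) f (lift_perm ord0 j s).
Proof.
rewrite (partition_big (fun s : 'S_n.+1 => s ord0) predT)//=.
apply: eq_bigr => j _; rewrite (reindex (lift_perm ord0 j)); last first.
  pose ulsf i (s : 'S_n.+1) k := odflt k (unlift (s i) (s (lift i k))).
  have ulsfK i (s : 'S_n.+1) k : lift (s i) (ulsf i s k) = s (lift i k).
    rewrite /ulsf; have:= neq_lift i k.
    by rewrite -(can_eq (permK s)) => /unlift_some[] ? ? ->.
  have inj_ulsf : injective (ulsf ord0 _).
    move=> s; apply: can_inj (ulsf (s ord0) s^-1%g) _ => k'.
    by rewrite {1}/ulsf ulsfK !permK liftK.
  exists (fun s => perm (inj_ulsf s)) => [s _ | s].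
    by apply/permP=> k'; rewrite permE /ulsf lift_perm_lift lift_perm_id liftK.
  move/(s _ =P _) => si0; apply/permP=> k.
  by case: (unliftP ord0 k) => [k'|] ->; rewrite ?lift_perm_id //= lift_perm_lift permE -si0 ulsfK.
by apply: eq_bigl => s; rewrite lift_perm_id eqxx.
Qed.

(** For symmetric [P] the 24 permutations fall into the three pairings of four indices, each
    occurring eight times. *)
Lemma Ssym_tprod (P : 'M[R]_3) i j k l : mx_sym P ->
  Ssym (tprod P P) i j k l =
  3^-1 * (P i j * P k l + P i k * P j l + P i l * P j k).
Proof.
move=> sP; have sE a b : P b a = P a b by rewrite -[in LHS]sP mxE.
rewrite /Ssym /tprod.
have -> : ord0 = inord 0 :> 'I_4 by apply/val_inj; rewrite /= inordK.
pose x := [:: i; j; k; l].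
have tE (m : 'I_4) : tnth [tuple i; j; k; l] m = nth i x m by rewrite (tnth_nth i).
under eq_bigr do rewrite !tE.
rewrite sum_perm_lift; under eq_bigr do (rewrite sum_perm_lift; under eq_bigr do (rewrite sum_perm_lift; under eq_bigr do rewrite sum_perm_lift)).
have e0 : inord 0 = ord0 :> 'I_4 by apply/val_inj; rewrite /= inordK.
have e1 : inord 1 = lift ord0 ord0 :> 'I_4 by apply/val_inj; rewrite /= inordK.
have e2 : inord 2 = lift ord0 (lift ord0 ord0) :> 'I_4 by apply/val_inj; rewrite /= inordK.
have e3 : inord 3 = lift ord0 (lift ord0 (lift ord0 ord0)) :> 'I_4 by apply/val_inj; rewrite /= inordK.
rewrite e0 e1 e2 e3.
under eq_bigr do under eq_bigr do under eq_bigr do under eq_bigr do under eq_bigr do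
 rewrite ?(lift_perm_id, lift_perm_lift).
have S1 (c : R) : \sum_(s : 'S_0) c = c.
  by rewrite sumr_const card_Sn /= mulr1n.
under eq_bigr do under eq_bigr do under eq_bigr do under eq_bigr do rewrite S1.
rewrite !big_ord_recl !big_ord0 /x /= /bump /= ?addn0 ?add0n /=.
rewrite (sE i j) (sE i k) (sE i l) (sE j k) (sE j l) (sE k l).
by field.
Qed.
End Perm4.

(** * Integrals over the half-line *)

Section Integral.
Variable R : realType.
Implicit Types (f g F : R -> R).
Local Notation mu := (@lebesgue_measure R).
Local Notation half := (`[0%R, +oo[%classic : set R).

Lemma is_drv_cst (k x : R) : is_derive x 1 (fun=> k) 0.
Proof. exact: is_derive_cst. Qed.

Lemma is_drv_id (x : R) : is_derive x 1 (fun y : R => y) 1.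
Proof. exact: is_derive_id. Qed.

Lemma is_drv_add f g (x a b : R) : is_derive x 1 f a -> is_derive x 1 g b ->
  is_derive x 1 (fun y => f y + g y) (a + b).
Proof. exact: is_deriveD. Qed.

Lemma is_drv_opp f (x a : R) : is_derive x 1 f a -> is_derive x 1 (fun y => - f y) (- a).
Proof. exact: is_deriveN. Qed.

Lemma is_drv_sub f g (x a b : R) : is_derive x 1 f a -> is_derive x 1 g b ->
  is_derive x 1 (fun y => f y - g y) (a - b).
Proof. exact: is_deriveB. Qed.

Lemma is_drv_mul f g (x a b : R) : is_derive x 1 f a -> is_derive x 1 g b ->
  is_derive x 1 (fun y => f y * g y) (a * g x + f x * b).
Proof.
move=> df dg; have /is_derive_eq := is_deriveM df dg; apply.
by rewrite -![_ *: _]/(_ * _); ring.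
Qed.

Lemma is_drv_scale k f (x a : R) : is_derive x 1 f a ->
  is_derive x 1 (fun y => k * f y) (k * a).
Proof. by move=> df; have := is_drv_mul (is_drv_cst k x) df; rewrite mul0r add0r. Qed.

Lemma is_drv_inv f (x a : R) : f x != 0 -> is_derive x 1 f a ->
  is_derive x 1 (fun y => (f y)^-1) (- (f x ^- 2 * a)).
Proof.
move=> f0 df; have /is_derive_eq := is_deriveV f0 df; apply.
by rewrite -[_ *: _]/(_ * _) mulNr.
Qed.

(** The reference weight: its integral over the half-line is exactly 1, so a pointwise bound
    [c * wt] becomes the bound [c] on the integral. *)
Definition wt (s : R) : R := (1 + s) ^- 2.

Lemma wt_ge0 s : 0 <= wt s.
Proof. by rewrite invr_ge0 sqr_ge0. Qed.

Lemma is_derive_wt_primitive (s : R) : 0 <= s ->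
  is_derive s 1 (fun x : R => - (1 + x)^-1) (wt s).
Proof.
move=> s0; have h : 1 + s != 0 by rewrite gt_eqF// ltr_pwDl.
have := is_drv_opp (is_drv_inv h (is_drv_add (is_drv_cst 1 s) (is_drv_id s))).
by move/is_derive_eq; apply; rewrite opprK add0r mulr1.
Qed.

Lemma within_halfP f : (forall s, 0 <= s -> {for s, continuous f}) ->
  {within half, continuous f}.
Proof.
move=> cf; apply: continuous_in_subspaceT => x; rewrite inE/= in_itv/= andbT; exact: cf.
Qed.

Lemma derivable_continuous_at f (x df : R) : is_derive x 1 f df -> {for x, continuous f}.
Proof.
by move=> h; apply/differentiable_continuous/derivable1_diffP; exact: ex_derive.
Qed.

Lemma continuous_wt s : 0 <= s -> {for s, continuous wt}.
Proof.
move=> s0; have h : (1 + s) * (1 + s) != 0 by rewrite mulf_neq0// gt_eqF// ltr_pwDl.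
have d1 := is_drv_add (is_drv_cst 1 s) (is_drv_id s).
rewrite (_ : wt = fun x => ((1 + x) * (1 + x))^-1); last first.
  by apply/funext => x; rewrite /wt expr2.
exact: derivable_continuous_at
  (@is_drv_inv (fun x => (1 + x) * (1 + x)) _ _ h (is_drv_mul d1 d1)).
Qed.

Lemma cvg_inv1D : (fun x : R => (1 + x)^-1) @ +oo --> (0 : R).
Proof.
apply/cvgrPdist_le => e e0; near=> x.
have x0 : e^-1 <= x by near: x; apply: nbhs_pinfty_ge; exact: num_real.
have ei : 0 < e^-1 by rewrite invr_gt0.
have x1 : 0 < 1 + x by rewrite ltr_pwDl// (le_trans (ltW ei)).
rewrite sub0r normrN gtr0_norm ?invr_gt0// -[e]invrK lef_pV2// ?posrE//.
by rewrite (le_trans x0)// lerDr.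
Unshelve. all: by end_near. Qed.

Lemma integral_wt : int0oo wt = 1 /\ mu.-integrable half (EFin \o wt).
Proof.
have P : (\int[mu]_(x in half) (wt x)%:E = 0%:E - (- (1 + 0)^-1 : R)%:E)%E.
  apply: (@ge0_continuous_FTC2y _ wt (fun x : R => - (1 + x)^-1)).
  - by move=> x _; exact: wt_ge0.
  - exact: within_halfP continuous_wt.
  - by rewrite -oppr0; apply: cvgN; exact: cvg_inv1D.
  - by move=> x x0; exact: (@ex_derive _ _ _ _ _ _ _ (is_derive_wt_primitive (ltW x0))).
  - apply: cvg_at_right_filter.
    exact: derivable_continuous_at (is_derive_wt_primitive (lexx 0)).
  - move=> x; rewrite in_itv/= andbT => x0; rewrite derive1E.
    exact: (@derive_val _ _ _ _ _ _ _ (is_derive_wt_primitive (ltW x0))).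
rewrite addr0 invr1 EFinN oppeK add0e in P.
split; first by rewrite /int0oo /Rintegral P.
apply/integrableP; split.
  apply/measurable_EFinP; apply: subspace_continuous_measurable_fun => //.
  exact: within_halfP continuous_wt.
under eq_integral do rewrite /comp abse_EFin ger0_norm ?wt_ge0//.
by rewrite P ltry.
Qed.

(** The only form of integrability used below; it is stable under linear combinations and makes
    every integral finite. *)
Definition dominated f := (forall s, 0 <= s -> {for s, continuous f}) /\
  exists c, forall s, 0 <= s -> `|f s| <= c * wt s.

Lemma dominated_integrable f : dominated f -> mu.-integrable half (EFin \o f).
Proof.
move=> [cf [c fc]].
have mf : measurable_fun half (EFin \o f).
  apply/measurable_EFinP; apply: subspace_continuous_measurable_fun => //.
  exact: within_halfP.
apply: (@le_integrable _ _ _ mu half _ _ (EFin \o (fun s => c * wt s))) => //.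
  move=> s; rewrite /= in_itv/= andbT => s0; rewrite lee_fin.
  by rewrite (le_trans (fc _ s0))// ler_norm.
rewrite (_ : _ \o _ = fun s => (c%:E * (EFin \o wt) s)%E); last by apply/funext => s; rewrite /= EFinM.
by apply: integrableZl => //; exact: integral_wt.2.
Qed.

Lemma dominated_wt : dominated wt.
Proof.
split; first exact: continuous_wt.
by exists 1 => s s0; rewrite mul1r ger0_norm// wt_ge0.
Qed.

Lemma dominatedD f g : dominated f -> dominated g -> dominated (fun s => f s + g s).
Proof.
move=> [cf [c fc]] [cg [d gd]]; split.
  by move=> s s0; apply: continuousD; [exact: cf|exact: cg].
exists (c + d) => s s0; rewrite mulrDl (le_trans (ler_normD _ _))// lerD//; [exact: fc|exact: gd].
Qed.

Lemma dominatedZ k f : dominated f -> dominated (fun s => k * f s).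
Proof.
move=> [cf [c fc]]; split.
  by move=> s s0; apply: continuousM; [exact: cst_continuous|exact: cf].
by exists (`|k| * c) => s s0; rewrite normrM -mulrA ler_wpM2l//; exact: fc.
Qed.

Lemma dominated_sum (I : Type) (r : seq I) (h : I -> R -> R) :
  (forall i, dominated (h i)) -> dominated (fun s => \sum_(i <- r) h i s).
Proof.
move=> dh; elim: r => [|i r IH].
  rewrite (_ : (fun _ => _) = fun=> 0); last by apply/funext => s; rewrite big_nil.
  split; first by move=> s _; exact: cst_continuous.
  by exists 0 => s s0; rewrite normr0 mul0r.
rewrite (_ : (fun _ => _) = fun s => h i s + \sum_(j <- r) h j s); last first.
  by apply/funext => s; rewrite big_cons.
exact: dominatedD.
Qed.

Lemma eq_int0oo f g : (forall s, 0 <= s -> f s = g s) -> int0oo f = int0oo g.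
Proof.
by move=> fg; apply: eq_Rintegral => s; rewrite inE/= in_itv/= andbT => s0; exact: fg.
Qed.

Lemma int0ooD f g : dominated f -> dominated g ->
  int0oo (fun s => f s + g s) = int0oo f + int0oo g.
Proof. by move=> df dg; apply: RintegralD => //; exact: dominated_integrable. Qed.

Lemma int0ooZ k f : dominated f -> int0oo (fun s => k * f s) = k * int0oo f.
Proof. by move=> df; apply: RintegralZl => //; exact: dominated_integrable. Qed.

Lemma int0oo_sum (I : Type) (r : seq I) (h : I -> R -> R) :
  (forall i, dominated (h i)) ->
  int0oo (fun s => \sum_(i <- r) h i s) = \sum_(i <- r) int0oo (h i).
Proof.
move=> dh; elim: r => [|i r IH].
  rewrite big_nil (@eq_int0oo _ (fun s => 0 * wt s)); last first.
    by move=> s _; rewrite big_nil mul0r.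
  by rewrite (int0ooZ _ dominated_wt) mul0r.
rewrite big_cons -IH -int0ooD//; last exact: dominated_sum.
by apply: eq_int0oo => s _; rewrite big_cons.
Qed.

Lemma le_int0oo f g : dominated f -> dominated g -> (forall s, 0 <= s -> f s <= g s) ->
  int0oo f <= int0oo g.
Proof.
move=> df dg fg; apply: le_Rintegral => //; try exact: dominated_integrable.
by move=> s; rewrite /= in_itv/= andbT => s0; exact: fg.
Qed.

Lemma norm_int0oo_le f c : dominated f -> (forall s, 0 <= s -> `|f s| <= c * wt s) ->
  `|int0oo f| <= c.
Proof.
move=> df fc.
have dc : dominated (fun s => c * wt s) by apply: dominatedZ; exact: dominated_wt.
have Ic : int0oo (fun s => c * wt s) = c.
  by rewrite (int0ooZ _ dominated_wt) integral_wt.1 mulr1.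
rewrite ler_norml; apply/andP; split; last first.
  by rewrite -Ic; apply: le_int0oo => // s s0; rewrite (le_trans (ler_norm _))// fc.
rewrite -mulN1r -[X in _ * X]Ic -int0ooZ//; apply: le_int0oo => //; first exact: dominatedZ.
by move=> s s0; have := fc s s0; rewrite ler_norml mulN1r => /andP[].
Qed.

(** Adding [k * wt], which majorises [|f|], makes the integrand nonnegative, as the half-line
    theorem applied here requires; the added part integrates to [k] and is removed again. The bound
    on [F] makes it vanish at infinity. *)
Lemma int0oo_FTC f F (c : R) : dominated f ->
  (forall s : R, 0 <= s -> is_derive s 1 F (f s)) ->
  (forall s : R, 0 <= s -> `|F s| <= c * (1 + s)^-1) ->
  int0oo f = - F 0.
Proof.
move=> df dF Fc; have [cf [k fk]] := df.
pose f1 s := f s + k * wt s; pose F1 s := F s + k * - (1 + s)^-1.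
have dk : dominated (fun s => k * wt s) by apply: dominatedZ; exact: dominated_wt.
have dF1 (s : R) : 0 <= s -> is_derive s 1 F1 (f1 s).
  move=> s0; apply: is_drv_add; first exact: dF.
  exact: is_drv_scale (is_derive_wt_primitive s0).
have I1 : int0oo f1 = 0 - F1 0.
  apply: Rintegral_ge0_continuous_FTC2y.
  - move=> s s0; have := fk s s0; rewrite ler_norml => /andP[].
    by rewrite /f1 -subr_ge0 opprK.
  - apply: within_halfP => s s0; exact: (dominatedD df dk).1.
  - apply: (@cvg_trans _ (F1 @ +oo)) => //.
    rewrite (_ : 0 = 0 + k * - 0 :> R); last by rewrite oppr0 mulr0 addr0.
    apply: cvgD; last by apply: cvgMr; apply: cvgN; exact: cvg_inv1D.
    apply: norm_cvg0.
    apply: (@squeeze_cvgr _ _ _ _ (cst 0) (fun s => c * (1 + s)^-1)).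
    + near=> s; rewrite normr_ge0 Fc//; near: s; apply: nbhs_pinfty_ge; exact: num_real.
    + exact: cvg_cst.
    + by rewrite -(mulr0 c); apply: cvgMr; exact: cvg_inv1D.
  - by move=> s s0; exact: (@ex_derive _ _ _ _ _ _ _ (dF1 _ (ltW s0))).
  - by apply: cvg_at_right_filter; exact: derivable_continuous_at (dF1 _ (lexx 0)).
  - move=> s; rewrite in_itv/= andbT => s0; rewrite derive1E.
    exact: (@derive_val _ _ _ _ _ _ _ (dF1 _ (ltW s0))).
have := int0ooD df dk; rewrite -/f1 I1 (int0ooZ _ dominated_wt) integral_wt.1 mulr1.
by rewrite /F1 addr0 invr1; lra.
Unshelve. all: by end_near. Qed.

End Integral.

(** * The integrands of A and C *)

Section Pointwise.
Variable R : realType.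
Implicit Types (B X Y H P : 'M[R]_3) (rho s e b : R).

Section Path.
Variables (X : R -> 'M[R]_3) (H : 'M[R]_3) (x : R).
Hypothesis dX : forall i j, is_derive x 1 (fun y => X y i j) (H i j).

(** Jacobi's formula, with the adjugate so that it also holds where [X x] is singular. *)
Lemma derive_det : is_derive x 1 (fun y => \det (X y)) (\tr (adj3 (X x) *m H)).
Proof.
rewrite (_ : (fun y => _) = fun y =>
  X y o0 o0 * (X y o1 o1 * X y o2 o2 - X y o1 o2 * X y o2 o1)
  - X y o0 o1 * (X y o1 o0 * X y o2 o2 - X y o1 o2 * X y o2 o0)
  + X y o0 o2 * (X y o1 o0 * X y o2 o1 - X y o1 o1 * X y o2 o0)); last first.
  by apply/funext => y; rewrite det3.
pose m (i1 j1 i2 j2 : 'I_3) := is_drv_mul (dX i1 j1) (dX i2 j2).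
have := is_drv_add (is_drv_sub
  (is_drv_mul (dX o0 o0) (is_drv_sub (m o1 o1 o2 o2) (m o1 o2 o2 o1)))
  (is_drv_mul (dX o0 o1) (is_drv_sub (m o1 o0 o2 o2) (m o1 o2 o2 o0))))
  (is_drv_mul (dX o0 o2) (is_drv_sub (m o1 o0 o2 o1) (m o1 o1 o2 o0))).
move/is_derive_eq; apply.
by rewrite /mxtrace sum3 !mxE !sum3 !mxE /cyc3 /=; ring.
Qed.

Hypothesis d0 : 0 < \det (X x).

Lemma near_det_gt0 : \forall y \near x, 0 < \det (X y).
Proof. exact: (cvgr_gt _ (derivable_continuous_at derive_det) _ d0). Qed.

Lemma derive_invmx i j : is_derive x 1 (fun y => invmx (X y) i j)
  (- (invmx (X x) *m H *m invmx (X x)) i j).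
Proof.
have d1 : \det (X x) != 0 by rewrite gt_eqF.
apply: (@near_eq_is_derive _ _ _ (fun y => (\det (X y))^-1 * adj3 (X y) i j)).
- near=> y; rewrite invmx3 ?mxE// gt_eqF//.
  by near: y; exact: near_det_gt0.
rewrite (_ : (fun y => _) = fun y => (\det (X y))^-1 *
  (X y (cyc3 j) (cyc3 i) * X y (cyc3 (cyc3 j)) (cyc3 (cyc3 i))
   - X y (cyc3 j) (cyc3 (cyc3 i)) * X y (cyc3 (cyc3 j)) (cyc3 i))); last first.
  by apply/funext => y; rewrite mxE.
pose m (i1 j1 i2 j2 : 'I_3) := is_drv_mul (dX i1 j1) (dX i2 j2).
have := is_drv_mul (@is_drv_inv _ (fun y => \det (X y)) _ _ d1 derive_det)
  (is_drv_sub (m (cyc3 j) (cyc3 i) (cyc3 (cyc3 j)) (cyc3 (cyc3 i)))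
              (m (cyc3 j) (cyc3 (cyc3 i)) (cyc3 (cyc3 j)) (cyc3 i))).
move/is_derive_eq; apply; rewrite invmx3//.
move: d1; move: (X x) => Z d1.
(* Separates the division by determinants from the polynomial identity
   [adj tr(adj H) - det adj' = adj H adj], which is then checked entry by entry. *)
have hc (a c t u : R) : a * c - \det Z * t = u ->
    - (\det Z ^- 2 * a) * c + (\det Z)^-1 * t = - ((\det Z)^-1 * (\det Z)^-1 * u).
  by move=> <-; field.
rewrite -!scalemxAl -!scalemxAr scalerA mxE; apply: hc.
by move: i j; apply: ord3_ind; apply: ord3_ind;
  rewrite /mxtrace sum3 det3 !mxE !sum3 !mxE !sum3 !mxE /cyc3 /=; ring.
Unshelve. all: by end_near. Qed.

Lemma derive_sqrtdet : is_derive x 1 (fun y => (Num.sqrt (\det (X y)))^-1)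
  (- (2^-1 * \tr (invmx (X x) *m H) * (Num.sqrt (\det (X x)))^-1)).
Proof.
have d1 : \det (X x) != 0 by rewrite gt_eqF.
have s0 : Num.sqrt (\det (X x)) != 0 by rewrite gt_eqF// sqrtr_gt0.
have ds : is_derive x 1 (fun y => Num.sqrt (\det (X y)))
    ((2 * Num.sqrt (\det (X x)))^-1 * \tr (adj3 (X x) *m H)).
  have := @is_derive1_comp _ Num.sqrt (fun y => \det (X y)) x _ _
    (is_derive1_sqrt d0) derive_det.
  by rewrite mulrC.
have := @is_drv_inv _ (fun y => Num.sqrt (\det (X y))) _ _ s0 ds.
move/is_derive_eq; apply; rewrite invmx3// -scalemxAl mxtraceZ.
have E : \det (X x) = Num.sqrt (\det (X x)) ^+ 2 by rewrite sqr_sqrtr// ltW.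
rewrite [(\det (X x))^-1](_ : _ = (Num.sqrt (\det (X x)) ^+ 2)^-1); last by rewrite -E.
by field.
Qed.
End Path.

Lemma detmx_le X b : (forall i j, `|X i j| <= b) -> `|\det X| <= 6 * b ^+ 3.
Proof.
move=> Xb; have b0 : 0 <= b by apply: le_trans (Xb o0 o0).
have t i j k l m n : `|X i j * X k l * X m n| <= b ^+ 3.
  by rewrite 2!exprSr expr1 !normrM !ler_pM// mulr_ge0.
have := t o0 o0 o1 o1 o2 o2; have := t o0 o0 o1 o2 o2 o1; have := t o0 o1 o1 o0 o2 o2.
have := t o0 o1 o1 o2 o2 o0; have := t o0 o2 o1 o0 o2 o1; have := t o0 o2 o1 o1 o2 o0.
rewrite det3 !ler_norml => /andP[a1 a2] /andP[b1 b2] /andP[c1 c2] /andP[e1 e2]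
  /andP[f1 f2] /andP[g1 g2].
by apply/andP; split; lra.
Qed.

Lemma mul_diff (a c da dc y z y' z' : R) : `|y'| <= a -> `|z| <= c ->
  `|y - y'| <= da -> `|z - z'| <= dc -> `|y * z - y' * z'| <= da * c + a * dc.
Proof.
move=> ya zc dy dz.
have -> : y * z - y' * z' = (y - y') * z + y' * (z - z') by ring.
by rewrite (le_trans (ler_normD _ _))// lerD// normrM ler_pM.
Qed.

Lemma detmx_diff X Y b e : (forall i j, `|X i j| <= b) -> (forall i j, `|Y i j| <= b) ->
  (forall i j, `|X i j - Y i j| <= e) -> `|\det X - \det Y| <= 18 * b ^+ 2 * e.
Proof.
move=> Xb Yb XY; have b0 : 0 <= b by apply: le_trans (Xb o0 o0).
have t i j k l m n : `|X i j * X k l * X m n - Y i j * Y k l * Y m n| <= 3 * b ^+ 2 * e.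
  have -> : 3 * b ^+ 2 * e = (e * b + b * e) * b + (b * b) * e by ring.
  apply: mul_diff => //; first by rewrite normrM ler_pM.
  exact: mul_diff.
have := t o0 o0 o1 o1 o2 o2; have := t o0 o0 o1 o2 o2 o1; have := t o0 o1 o1 o0 o2 o2.
have := t o0 o1 o1 o2 o2 o0; have := t o0 o2 o1 o0 o2 o1; have := t o0 o2 o1 o1 o2 o0.
rewrite !det3 !ler_norml => /andP[a1 a2] /andP[b1 b2] /andP[c1 c2] /andP[e1 e2]
  /andP[f1 f2] /andP[g1 g2].
by apply/andP; split; lra.
Qed.

Lemma mulmx3_le X H P (a c d : R) i j : (forall i j, `|X i j| <= a) ->
  (forall i j, `|H i j| <= c) -> (forall i j, `|P i j| <= d) ->
  `|(X *m H *m P) i j| <= 9 * (a * c * d).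
Proof.
move=> Xa Hc Pd.
have -> : (X *m H *m P) i j = \sum_(k < 3) \sum_(l < 3) X i l * H l k * P k j.
  by rewrite mxE; apply: eq_bigr => k _; rewrite mxE big_distrl.
apply: (le_trans (ler_norm_sum _ _ _)).
apply: (le_trans (ler_sum _ (fun i _ => ler_norm_sum _ _ _))).
apply: (@le_trans _ _ (\sum_(k < 3) \sum_(l < 3) (a * c * d))).
  apply: ler_sum => k _; apply: ler_sum => l _; rewrite !normrM.
  by rewrite ler_pM// ?mulr_ge0// ler_pM.
by rewrite !sum3; lra.
Qed.

Definition resolvent B s := invmx (Bs B s).
Definition weight B s := (Num.sqrt (\det (Bs B s)))^-1.

Lemma sym_Bs B s : mx_sym B -> mx_sym (Bs B s).
Proof. by move=> sB; rewrite /mx_sym /Bs linearD/= sB tr_scalar_mx. Qed.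

Lemma spd_Bs B s : mx_spd B -> 0 <= s -> mx_spd (Bs B s).
Proof.
move=> [sB pB] s0; split; first exact: sym_Bs.
move=> v v0; rewrite -/(qf _ _) /Bs qfD qf_scalar.
by rewrite ltr_pwDl ?pB// mulr_ge0// sqnorm_ge0.
Qed.

(** Two-sided ellipticity without eigenvalues. The condition [1 <= rho] makes powers of [rho]
    comparable, so that constants can be rounded up. *)
Definition ellip rho B :=
  [/\ 1 <= rho, mx_sym B, forall v, sqnorm v <= rho * qf B v & forall i j, `|B i j| <= rho].

Lemma ellip_spd rho B : ellip rho B -> mx_spd B.
Proof.
move=> [r1 sB lB uB]; split=> // v /sqnorm_gt0 v0; have := lt_le_trans v0 (lB v).
by rewrite pmulr_rgt0// (lt_le_trans _ r1).
Qed.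

Lemma derive_Bs B s i j : is_derive s 1 (fun t => Bs B t i j) ((1%:M : 'M[R]_3) i j).
Proof.
rewrite (_ : (fun t => _) = fun t => B i j + (i == j)%:R * t); last first.
  by apply/funext => t; rewrite !mxE mulr_natl.
have := is_drv_add (is_drv_cst (B i j) s) (is_drv_scale (i == j)%:R (is_drv_id s)).
by move/is_derive_eq; apply; rewrite mxE add0r mulr1.
Qed.

Section Bounds.
Variables (rho : R) (B : 'M[R]_3).
Hypothesis eB : ellip rho B.
Variable s : R.
Hypothesis s0 : 0 <= s.
Let q := (1 + s)^-1.

Lemma q_gt0 : 0 < q. Proof. by rewrite invr_gt0 ltr_pwDl. Qed.
Lemma q_le1 : q <= 1. Proof. by rewrite invf_le1 ?ltr_pwDl// lerDl. Qed.
Lemma rho_ge1 : 1 <= rho. Proof. by case: eB. Qed.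
Lemma rho_gt0 : 0 < rho. Proof. exact: lt_le_trans rho_ge1. Qed.

Lemma det_Bs_gt0 : 0 < \det (Bs B s).
Proof. exact: posdef_det (spd_Bs (ellip_spd eB) s0). Qed.

Lemma Bs_le i j : `|Bs B s i j| <= rho * (1 + s).
Proof.
have [r1 _ _ uB] := eB.
rewrite !mxE (le_trans (ler_normD _ _))// mulrDr mulr1 lerD//.
case: (i == j); first by rewrite mulr1n ger0_norm// ler_peMl.
by rewrite mulr0n normr0 mulr_ge0// ltW// rho_gt0.
Qed.

(** As [rho >= 1], the form of [B + s] is at least [(1 + s) / rho] times the squared length, and
    [inv_bound] applies. *)
Lemma resolvent_le i j : `|resolvent B s i j| <= rho * q.
Proof.
have -> : rho * q = (rho^-1 * (1 + s))^-1 by rewrite invfM invrK.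
have r0 := rho_gt0; have [r1 sB lB _] := eB.
apply: inv_bound.
- exact: spd_Bs (ellip_spd eB) s0.
- by rewrite mulr_gt0 ?invr_gt0// ltr_pwDl.
- move=> v; rewrite /Bs qfD qf_scalar mulrDr mulr1 mulrDl lerD//.
    by rewrite ler_pdivrMl.
  by rewrite ler_wpM2r ?sqnorm_ge0// ler_piMl// invf_le1.
Qed.

Lemma weight_gt0 : 0 < weight B s.
Proof. by rewrite invr_gt0 sqrtr_gt0 det_Bs_gt0. Qed.

Lemma weight_sqr : weight B s ^+ 2 = \det (resolvent B s).
Proof. by rewrite /weight exprVn sqr_sqrtr ?ltW ?det_Bs_gt0// det_inv. Qed.

(** The square of the weight is a determinant, at most [6 (rho q)^3], which is rounded up to the
    perfect square [(3 rho^2 q)^2]. The lost half power of [q] is harmless: the resolvent supplies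
    the second factor [q] of [wt]. *)
Lemma weight_le : weight B s <= 3 * rho ^+ 2 * q.
Proof.
have r0 := rho_gt0; have r1 := rho_ge1; have q0 := q_gt0; have q1 := q_le1.
have w0 := weight_gt0.
have y0 : 0 <= 3 * rho ^+ 2 * q by rewrite !mulr_ge0// ?sqr_ge0 ?(ltW q0) ?(ltW r0).
rewrite -(@ler_pXn2r _ 2)// ?nnegrE ?(ltW w0)//.
rewrite weight_sqr; apply: (le_trans (ler_norm _)); apply: (le_trans (detmx_le resolvent_le)).
have -> : (3 * rho ^+ 2 * q) ^+ 2 = 9 * ((rho * q) ^+ 2 * (rho * rho)) by ring.
have -> : 6 * (rho * q) ^+ 3 = 6 * ((rho * q) ^+ 2 * (rho * q)) by ring.
have rq0 : 0 <= rho * q by rewrite mulr_ge0 ?ltW.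
apply: ler_pM => //; [by rewrite mulr_ge0 ?sqr_ge0|by rewrite ler_nat|].
by rewrite ler_wpM2l ?sqr_ge0// ler_wpM2l ?(ltW r0)// (le_trans q1).
Qed.

Lemma weight_ge : (3 * rho ^+ 2 * (1 + s) ^+ 2)^-1 <= weight B s.
Proof.
have r0 := rho_gt0; have r1 := rho_ge1; have d0 := det_Bs_gt0.
have s1 : 0 < 1 + s by rewrite ltr_pwDl.
rewrite lef_pV2 ?posrE ?sqrtr_gt0// ?mulr_gt0 ?exprn_gt0//.
have y0 : 0 <= 3 * rho ^+ 2 * (1 + s) ^+ 2 by rewrite !mulr_ge0// ?sqr_ge0 ?(ltW r0) ?(ltW s1).
rewrite -(@ler_pXn2r _ 2)// ?nnegrE ?sqrtr_ge0//.
rewrite sqr_sqrtr ?(ltW d0)//; apply: (le_trans (ler_norm _)); apply: (le_trans (detmx_le Bs_le)).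
have -> : (3 * rho ^+ 2 * (1 + s) ^+ 2) ^+ 2 = 9 * ((rho * (1 + s)) ^+ 3 * (rho * (1 + s))) by ring.
have rs : 1 <= rho * (1 + s) by rewrite mulr_ege1// lerDl.
have rs0 := le_trans ler01 rs.
apply: ler_pM => //; [by rewrite exprn_ge0|by rewrite ler_nat|].
by rewrite ler_peMr// exprn_ge0// (le_trans _ rs).
Qed.

Lemma tr_resolvent_ge H : mx_sym H ->
  (9 * rho ^+ 2 * (1 + s) ^+ 2)^-1 * \tr (H *m H) <= \tr (resolvent B s *m H *m resolvent B s *m H).
Proof.
move=> sH; have r0 := rho_gt0; have s1 : 0 < 1 + s by rewrite ltr_pwDl.
rewrite ler_pdivrMl ?mulr_gt0 ?exprn_gt0// -[9 * _ * _]mulrA -exprMn.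
apply: tr_conj_sqr_lower => //.
- exact: spd_Bs (ellip_spd eB) s0.
- by rewrite mulr_gt0.
- exact: Bs_le.
Qed.

Lemma sym_resolvent : mx_sym (resolvent B s).
Proof. by apply: sym_inv; apply: sym_Bs; case: eB. Qed.

Lemma derive_resolvent i j : is_derive s 1 (fun t => resolvent B t i j) (- (resolvent B s *m resolvent B s) i j).
Proof.
have := derive_invmx (derive_Bs B s) det_Bs_gt0 i j.
by rewrite mulmx1.
Qed.

Lemma derive_weight : is_derive s 1 (weight B) (- (2^-1 * \tr (resolvent B s) * weight B s)).
Proof.
have := derive_sqrtdet (derive_Bs B s) det_Bs_gt0.
by rewrite mulmx1.
Qed.
End Bounds.

Section Differences.
Variables (rho e : R) (B1 B2 : 'M[R]_3).
Hypotheses (eB1 : ellip rho B1) (eB2 : ellip rho B2).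
Hypothesis B12 : forall i j, `|B1 i j - B2 i j| <= e.
Variable s : R.
Hypothesis s0 : 0 <= s.
Let q := (1 + s)^-1.
Let r0 := rho_gt0 eB1.
Let r1 := rho_ge1 eB1.
Let q0 : 0 < q := q_gt0 s0.
Let q1 : q <= 1 := q_le1 s0.
Let e0 : 0 <= e := le_trans (normr_ge0 _) (B12 o0 o0).

(** The resolvent identity [P1 - P2 = P1 (B2 - B1) P2]. *)
Lemma resolvent_diff i j : `|resolvent B1 s i j - resolvent B2 s i j| <= 9 * rho ^+ 2 * q ^+ 2 * e.
Proof.
have u1 := spd_unit (spd_Bs (ellip_spd eB1) s0).
have u2 := spd_unit (spd_Bs (ellip_spd eB2) s0).
have -> : resolvent B1 s i j - resolvent B2 s i j = (resolvent B1 s *m (B2 - B1) *m resolvent B2 s) i j.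
  have -> : B2 - B1 = Bs B2 s - Bs B1 s by rewrite /Bs opprD addrACA subrr addr0.
  rewrite mulmxBr mulmxBl mulVmx// mul1mx -mulmxA mulmxV// mulmx1.
  by rewrite !mxE.
have -> : 9 * rho ^+ 2 * q ^+ 2 * e = 9 * ((rho * q) * e * (rho * q)) by ring.
apply: mulmx3_le => [k l|k l|k l]; [exact: resolvent_le| |exact: resolvent_le].
by rewrite !mxE distrC.
Qed.

(** Avoids differentiating the square root: [w1 |w1 - w2| <= |w1^2 - w2^2|] is a difference of
    determinants, at most [162 rho^4 q^4 e], and [weight_ge] divides by [w1], which costs
    [3 rho^2 (1 + s)^2]. *)
Lemma weight_diff : `|weight B1 s - weight B2 s| <= 486 * rho ^+ 6 * q ^+ 2 * e.
Proof.
have w1 := weight_gt0 eB1 s0; have w2 := weight_gt0 eB2 s0.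
have s1 : 0 < 1 + s by rewrite ltr_pwDl.
rewrite -(ler_pM2l w1).
apply: (@le_trans _ _ `|weight B1 s ^+ 2 - weight B2 s ^+ 2|).
  rewrite subr_sqr normrM [leRHS]mulrC ler_wpM2r// ger0_norm ?addr_ge0 ?ltW//.
  by rewrite ltrDl.
rewrite (weight_sqr eB1 s0) (weight_sqr eB2 s0); apply: (le_trans (detmx_diff (resolvent_le eB1 s0) (resolvent_le eB2 s0) resolvent_diff)).
apply: (@le_trans _ _ ((3 * rho ^+ 2 * (1 + s) ^+ 2)^-1 * (486 * rho ^+ 6 * q ^+ 2 * e))).
  rewrite le_eqVlt; apply/orP; left; apply/eqP; rewrite /q.
  by field; rewrite !gt_eqF.
have p0 : 0 <= 486 * rho ^+ 6 * q ^+ 2 * e.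
  exact: mulr_ge0 (mulr_ge0 (mulr_ge0 (ler0n R 486) (exprn_ge0 6 (ltW r0)))
    (exprn_ge0 2 (ltW q0))) e0.
exact: ler_wpM2r p0 _ _ (weight_ge eB1 s0).
Qed.

Lemma rho_q_mono (k n m p : nat) : (k <= n)%N -> (p <= m)%N ->
  rho ^+ k * q ^+ m * e <= rho ^+ n * q ^+ p * e.
Proof.
move=> kn pm; rewrite ler_wpM2r// ler_pM ?exprn_ge0 ?(ltW r0) ?(ltW q0)//.
  by rewrite ler_weXn2l.
by rewrite ler_wiXn2l// ltW.
Qed.

Lemma Aintegrand_diff i j : `|resolvent B1 s i j * weight B1 s - resolvent B2 s i j * weight B2 s| <=
  513 * rho ^+ 7 * e * wt s.
Proof.
have wb : `|weight B1 s| <= 3 * rho ^+ 2 * q by rewrite gtr0_norm ?(weight_gt0 eB1 s0)//; exact: weight_le.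
apply: (le_trans (mul_diff (resolvent_le eB2 s0 i j) wb (resolvent_diff i j) weight_diff)).
have -> : 513 * rho ^+ 7 * e * wt s = 27 * (rho ^+ 7 * q ^+ 2 * e) + 486 * (rho ^+ 7 * q ^+ 2 * e).
  by rewrite /wt -exprVn -/q; ring.
have -> : 9 * rho ^+ 2 * q ^+ 2 * e * (3 * rho ^+ 2 * q) + rho * q * (486 * rho ^+ 6 * q ^+ 2 * e)
  = 27 * (rho ^+ 4 * q ^+ 3 * e) + 486 * (rho ^+ 7 * q ^+ 3 * e) by ring.
by apply: lerD; apply: (ler_wpM2l (ler0n R _)); exact: rho_q_mono.
Qed.

Lemma Cintegrand_diff i j k l :
  `|resolvent B1 s i j * resolvent B1 s k l * weight B1 s - resolvent B2 s i j * resolvent B2 s k l * weight B2 s| <=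
  540 * rho ^+ 8 * e * wt s.
Proof.
have wb : `|weight B1 s| <= 3 * rho ^+ 2 * q by rewrite gtr0_norm ?(weight_gt0 eB1 s0)//; exact: weight_le.
have pp := mul_diff (resolvent_le eB2 s0 i j) (resolvent_le eB1 s0 k l) (resolvent_diff i j) (resolvent_diff k l).
have p2 : `|resolvent B2 s i j * resolvent B2 s k l| <= rho * q * (rho * q).
  by rewrite normrM ler_pM// resolvent_le.
apply: (le_trans (mul_diff p2 wb pp weight_diff)).
have -> : 540 * rho ^+ 8 * e * wt s = 54 * (rho ^+ 8 * q ^+ 2 * e) + 486 * (rho ^+ 8 * q ^+ 2 * e).
  by rewrite /wt -exprVn -/q; ring.
rewrite -/q.
have -> : (9 * rho ^+ 2 * q ^+ 2 * e * (rho * q) + rho * q * (9 * rho ^+ 2 * q ^+ 2 * e)) *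
  (3 * rho ^+ 2 * q) + rho * q * (rho * q) * (486 * rho ^+ 6 * q ^+ 2 * e)
  = 54 * (rho ^+ 5 * q ^+ 4 * e) + 486 * (rho ^+ 8 * q ^+ 4 * e) by ring.
by apply: lerD; apply: (ler_wpM2l (ler0n R _)); exact: rho_q_mono.
Qed.
End Differences.
End Pointwise.

(** * The tensor C(B) *)

Section Tensor.
Variable R : realType.
Implicit Types (B H M : 'M[R]_3) (rho s e : R).

Definition Aintegrand B i j s := resolvent B s i j * weight B s.
Definition Cintegrand B i j k l s := resolvent B s i j * resolvent B s k l * weight B s.

Lemma AmapE B i j : Amap B i j = 2^-1 * int0oo (Aintegrand B i j).
Proof. by rewrite mxE. Qed.

Section Ellip.
Variables (rho : R) (B : 'M[R]_3).
Hypothesis eB : ellip rho B.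

Lemma continuous_resolvent s i j : 0 <= s -> {for s, continuous (fun t => resolvent B t i j)}.
Proof. by move=> s0; exact: derivable_continuous_at (derive_resolvent eB s0 i j). Qed.

Lemma continuous_weight s : 0 <= s -> {for s, continuous (weight B)}.
Proof. by move=> s0; exact: derivable_continuous_at (derive_weight eB s0). Qed.

Lemma dominated_Aintegrand i j : dominated (Aintegrand B i j).
Proof.
split=> [s s0|].
  by apply: continuousM; [exact: continuous_resolvent|exact: continuous_weight].
exists (3 * rho ^+ 3) => s s0; rewrite normrM (gtr0_norm (weight_gt0 eB s0)).
have -> : 3 * rho ^+ 3 * wt s = (rho * (1 + s)^-1) * (3 * rho ^+ 2 * (1 + s)^-1).
  by rewrite /wt -exprVn; ring.
by apply: ler_pM => //; [rewrite ltW// (weight_gt0 eB s0)|exact: resolvent_le|exact: weight_le].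
Qed.

Lemma dominated_Cintegrand i j k l : dominated (Cintegrand B i j k l).
Proof.
split=> [s s0|].
  apply: continuousM; last exact: continuous_weight.
  by apply: continuousM; exact: continuous_resolvent.
exists (3 * rho ^+ 4) => s s0; rewrite normrM (gtr0_norm (weight_gt0 eB s0)).
have r0 := rho_gt0 eB; have q0 := q_gt0 s0; have q1 := q_le1 s0.
have pp : `|resolvent B s i j * resolvent B s k l| <= rho ^+ 2 * (1 + s)^-1.
  rewrite normrM; apply: (@le_trans _ _ ((rho * (1 + s)^-1) * (rho * (1 + s)^-1))).
    by apply: ler_pM => //; exact: resolvent_le.
  rewrite mulrACA -expr2 ler_wpM2l ?exprn_ge0 ?(ltW r0)//.
  by rewrite ler_piMr ?(ltW q0).
have -> : 3 * rho ^+ 4 * wt s = (rho ^+ 2 * (1 + s)^-1) * (3 * rho ^+ 2 * (1 + s)^-1).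
  by rewrite /wt -exprVn; ring.
by apply: ler_pM => //; [rewrite ltW// (weight_gt0 eB s0)|exact: weight_le].
Qed.

(** The factor is [3/4] from the definition times [1/3] from [Ssym_tprod]. *)
Lemma CtenE i j k l : Cten B i j k l =
  4^-1 * (int0oo (Cintegrand B i j k l) + int0oo (Cintegrand B i k j l) + int0oo (Cintegrand B i l j k)).
Proof.
rewrite /Cten -!int0ooD//; try exact: dominated_Cintegrand; last first.
  by apply: dominatedD; exact: dominated_Cintegrand.
rewrite (@eq_int0oo _ _ (fun s => 3^-1 * (Cintegrand B i j k l s + Cintegrand B i k j l s + Cintegrand B i l j k s))).
  rewrite int0ooZ; first by field.
  by do 2?[apply: dominatedD]; exact: dominated_Cintegrand.
move=> s s0; rewrite Ssym_tprod; last exact: (sym_resolvent eB).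
by rewrite -/(resolvent B s) -/(weight B s) /Cintegrand; ring.
Qed.

Lemma Cten_sym i j k l : Cten B i j k l = Cten B k l i j.
Proof.
have c1 a b c d : int0oo (Cintegrand B a b c d) = int0oo (Cintegrand B c d a b).
  by apply: eq_int0oo => s _; rewrite /Cintegrand [_ * resolvent B s c d]mulrC.
have t a b c d : int0oo (Cintegrand B a b c d) = int0oo (Cintegrand B b a c d).
  by apply: eq_int0oo => s s0; rewrite /Cintegrand (sym_entry a b (sym_resolvent eB s)).
rewrite !CtenE (c1 i j k l) (t i k) (c1 k i) (t j l) (c1 l j) (c1 i l) (t j k) (c1 k j) (t i l).
by rewrite (c1 l i).
Qed.

Definition Cdensity H s := 2^-1 *: (resolvent B s *m H *m resolvent B s) + (4^-1 * \tr (resolvent B s *m H)) *: resolvent B s.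

(** Of the three pairings, two contract with a symmetric [H] to [P H P] and one to [tr (P H) P]. *)
Lemma tcontract_Cten H i j : mx_sym H ->
  tcontract (Cten B) H i j = int0oo (fun s => Cdensity H s i j * weight B s).
Proof.
move=> sH; rewrite mxE.
have dom k l : dominated (fun s => H k l * (4^-1 * (Cintegrand B i j k l s + Cintegrand B i k j l s + Cintegrand B i l j k s))).
  by do 2 apply: dominatedZ; do 2?[apply: dominatedD]; exact: dominated_Cintegrand.
transitivity (\sum_(k < 3) \sum_(l < 3) int0oo (fun s =>
    H k l * (4^-1 * (Cintegrand B i j k l s + Cintegrand B i k j l s + Cintegrand B i l j k s)))).
  apply: eq_bigr => k _; apply: eq_bigr => l _; rewrite CtenE mulrC.
  have d2 : dominated (fun s => Cintegrand B i j k l s + Cintegrand B i k j l s).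
    by apply: dominatedD; exact: dominated_Cintegrand.
  have d3 : dominated (fun s => Cintegrand B i j k l s + Cintegrand B i k j l s + Cintegrand B i l j k s).
    by apply: dominatedD => //; exact: dominated_Cintegrand.
  rewrite int0ooZ; last exact: dominatedZ.
  by rewrite int0ooZ// !int0ooD//; exact: dominated_Cintegrand.
under eq_bigr do rewrite -int0oo_sum//.
rewrite -int0oo_sum; last by move=> k; apply: dominated_sum.
apply: eq_int0oo => s s0.
have sP := sym_resolvent eB s.
rewrite /Cdensity /Cintegrand !mxE /mxtrace !sum3 !mxE ?sum3 ?mxE ?sum3.
have E a b := sym_entry a b sP; have EH a b := sym_entry a b sH.
rewrite (E j o0) (E j o1) (E j o2) (EH o0 o1) (EH o0 o2) (EH o1 o2) (E o0 o1) (E o0 o2) (E o1 o2).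
by field.
Qed.

Lemma dominated_Cdensity H i j : dominated (fun s => Cdensity H s i j * weight B s).
Proof.
have e : (fun s => Cdensity H s i j * weight B s) = fun s =>
   \sum_(k < 3) \sum_(l < 3) (2^-1 * H k l * Cintegrand B i k l j s + 4^-1 * H k l * Cintegrand B l k i j s).
  apply/funext => s; rewrite /Cdensity /Cintegrand !mxE /mxtrace !sum3 !mxE ?sum3 ?mxE ?sum3; ring.
rewrite e; apply: dominated_sum => k; apply: dominated_sum => l.
by apply: dominatedD; apply: dominatedZ; exact: dominated_Cintegrand.
Qed.


Lemma derive_Aintegrand s i j : 0 <= s -> is_derive s 1 (Aintegrand B i j) (- 2 * (Cdensity 1%:M s i j * weight B s)).
Proof.
move=> s0; have := is_drv_mul (derive_resolvent eB s0 i j) (derive_weight eB s0).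
move/is_derive_eq; apply; rewrite /Cdensity !mulmx1.
by set Q := resolvent B s *m resolvent B s; rewrite !mxE; field.
Qed.

Lemma Aintegrand_le s i j : 0 <= s -> `|Aintegrand B i j s| <= 3 * rho ^+ 3 * wt s.
Proof.
move=> s0; rewrite normrM (gtr0_norm (weight_gt0 eB s0)).
have -> : 3 * rho ^+ 3 * wt s = (rho * (1 + s)^-1) * (3 * rho ^+ 2 * (1 + s)^-1).
  by rewrite /wt -exprVn; ring.
by apply: ler_pM => //; [rewrite ltW// (weight_gt0 eB s0)|exact: resolvent_le|exact: weight_le].
Qed.

Lemma wt_le s : 0 <= s -> wt s <= (1 + s)^-1.
Proof.
move=> s0; rewrite /wt -exprVn expr2 ler_piMr//; last exact: q_le1.
by rewrite ltW// q_gt0.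
Qed.

Lemma Cten_one : tcontract (Cten B) 1%:M =
  (2^-1 * (Num.sqrt (\det B))^-1) *: invmx B.
Proof.
have B0 : Bs B 0 = B by rewrite /Bs [0%:M](_ : _ = 0) ?addr0//; apply/matrixP => i j; rewrite !mxE mul0rn.
apply/matrixP => i j; rewrite tcontract_Cten; last by rewrite /mx_sym tr_scalar_mx.
have dom := dominated_Cdensity (1%:M : 'M[R]_3) i j.
have h : int0oo (fun s => - 2 * (Cdensity 1%:M s i j * weight B s)) = - Aintegrand B i j 0.
  apply: (@int0oo_FTC _ _ _ (3 * rho ^+ 3)).
  - exact: dominatedZ.
  - by move=> s s0; exact: derive_Aintegrand.
  - move=> s s0; apply: (le_trans (Aintegrand_le i j s0)); rewrite ler_wpM2l ?wt_le//.
    by rewrite mulr_ge0// exprn_ge0// ltW// (rho_gt0 eB).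
move: h; rewrite int0ooZ// /Aintegrand /resolvent /weight B0 mxE => h.
by move: h; rewrite mulrC; lra.
Qed.

Lemma Cten_self : tcontract (Cten B) B = (3 / 2) *: Amap B.
Proof.
have sB : mx_sym B by case: eB.
apply/matrixP => i j; rewrite tcontract_Cten// [in RHS]mxE AmapE.
have dom := dominated_Cdensity (1%:M : 'M[R]_3) i j.
have domB := dominated_Cdensity B i j.
have dA := dominated_Aintegrand i j.
(* Substituting [P B = I - s P] gives the coefficient [1/2 + 3/4] of [P] and turns the rest into
   [- s] times the density at the identity. *)
have pt s : 0 <= s -> Cdensity B s i j * weight B s = 5 / 4 * Aintegrand B i j s - s * (Cdensity 1%:M s i j * weight B s).
  move=> s0; have uB := spd_unit (spd_Bs (ellip_spd eB) s0).
  have PB : resolvent B s *m B = 1%:M - s *: resolvent B s.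
    have E : resolvent B s *m (B + s%:M) = 1%:M := mulVmx uB.
    by rewrite -E mulmxDr mul_mx_scalar addrK.
  have PBP : resolvent B s *m B *m resolvent B s = resolvent B s - s *: (resolvent B s *m resolvent B s).
    by rewrite PB mulmxBl mul1mx -scalemxAl.
  have tPB : \tr (resolvent B s *m B) = 3 - s * \tr (resolvent B s).
    by rewrite PB raddfB/= mxtraceZ mxtrace1.
  rewrite /Cdensity PBP tPB !mulmx1 /Aintegrand; set Q := resolvent B s *m resolvent B s; by rewrite !mxE; field.
(* By [pt] this integrand is the derivative of [s * Aintegrand], which vanishes at 0 through the
   factor [s] and at infinity because [s * wt s <= (1 + s)^-1]. *)
have h : int0oo (fun s => - (3 / 2) * Aintegrand B i j s + 2 * (Cdensity B s i j * weight B s)) = - (0 * Aintegrand B i j 0).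
  apply: (@int0oo_FTC _ _ (fun s => s * Aintegrand B i j s) (3 * rho ^+ 3)).
  - by apply: dominatedD; apply: dominatedZ.
  - move=> s s0; have := is_drv_mul (is_drv_id s) (derive_Aintegrand i j s0).
    by move/is_derive_eq; apply; rewrite pt//; field.
  - move=> s s0; have r0 := rho_gt0 eB.
    have s1 : 1 + s != 0 by rewrite gt_eqF// ltr_pwDl.
    rewrite normrM (ger0_norm s0).
    apply: (le_trans (ler_wpM2l s0 (Aintegrand_le i j s0))).
    rewrite mulrCA ler_wpM2l ?mulr_ge0 ?exprn_ge0 ?(ltW r0)//.
    rewrite /wt expr2 invfM mulrA ler_piMl ?(ltW (q_gt0 s0))//.
    by rewrite ler_pdivrMr ?ltr_pwDl// mul1r lerDr.
move: h; rewrite int0ooD; try by apply: dominatedZ.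
by rewrite !int0ooZ// mul0r oppr0; lra.
Qed.


Lemma sym_Amap : mx_sym (Amap B).
Proof.
apply/matrixP => i j; rewrite mxE !AmapE; congr (_ * _).
by apply: eq_int0oo => s _; rewrite /Aintegrand (sym_entry i j (sym_resolvent eB s)).
Qed.

Definition mdot (G H : 'M[R]_3) : R := \sum_(i < 3) \sum_(j < 3) G i j * H i j.

Lemma mdot_tr (G H : 'M[R]_3) : mx_sym G -> mdot G H = \tr (G *m H).
Proof.
move=> sG; rewrite /mdot exchange_big; apply: eq_bigr => i _; rewrite mxE.
by apply: eq_bigr => j _; rewrite (sym_entry i j sG).
Qed.

Lemma Cten_adj (G H : 'M[R]_3) :
  mdot G (tcontract (Cten B) H) = mdot (tcontract (Cten B) G) H.
Proof.
have pE (f : 'I_3 -> 'I_3 -> R) : \sum_(i < 3) \sum_(j < 3) f i j = \sum_p f p.1 p.2.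
  exact: pair_bigA.
rewrite /mdot !pE.
transitivity (\sum_(p : 'I_3 * 'I_3) \sum_(r : 'I_3 * 'I_3) G p.1 p.2 * Cten B p.1 p.2 r.1 r.2 * H r.1 r.2).
  by apply: eq_bigr => p _; rewrite mxE pE big_distrr; apply: eq_bigr => r _; rewrite /= mulrA.
rewrite exchange_big; apply: eq_bigr => r _; rewrite mxE pE big_distrl; apply: eq_bigr => p _.
by rewrite /= Cten_sym [G _ _ * _]mulrC.
Qed.

(** Self-adjointness of [Cten B] equates [<I, C : B> = 3/2 tr A] with
    [<C : I, B> = 1/2 tr (B^-1 B) = 3/2]. *)
Lemma trAmap : \det B = 1 -> \tr (Amap B) = 1.
Proof.
move=> dB; have sB : mx_sym B by case: eB.
have s1 : mx_sym (1%:M : 'M[R]_3) by rewrite /mx_sym tr_scalar_mx.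
have uB := spd_unit (ellip_spd eB).
have := Cten_adj 1%:M B; rewrite Cten_self Cten_one dB sqrtr1 invr1 mulr1.
rewrite mdot_tr// mul1mx mxtraceZ mdot_tr; last first.
  by rewrite /mx_sym linearZ/= (sym_inv sB).
by rewrite -scalemxAl mulVmx// mxtraceZ mxtrace1; lra.
Qed.

(** The decay of the lower bounds: [(1 + s)^-2] from the quadratic term in [H] and [(1 + s)^-2] from
    the weight. *)
Definition wt4 s : R := wt s * wt s.

Lemma wt_le1 s : 0 <= s -> wt s <= 1.
Proof. by move=> s0; rewrite (le_trans (wt_le s0))// q_le1. Qed.

Lemma dominated_wt4 : dominated wt4.
Proof.
split=> [s s0|]; first by apply: continuousM; exact: continuous_wt.
exists 1 => s s0; rewrite mul1r ger0_norm ?mulr_ge0 ?wt_ge0//.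
by rewrite ler_piMl ?wt_ge0// wt_le1.
Qed.

Lemma int_wt4 : int0oo wt4 = 3^-1.
Proof.
transitivity (- (- 3^-1 * ((1 + 0)^-1 * wt (0 : R)))); last first.
  by rewrite /wt addr0 expr1n invr1 mulr1 mulr1 opprK.
apply: (@int0oo_FTC _ wt4 (fun s => - 3^-1 * ((1 + s)^-1 * wt s)) 1).
- exact: dominated_wt4.
- move=> s s0; have h : 1 + s != 0 by rewrite gt_eqF// ltr_pwDl.
  have d1 := @is_drv_inv _ (fun x => 1 + x) _ _ h (is_drv_add (is_drv_cst 1 s) (is_drv_id s)).
  rewrite (_ : (fun x => _) = fun x : R => - 3^-1 * ((1 + x)^-1 * ((1 + x)^-1 * (1 + x)^-1))); last first.
    by apply/funext => x; rewrite /wt expr2 invfM.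
  have := is_drv_scale (- 3^-1) (is_drv_mul d1 (is_drv_mul d1 d1)).
  by move/is_derive_eq; apply; rewrite /wt4 /wt; field.
- move=> s s0; have q0 := q_gt0 s0; have w0 := wt_ge0 s; have w1 := wt_le1 s0.
  have p0 : 0 <= (1 + s)^-1 * wt s by rewrite mulr_ge0// ltW.
  have p1 : (1 + s)^-1 * wt s <= (1 + s)^-1 by rewrite ler_piMr// ltW.
  have t0 : 0 <= 3^-1 :> R by rewrite invr_ge0.
  rewrite mul1r normrM normrN (ger0_norm p0) (ger0_norm t0); lra.
Qed.

(** Coercivity of [Cten B]: the density paired with [H] is [(tr (P H P H) / 2 + tr (P H)^2 / 4) w].
    The square is dropped and the remaining factors are bounded below; [162 = 2 * 9 * 3 * 3], the
    last 3 coming from [int_wt4]. *)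
Lemma Cten_pos H : mx_sym H -> \tr (H *m H) <= 162 * rho ^+ 4 * mdot H (tcontract (Cten B) H).
Proof.
move=> sH; have r0 := rho_gt0 eB.
have dom i j : dominated (fun s => H i j * (Cdensity H s i j * weight B s)).
  by apply: dominatedZ; exact: dominated_Cdensity.
have -> : mdot H (tcontract (Cten B) H) =
    int0oo (fun s => \sum_(i < 3) \sum_(j < 3) H i j * (Cdensity H s i j * weight B s)).
  rewrite int0oo_sum; last by move=> i; exact: dominated_sum.
  apply: eq_bigr => i _; rewrite int0oo_sum//; apply: eq_bigr => j _.
  by rewrite int0ooZ ?tcontract_Cten//; exact: dominated_Cdensity.
have r4 : 0 < 54 * rho ^+ 4 by rewrite mulr_gt0// exprn_gt0.
have h : int0oo (fun s => \tr (H *m H) / (54 * rho ^+ 4) * wt4 s) <=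
   int0oo (fun s => \sum_(i < 3) \sum_(j < 3) H i j * (Cdensity H s i j * weight B s)).
  apply: le_int0oo.
  - exact: dominatedZ dominated_wt4.
  - by apply: dominated_sum => i; exact: dominated_sum.
  move=> s s0; have P0 := weight_gt0 eB s0; have s1 : 0 < 1 + s by rewrite ltr_pwDl.
  have -> : \sum_(i < 3) \sum_(j < 3) H i j * (Cdensity H s i j * weight B s) =
      (2^-1 * \tr (resolvent B s *m H *m resolvent B s *m H) + 4^-1 * \tr (resolvent B s *m H) ^+ 2) * weight B s.
    transitivity (mdot H (Cdensity H s) * weight B s).
      by rewrite /mdot big_distrl; apply: eq_bigr => i _; rewrite big_distrl; apply: eq_bigr => j _; rewrite /= mulrA.
    congr (_ * _); rewrite mdot_tr// /Cdensity mulmxDr -!scalemxAr mxtraceD !mxtraceZ.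
    by rewrite [\tr (H *m resolvent B s)]mxtrace_mulC [\tr (H *m _)]mxtrace_mulC; ring.
  have a := tr_resolvent_ge eB s0 sH; have b := weight_ge eB s0.
  have t0 := tr_sym_sqr_ge0 sH.
  have c9 : 0 < 9 * rho ^+ 2 * (1 + s) ^+ 2 by rewrite ?mulr_gt0 ?exprn_gt0.
  have c3 : 0 < 3 * rho ^+ 2 * (1 + s) ^+ 2 by rewrite ?mulr_gt0 ?exprn_gt0.
  have -> : \tr (H *m H) / (54 * rho ^+ 4) * wt4 s =
     (2^-1 * ((9 * rho ^+ 2 * (1 + s) ^+ 2)^-1 * \tr (H *m H))) * (3 * rho ^+ 2 * (1 + s) ^+ 2)^-1.
    by rewrite /wt4 /wt; field; rewrite !gt_eqF.
  apply: ler_pM => //.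
  - by apply: mulr_ge0; rewrite ?invr_ge0// mulr_ge0// invr_ge0 ltW.
  - by rewrite invr_ge0 ltW.
  - by rewrite (@le_trans _ _ (2^-1 * \tr (resolvent B s *m H *m resolvent B s *m H)))// ?ler_wpM2l ?invr_ge0// lerDl mulr_ge0// sqr_ge0.
move: h; rewrite (int0ooZ _ dominated_wt4) int_wt4 -mulrA -invfM ler_pdivrMr ?mulr_gt0//.
by move/le_trans; apply; rewrite le_eqVlt; apply/orP; left; apply/eqP; ring.
Qed.

Lemma posdef_Amap : mx_posdef (Amap B).
Proof.
move=> v v0; have r0 := rho_gt0 eB; have n0 := sqnorm_gt0 v0.
have dom i j : dominated (fun s => (v i 0 * v j 0) * Aintegrand B i j s).
  by apply: dominatedZ; exact: dominated_Aintegrand.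
have -> : (v^T *m Amap B *m v) 0 0 = 2^-1 *
    int0oo (fun s => \sum_(i < 3) \sum_(j < 3) (v i 0 * v j 0) * Aintegrand B i j s).
  rewrite -/(qf _ _) qfE int0oo_sum; last by move=> i; exact: dominated_sum.
  rewrite big_distrr; apply: eq_bigr => i _; rewrite int0oo_sum// big_distrr; apply: eq_bigr => j _.
  by rewrite int0ooZ ?AmapE; [rewrite /=; ring|exact: dominated_Aintegrand].
rewrite mulr_gt0// ?invr_gt0//.
have r3 : 0 < 9 * rho ^+ 3 by rewrite mulr_gt0// exprn_gt0.
apply: (@lt_le_trans _ _ (int0oo (fun s => sqnorm v / (9 * rho ^+ 3) * wt4 s))).
  by rewrite (int0ooZ _ dominated_wt4) int_wt4 !mulr_gt0// invr_gt0.
apply: le_int0oo.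
- exact: dominatedZ dominated_wt4.
- by apply: dominated_sum => i; exact: dominated_sum.
move=> s s0; have P0 := weight_gt0 eB s0; have s1 : 0 < 1 + s by rewrite ltr_pwDl.
have -> : \sum_(i < 3) \sum_(j < 3) v i 0 * v j 0 * Aintegrand B i j s = qf (resolvent B s) v * weight B s.
  rewrite qfE big_distrl; apply: eq_bigr => i _; rewrite big_distrl; apply: eq_bigr => j _.
  by rewrite /Aintegrand /=; ring.
have sp := spd_Bs (ellip_spd eB) s0.
have b := weight_ge eB s0.
have a : sqnorm v <= 3 * (rho * (1 + s)) * qf (resolvent B s) v.
  apply: qf_lower; [exact: spd_inv|by rewrite mulr_gt0|].
  by move=> i j; rewrite invmxK; exact: Bs_le.
have c1 : 0 < 3 * (rho * (1 + s)) by rewrite ?mulr_gt0.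
have c3 : 0 < 3 * rho ^+ 2 * (1 + s) ^+ 2 by rewrite ?mulr_gt0 ?exprn_gt0.
apply: (@le_trans _ _ ((3 * (rho * (1 + s)))^-1 * sqnorm v * (3 * rho ^+ 2 * (1 + s) ^+ 2)^-1)).
  (* The integrand only decays like [(1 + s)^-3]; the spare factor [(1 + s)^-1 <= 1] is given away
     to reuse [wt4]. *)
  have -> : sqnorm v / (9 * rho ^+ 3) * wt4 s = (3 * (rho * (1 + s)))^-1 * sqnorm v * (3 * rho ^+ 2 * (1 + s) ^+ 2)^-1 * (1 + s)^-1.
    by rewrite /wt4 /wt; field; rewrite !gt_eqF.
  rewrite ler_piMr ?q_le1//; apply: mulr_ge0; last by rewrite invr_ge0 ltW.
  by apply: mulr_ge0; rewrite ?invr_ge0 ltW.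
apply: ler_pM => //.
- by apply: mulr_ge0; rewrite ?invr_ge0 ltW.
- by rewrite invr_ge0 ltW.
- by rewrite ler_pdivrMl.
Qed.

End Ellip.

Section Lipschitz.
Variables (rho e : R) (B1 B2 : 'M[R]_3).
Hypotheses (eB1 : ellip rho B1) (eB2 : ellip rho B2).
Hypothesis B12 : forall i j, `|B1 i j - B2 i j| <= e.

Lemma int0oo_diff_le (f g : R -> R) (c : R) : dominated f -> dominated g ->
  (forall s, 0 <= s -> `|f s - g s| <= c * wt s) -> `|int0oo f - int0oo g| <= c.
Proof.
move=> df dg h; have dg1 := dominatedZ (-1) dg.
rewrite -mulN1r -int0ooZ// -int0ooD//; apply: norm_int0oo_le; first exact: dominatedD.
by move=> s s0; rewrite mulN1r; exact: h.
Qed.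

Lemma Amap_lip i j : `|Amap B1 i j - Amap B2 i j| <= 513 * rho ^+ 7 * e.
Proof.
have h : `|int0oo (Aintegrand B1 i j) - int0oo (Aintegrand B2 i j)| <= 513 * rho ^+ 7 * e.
  apply: int0oo_diff_le; [exact: dominated_Aintegrand eB1 i j|exact: dominated_Aintegrand eB2 i j|].
  by move=> s s0; exact: Aintegrand_diff.
by rewrite !AmapE -mulrBr normrM ger0_norm ?invr_ge0//; move: (normr_ge0 (int0oo (Aintegrand B1 i j) - int0oo (Aintegrand B2 i j))); lra.
Qed.

Lemma Cten_lip i j k l : `|Cten B1 i j k l - Cten B2 i j k l| <= 540 * rho ^+ 8 * e.
Proof.
have h a b c d : `|int0oo (Cintegrand B1 a b c d) - int0oo (Cintegrand B2 a b c d)| <= 540 * rho ^+ 8 * e.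
  apply: int0oo_diff_le; [exact: dominated_Cintegrand eB1 _ _ _ _|exact: dominated_Cintegrand eB2 _ _ _ _|].
  by move=> s s0; exact: Cintegrand_diff.
rewrite (CtenE eB1) (CtenE eB2); move: (h i j k l) (h i k j l) (h i l j k).
move: (int0oo (Cintegrand B1 i j k l)) (int0oo (Cintegrand B1 i k j l)) (int0oo (Cintegrand B1 i l j k)).
move: (int0oo (Cintegrand B2 i j k l)) (int0oo (Cintegrand B2 i k j l)) (int0oo (Cintegrand B2 i l j k)).
move: (540 * rho ^+ 8 * e) => K x1 x2 x3 y1 y2 y3.
by rewrite !ler_norml; lra.
Qed.
End Lipschitz.

End Tensor.

(** * Picard iteration *)

Section Picard.
Variable R : realType.
Implicit Types (f g : R -> R) (x y : R -> 'M[R]_3).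
Local Notation mu := (@lebesgue_measure R).

Lemma le_double (a b : R) : 0 <= b -> b <= a -> b <= 2 * a.
Proof. by lra. Qed.

Lemma dist_third (a b c d e : R) : `|a - b| <= e / 3 -> `|b - c| <= e / 3 ->
  `|a - d| <= e / 3 -> `|d - c| <= e.
Proof. by rewrite !ler_norml; lra. Qed.

(** Integration starts at [-1] so that 0 is an interior point and the two-sided derivative exists
    there as well. *)
Definition primitive f (t : R) : R :=
  Rintegral mu `[-1, t]%classic f - Rintegral mu `[-1, 0]%classic f.

Lemma primitive0 f : primitive f 0 = 0.
Proof. by rewrite /primitive subrr. Qed.

Lemma derive_primitive f (t : R) : continuous f -> 0 <= t -> is_derive t 1 (primitive f) (f t).
Proof.
move=> cf t0; have lt1 : -1 < t by rewrite (lt_le_trans _ t0)// oppr_lt0.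
have [d dE] : derivable (fun z : R => Rintegral mu `[-1, z]%classic f) t 1 /\
    derive1 (fun z : R => Rintegral mu `[-1, z]%classic f) t = f t.
  apply: (@continuous_FTC1_closed _ f (-1) t (t + 1)) => //.
  - by rewrite ltrDl.
  - apply: continuous_compact_integrable; first exact: segment_compact.
    by apply: continuous_subspaceT.
  - exact: cf.
have d1 : is_derive t 1 (fun z : R => Rintegral mu `[-1, z]%classic f) (f t).
  by apply: DeriveDef; [exact: d|rewrite -derive1E; exact: dE].
by have := is_drv_sub d1 (is_drv_cst (Rintegral mu `[-1, 0]%classic f) t); rewrite subr0.
Qed.

Lemma derive_nondecreasing f (df : R -> R) (a b : R) : a <= b ->
  (forall t, a <= t <= b -> is_derive t 1 f (df t)) ->
  (forall t, a <= t <= b -> 0 <= df t) -> f a <= f b.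
Proof.
move=> ab fd df0.
have [| |c cab E] := @MVT_segment _ f df a b ab.
- by move=> t; rewrite in_itv/= => /andP[h1 h2]; apply: fd; rewrite !ltW.
- apply: derivable_within_continuous => t; rewrite in_itv/= => h.
  exact: (@ex_derive _ _ _ _ _ _ _ (fd t h)).
rewrite -subr_ge0 E mulr_ge0 ?subr_ge0//; apply: df0.
by move: cab; rewrite in_itv/=.
Qed.

(** The mean value inequality; it stands in for all estimates of integrals in the Picard
    iteration. *)
Lemma derive_norm_le f g (df dg : R -> R) (b : R) : 0 <= b ->
  (forall t, 0 <= t <= b -> is_derive t 1 f (df t)) ->
  (forall t, 0 <= t <= b -> is_derive t 1 g (dg t)) ->
  (forall t, 0 <= t <= b -> `|df t| <= dg t) -> `|f b - f 0| <= g b - g 0.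
Proof.
move=> b0 fd gd h; rewrite ler_norml; apply/andP; split.
  suff : f 0 + g 0 <= f b + g b by lra.
  apply: (@derive_nondecreasing (fun z => f z + g z) (fun z => df z + dg z)) => // t tb.
    exact: is_drv_add (fd _ tb) (gd _ tb).
  by have := h t tb; rewrite ler_norml => /andP[]; lra.
suff : g 0 - f 0 <= g b - f b by lra.
apply: (@derive_nondecreasing (fun z => g z - f z) (fun z => dg z - df z)) => // t tb.
  exact: is_drv_sub (gd _ tb) (fd _ tb).
by have := h t tb; rewrite ler_norml => /andP[]; lra.
Qed.

Lemma continuous_max0 : continuous (fun t : R => Num.max t 0).
Proof. by move=> t; apply: continuous_max; [exact: id|exact: cst_continuous]. Qed.

Lemma continuous_sum_seq (I : Type) (r : seq I) (h : I -> R -> R) :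
  (forall i, continuous (h i)) -> continuous (fun z => \sum_(i <- r) h i z).
Proof.
move=> ch t; elim: r => [|i r IH].
  rewrite (_ : (fun _ => _) = fun=> 0); last by apply/funext => z; rewrite big_nil.
  exact: cst_continuous.
rewrite (_ : (fun _ => _) = fun z => h i z + \sum_(j <- r) h j z); last first.
  by apply/funext => z; rewrite big_cons.
by apply: continuousD => //; exact: ch.
Qed.

Variables (G : R -> 'M[R]_3 -> 'M[R]_3) (L : R -> R) (x0 : 'M[R]_3).
Hypothesis cL : continuous L.
Hypothesis L0 : forall t, 0 <= L t.
Hypothesis GL : forall (t e : R) (a b : 'M[R]_3), (forall i j, `|a i j - b i j| <= e) ->
  forall i j, `|G t a i j - G t b i j| <= L t * e.
Hypothesis cG : forall a i j, continuous (fun t => G t a i j).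

Definition cpath x := forall i j, continuous (fun t => x t i j).

(** [G] is continuous in time only for a frozen matrix; the Lipschitz bound, with [L] locally
    bounded by continuity, transfers this to a moving one. *)
Lemma continuous_G x : cpath x -> forall i j, continuous (fun t => G t (x t) i j).
Proof.
move=> cx i j t; apply/cvgrPdist_le => e e0.
have L1 : 0 < L t + 1 by rewrite ltr_wpDl.
pose d := e / 2 / (L t + 1).
have d0 : 0 < d by rewrite !divr_gt0.
have N : \forall z \near t, forall k l, `|x t k l - x z k l| <= d.
  apply: (@filter_forall R 'I_3 (fun k z => forall l, `|x t k l - x z k l| <= d)
    (nbhs t) _) => k.
  apply: (@filter_forall R 'I_3 (fun l z => `|x t k l - x z k l| <= d) (nbhs t) _) => l.
  by have := cx k l t; move/cvgrPdist_le; apply.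
near=> z.
have h1 : `|G t (x t) i j - G z (x t) i j| <= e / 2.
  near: z; have := @cG (x t) i j t; move/cvgrPdist_le; apply; exact: divr_gt0.
have h2 : L z <= L t + 1.
  by near: z; apply: (cvgr_le _ (@cL t)); rewrite ltrDl.
have h3 k l : `|x t k l - x z k l| <= d.
  by move: k l; near: z; exact: N.
have h4 := GL z h3 i j.
have h5 : L z * d <= e / 2.
  by rewrite /d mulrA ler_pdivrMr// mulrC ler_wpM2l// ltW// divr_gt0.
rewrite -(subrKA (G z (x t) i j)) (le_trans (ler_normD _ _))//.
by rewrite [leRHS]splitr lerD// (le_trans h4).
Unshelve. all: by end_near. Qed.

Definition pstep x (t : R) : 'M[R]_3 :=
  \matrix_(i, j) (x0 i j + primitive (fun s => G s (x s) i j) t).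

Lemma derive_pstep x (t : R) i j : cpath x -> 0 <= t ->
  is_derive t 1 (fun z => pstep x z i j) (G t (x t) i j).
Proof.
move=> cx t0; rewrite (_ : (fun z => _) = fun z => x0 i j + primitive (fun s => G s (x s) i j) z).
  have := is_drv_add (is_drv_cst (x0 i j) t) (derive_primitive (continuous_G cx (i:=i) (j:=j)) t0).
  by rewrite add0r.
by apply/funext => z; rewrite mxE.
Qed.

Lemma pstep0 x : pstep x 0 = x0.
Proof. by apply/matrixP => i j; rewrite mxE primitive0 addr0. Qed.

(** Iterates are frozen at negative times: [derive_primitive] wants an integrand continuous on the
    whole line, while [pstep] is only controlled for [t >= 0]. *)
Definition pstepm x (t : R) := pstep x (Num.max t 0).

Lemma max0_ge0 (t : R) : 0 <= Num.max t 0.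
Proof. by rewrite le_max lexx orbT. Qed.

Lemma cpath_pstepm x : cpath x -> cpath (pstepm x).
Proof.
move=> cx i j t.
exact: (@continuous_comp R R R (fun t => Num.max t 0) (fun z => pstep x z i j) t
  (@continuous_max0 t) (derivable_continuous_at (derive_pstep i j cx (max0_ge0 t)))).
Qed.

(** Besides the Lipschitz constant, [K] majorises the field at the initial value, so that the first
    increment obeys the same weighted bound as the later ones. *)
Let K (t : R) : R := L t + \sum_(i < 3) \sum_(j < 3) `|G t x0 i j|.

Let cK : continuous K.
Proof.
move=> t; apply: (@continuousD _ R R L); first exact: cL.
apply: continuous_sum_seq => i z; apply: continuous_sum_seq => {z} j z.
exact: (@continuous_comp R R R (fun z => G z x0 i j) (fun u : R => `|u|) z
  (@cG x0 i j z) (@norm_continuous _ _ _)).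
Qed.

Let K0 t : 0 <= K t.
Proof. by rewrite addr_ge0// sumr_ge0// => i _; rewrite sumr_ge0. Qed.

Let LK t : L t <= K t.
Proof. by rewrite lerDl sumr_ge0// => i _; rewrite sumr_ge0. Qed.

Let GK t i j : `|G t x0 i j| <= K t.
Proof.
rewrite /K (bigD1 i)//= (bigD1 j)//= addrCA -addrA lerDl addr_ge0//.
  by rewrite sumr_ge0.
by rewrite addr_ge0 ?L0// sumr_ge0// => k _; rewrite sumr_ge0.
Qed.

(** The weight of the norm. Its equation [E' = 2 K E] is what makes [pstep] a contraction of ratio
    [1/2] on the entire half-line, however fast [K] grows. *)
Let E (t : R) : R := expR (2 * primitive K t).

Let dE (t : R) : 0 <= t -> is_derive t 1 E (2 * K t * E t).
Proof.
move=> t0; have d := is_drv_scale 2 (derive_primitive cK t0).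
have := @is_derive1_comp _ expR (fun t => 2 * primitive K t) t _ _ (is_derive_expR _) d.
by rewrite mulrC.
Qed.

Let E0 : E 0 = 1. Proof. by rewrite /E primitive0 mulr0 expR0. Qed.

Let E_ge1 (t : R) : 0 <= t -> 1 <= E t.
Proof.
move=> t0; rewrite -E0; apply: (@derive_nondecreasing E (fun t => 2 * K t * E t)) => //.
  by move=> z /andP[z0 _]; exact: dE.
by move=> z _; rewrite !mulr_ge0// expR_ge0.
Qed.

Let pstep_contract x y (c : R) : cpath x -> cpath y ->
  (forall t, 0 <= t -> forall i j, `|x t i j - y t i j| <= c * E t) ->
  forall t, 0 <= t -> forall i j, `|pstep x t i j - pstep y t i j| <= c / 2 * E t.
Proof.
move=> cx cy xy t t0 i j.
have c0 : 0 <= c by have := xy 0 (lexx _) o0 o0; rewrite E0 mulr1; exact: le_trans.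
have := @derive_norm_le (fun z => pstep x z i j - pstep y z i j) (fun z => c / 2 * E z)
  (fun z => G z (x z) i j - G z (y z) i j) (fun z => c / 2 * (2 * K z * E z)) t t0.
rewrite !pstep0 subrr subr0 => h; apply: le_trans (h _ _ _) _.
- move=> z /andP[z0 _]; apply: is_drv_sub; exact: derive_pstep.
- move=> z /andP[z0 _]; apply: is_drv_scale; exact: dE.
- move=> z /andP[z0 _]; apply: (le_trans (GL z (xy z z0) i j)).
  have -> : c / 2 * (2 * K z * E z) = K z * (c * E z) by field.
  by rewrite ler_wpM2r// mulr_ge0// expR_ge0.
by rewrite lerBlDr lerDl mulr_ge0 ?expR_ge0// divr_ge0.
Qed.

Let X_ n : R -> 'M[R]_3 := iter n pstepm (fun=> x0).

Let cX_ n : cpath (X_ n).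
Proof.
elim: n => [|n IH]; last exact: cpath_pstepm.
by move=> i j t; exact: cst_continuous.
Qed.

Let pstepmE x (t : R) : 0 <= t -> pstepm x t = pstep x t.
Proof. by move=> t0; rewrite /pstepm max_l. Qed.

Let X_step n (t : R) : 0 <= t -> forall i j,
  `|X_ n.+1 t i j - X_ n t i j| <= 2^-1 ^+ n * E t.
Proof.
elim: n t => [|n IH] t t0 i j.
  rewrite mul1r /X_ /= pstepmE//.
  have := @derive_norm_le (fun z => pstep (fun=> x0) z i j) E
    (fun z => G z x0 i j) (fun z => 2 * K z * E z) t t0.
  rewrite !pstep0 => h; apply: le_trans (h _ _ _) _.
  - by move=> z /andP[z0 _]; apply: (@derive_pstep (fun=> x0)) => // k l u; exact: cst_continuous.
  - by move=> z /andP[z0 _]; exact: dE.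
  - move=> z /andP[z0 _]; apply: (le_trans (GK z i j)).
    have := ler_wpM2l (K0 z) (E_ge1 z0); have := K0 z; rewrite mulr1 -mulrA.
    by move=> k0 kE; exact: le_double k0 kE.
  by rewrite E0 lerBlDr lerDl.
rewrite exprSr /X_ !iterS !pstepmE//; apply: pstep_contract => //.
- exact: (@cX_ n.+1).
- exact: (@cX_ n).
Qed.

(** With [d n = 2 * 2^-n * M] the tail of the series, the intervals [[u n - d n, u n + d n]] are
    nested, and the supremum of their left ends lies in all of them. *)
Lemma geometric_limit (u : nat -> R) (M : R) :
  (forall n, `|u n.+1 - u n| <= 2^-1 ^+ n * M) ->
  exists l, forall n, `|u n - l| <= 2 * 2^-1 ^+ n * M.
Proof.
move=> h; pose d n := 2 * 2^-1 ^+ n * M.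
have M0 : 0 <= M by have := h 0; rewrite mul1r; exact: le_trans.
have d0 n : 0 <= d n by rewrite !mulr_ge0// exprn_ge0// invr_ge0.
have dS n : d n - d n.+1 = 2^-1 ^+ n * M by rewrite /d exprS; field.
pose a n := u n - d n; pose b n := u n + d n.
have aS n : a n <= a n.+1.
  by have := h n; rewrite ler_norml -dS /a => /andP[]; lra.
have bS n : b n.+1 <= b n.
  by have := h n; rewrite ler_norml -dS /b => /andP[]; lra.
have aM m n : (m <= n)%N -> a m <= a n.
  by move=> mn; have /nondecreasing_seqP ha := aS; exact: ha.
have bM m n : (m <= n)%N -> b n <= b m.
  by move=> mn; have /nonincreasing_seqP hb := bS; exact: hb.
have ab m n : a m <= b n.
  apply: (@le_trans _ _ (a (maxn m n))); first by apply: aM; rewrite leq_maxl.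
  apply: (@le_trans _ _ (b (maxn m n))); last by apply: bM; rewrite leq_maxr.
  by rewrite /a /b; have := d0 (maxn m n); lra.
exists (sup (range a)) => n.
have n0 : range a !=set0 by exists (a 0); exists 0.
have ub : has_ubound (range a) by exists (b n) => _ [m _ <-]; exact: ab.
have l1 : a n <= sup (range a) by apply: ub_le_sup => //; exists n.
have l2 : sup (range a) <= b n.
  by apply: ge_sup => // _ [m _ <-]; exact: ab.
by rewrite -/(d n) ler_norml; move: l1 l2; rewrite /a /b; lra.
Qed.

Lemma exp_half_small (e : R) : 0 < e -> exists n, 2^-1 ^+ n <= e.
Proof.
move=> e0; have [n hn] : exists n : nat, e^-1 <= n%:R.
  by exists (Num.bound e^-1); apply/ltW/archi_boundP; rewrite invr_ge0 ltW.
exists n; rewrite exprVn -[e]invrK lef_pV2 ?posrE ?invr_gt0// ?exprn_gt0//.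
by rewrite (le_trans hn)// -natrX ler_nat ltnW// ltn_expl.
Qed.

Lemma picard : exists x : R -> 'M[R]_3, x 0 = x0 /\
  forall t : R, 0 <= t -> forall i j, is_derive t 1 (fun s => x s i j) (G t (x t) i j).
Proof.
have X_max n t : X_ n (Num.max t 0) = X_ n t.
  case: n => [//|n]; rewrite /X_ /= /pstepm; congr (pstep _ _).
  by rewrite max_l// max0_ge0.
(* Limits are chosen for all triples [(t, i, j)] at once; [Num.max] keeps the error bound valid at
   negative times, where the iterates are frozen. *)
have /choice[X hX] : forall p : R * ('I_3 * 'I_3), exists l : R, forall n,
    `|X_ n p.1 p.2.1 p.2.2 - l| <= 2 * 2^-1 ^+ n * E (Num.max p.1 0).
  move=> [t [i j]] /=; apply: geometric_limit => n; rewrite -(X_max n) -(X_max n.+1).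
  exact: X_step (max0_ge0 t) i j.
pose Y t : 'M[R]_3 := \matrix_(i, j) X (t, (i, j)).
have hY n t i j : `|X_ n t i j - Y t i j| <= 2 * 2^-1 ^+ n * E (Num.max t 0).
  by rewrite mxE; exact: (hX (t, (i, j))).
have cY : cpath Y.
  move=> i j t; apply/cvgrPdist_le => e e0.
  pose M := E (Num.max t 0) + 1.
  have M0 : 0 < M by rewrite /M ltr_wpDl// expR_ge0.
  have tM : E (Num.max t 0) <= M by rewrite /M lerDl ler01.
  have [n hn] : exists n, 2^-1 ^+ n <= e / (6 * M).
    by apply: exp_half_small; rewrite divr_gt0// mulr_gt0.
  have b0 : 2 * 2^-1 ^+ n * M <= e / 3.
    move: hn; rewrite ler_pdivlMr ?mulr_gt0//; lra.
  have hc : (fun z : R => E (Num.max z 0)) @ t --> E (Num.max t 0).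
    exact: (@continuous_comp R R R (fun t => Num.max t 0) E t
      (@continuous_max0 t) (derivable_continuous_at (dE (max0_ge0 t)))).
  near=> z.
  have hE : E (Num.max z 0) <= M.
    by near: z; apply: (cvgr_le _ hc); rewrite /M ltrDl.
  have h1 : `|X_ n t i j - X_ n z i j| <= e / 3.
    by near: z; have := @cX_ n i j t; move/cvgrPdist_le; apply; rewrite divr_gt0.
  have q0 : 0 <= 2 * 2^-1 ^+ n :> R by rewrite mulr_ge0// exprn_ge0// invr_ge0.
  have h2 : `|X_ n z i j - Y z i j| <= e / 3.
    exact: le_trans (hY n z i j) (le_trans (ler_wpM2l q0 hE) b0).
  have h3 : `|X_ n t i j - Y t i j| <= e / 3.
    exact: le_trans (hY n t i j) (le_trans (ler_wpM2l q0 tM) b0).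
  exact: dist_third h1 h2 h3.
(* For [t >= 0], [pstep (X_ n) t] equals [X_ n.+1 t]: it is close to [pstep Y t] by contraction and
   to [Y t] by [hY], with errors of order [2^-n * E t]. *)
have fix_ t : 0 <= t -> pstep Y t = Y t.
  move=> t0; apply/matrixP => i j; apply/eqP; rewrite -subr_eq0 -normr_eq0 eq_le normr_ge0 andbT.
  apply/ler_addgt0Pr => e e0; rewrite add0r.
  have Et : 0 < E t by exact: expR_gt0.
  have [n hn] : exists n, 2^-1 ^+ n <= e / (2 * E t).
    by apply: exp_half_small; rewrite divr_gt0// mulr_gt0.
  have h1 : `|pstep (X_ n) t i j - pstep Y t i j| <= 2 * 2^-1 ^+ n / 2 * E t.
    have hc z : 0 <= z -> forall k l, `|X_ n z k l - Y z k l| <= 2 * 2^-1 ^+ n * E z.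
      by move=> z0 k l; have := hY n z k l; rewrite max_l.
    exact: (pstep_contract (@cX_ n) cY hc t0 i j).
  have h2 := hY n.+1 t i j; rewrite max_l// exprS /X_ iterS pstepmE// -/(X_ n) in h2.
  move: hn; rewrite ler_pdivlMr ?mulr_gt0// => hn.
  move: h1 h2 hn; rewrite !ler_norml; lra.
exists (pstep Y); split; first exact: pstep0.
by move=> t t0 i j; rewrite fix_//; exact: derive_pstep.
Unshelve. all: by end_near. Qed.
End Picard.

(** * Derivative of A along a path, and the inverse tensor D(B) *)

Section PathDerivative.
Variable R : realType.

(** Differentiation under the integral sign. A common [rho] and [beta] on an open interval around
    [t0] give a majorant independent of [t]; symmetry of [H] at [t0] serves to recognise the result
    as a contraction with [Cten]. *)
Lemma derive_Amap (X H : R -> 'M[R]_3) (u v t0 rho beta : R) i j : u < t0 < v ->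
  (forall t, u < t < v -> ellip rho (X t)) ->
  (forall t, u < t < v -> forall k l, is_derive t 1 (fun z => X z k l) (H t k l)) ->
  (forall t, u < t < v -> forall k l, `|H t k l| <= beta) -> mx_sym (H t0) ->
  is_derive t0 1 (fun t => Amap (X t) i j) (- tcontract (Cten (X t0)) (H t0) i j).
Proof.
move=> ut eX dX Hb sH.
pose f (t s : R) := Aintegrand (X t) i j s.
have df t s : u < t < v -> 0 <= s ->
    is_derive t 1 (f ^~ s) (- 2 * (Cdensity (X t) (H t) s i j * weight (X t) s)).
  move=> tuv s0.
  have dB k l : is_derive t 1 (fun z => Bs (X z) s k l) (H t k l).
    rewrite (_ : (fun z => _) = fun z => X z k l + (s%:M : 'M[R]_3) k l); last first.
      by apply/funext => z; rewrite /Bs mxE.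
    by have := is_drv_add (dX t tuv k l) (is_drv_cst ((s%:M : 'M[R]_3) k l) t); rewrite addr0.
  have d0 := det_Bs_gt0 (eX t tuv) s0.
  have := is_drv_mul (derive_invmx dB d0 i j) (derive_sqrtdet dB d0).
  move/is_derive_eq; apply; rewrite -/(resolvent (X t) s) -/(weight (X t) s) /Cdensity.
  by set Q := resolvent _ _ *m _ *m _; rewrite !mxE; field.
have b0 : 0 <= beta by apply: le_trans (Hb t0 ut o0 o0).
have r0 : 0 < rho by exact: rho_gt0 (eX t0 ut).
(* [81 = 27 * 3], from the bounds [p5] on twice the density and [p6] on the weight. *)
pose c := 81 * rho ^+ 4 * beta.
have c0 : 0 <= c by rewrite !mulr_ge0// ?exprn_ge0// ltW.
have bd t s : u < t < v -> 0 <= s ->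
    `|- 2 * (Cdensity (X t) (H t) s i j * weight (X t) s)| <= c * wt s.
  move=> tuv s0; have e := eX t tuv; have q0 := q_gt0 s0; have q1 := q_le1 s0.
  have p1 := mulmx3_le i j (resolvent_le e s0) (Hb t tuv) (resolvent_le e s0).
  have p2 : `|\tr (resolvent (X t) s *m H t)| <= 9 * (rho * (1 + s)^-1 * beta).
    rewrite /mxtrace; apply: (le_trans (ler_norm_sum _ _ _)).
    apply: (@le_trans _ _ (\sum_(k < 3) 3 * (rho * (1 + s)^-1 * beta))); last by rewrite sum3; lra.
    apply: ler_sum => k _; rewrite mxE; apply: (le_trans (ler_norm_sum _ _ _)).
    apply: (@le_trans _ _ (\sum_(l < 3) (rho * (1 + s)^-1 * beta))); last by rewrite sum3; lra.
    by apply: ler_sum => l _; rewrite normrM ler_pM//; [exact: resolvent_le|exact: Hb].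
  have p3 := resolvent_le e s0 i j.
  have p4 : `|\tr (resolvent (X t) s *m H t) * resolvent (X t) s i j| <= 9 * (rho * (1 + s)^-1 * beta) * (rho * (1 + s)^-1).
    by rewrite normrM ler_pM.
  have p5 : `|2 * Cdensity (X t) (H t) s i j| <= 27 * (rho * (1 + s)^-1 * beta * (rho * (1 + s)^-1)).
    have -> : 2 * Cdensity (X t) (H t) s i j = (resolvent (X t) s *m H t *m resolvent (X t) s) i j
        + 2^-1 * (\tr (resolvent (X t) s *m H t) * resolvent (X t) s i j).
      by rewrite /Cdensity; set Q := resolvent _ _ *m _ *m _; rewrite !mxE; field.
    apply: (le_trans (ler_normD _ _)); rewrite [`|2^-1 * _|]normrM [`|2^-1|]ger0_norm ?invr_ge0//.
    by move: p1 p4 (normr_ge0 (\tr (resolvent (X t) s *m H t) * resolvent (X t) s i j)); lra.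
  have p6 : `|weight (X t) s| <= 3 * rho ^+ 2 * (1 + s)^-1.
    by rewrite gtr0_norm ?(weight_gt0 e s0)//; exact: weight_le.
  rewrite mulrA mulNr mulNr normrN normrM.
  apply: (le_trans (ler_pM _ _ p5 p6)) => //.
  have -> : 27 * (rho / (1 + s) * beta * (rho / (1 + s))) * (3 * rho ^+ 2 / (1 + s)) =
     c * wt s * (1 + s)^-1.
    by rewrite /c /wt -exprVn; ring.
  by rewrite ler_piMr// mulr_ge0// wt_ge0.
have It0 : `]u, v[%classic t0 by rewrite /= in_itv.
pose G s : R := c * wt s.
have G0 s : 0 <= G s by rewrite mulr_ge0// wt_ge0.
have iG : (@lebesgue_measure R).-integrable `[0, +oo[%classic (EFin \o G).
  apply: dominated_integrable; apply: dominatedZ; exact: dominated_wt.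
have intf t : `]u, v[%classic t -> (@lebesgue_measure R).-integrable `[0, +oo[%classic (EFin \o f t).
  by rewrite /= in_itv/= => tuv; apply: dominated_integrable; exact: dominated_Aintegrand (eX t tuv) i j.
have derf t s : `]u, v[%classic t -> `[0, +oo[%classic s -> derivable (f ^~ s) t 1.
  rewrite /= !in_itv/= andbT => tuv s0; exact: (@ex_derive _ _ _ _ _ _ _ (df t s tuv s0)).
have Gub t s : `]u, v[%classic t -> `[0, +oo[%classic s -> `|partial1of2 f t s| <= G s.
  rewrite /= !in_itv/= andbT => tuv s0; rewrite partial1of2E.
  rewrite (@derive_val _ _ _ _ _ _ _ (df t s tuv s0)); exact: bd.
have mh : measurable (`[0, +oo[%classic : set R) by [].
have D1 := @derivable_under_integral R _ _ (@lebesgue_measure R) f _ mh t0 u v It0 intf derf G G0 iG Gub.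
have D2 := @differentiation_under_integral R _ _ (@lebesgue_measure R) f _ mh t0 u v It0 intf derf G G0 iG Gub.
have D : is_derive t0 1 (fun t => int0oo (f t))
    (int0oo (fun s => - 2 * (Cdensity (X t0) (H t0) s i j * weight (X t0) s))).
  apply: DeriveDef; first exact: D1.
  rewrite -derive1E; apply: etrans D2 _; apply: eq_int0oo => s s0.
  by rewrite partial1of2E (@derive_val _ _ _ _ _ _ _ (df t0 s ut s0)).
rewrite (_ : (fun t => _) = fun t => 2^-1 * int0oo (f t)); last first.
  by apply/funext => t; rewrite AmapE.
have := is_drv_scale 2^-1 D; move/is_derive_eq; apply.
rewrite int0ooZ; last exact: dominated_Cdensity (eX t0 ut) _ i j.
by rewrite (tcontract_Cten (eX t0 ut))//; field.
Qed.
End PathDerivative.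

(* [Dten_id] is picked from an opaque existence proof so that unification never
   unfolds the integrals hidden in [Dten]. *)
Lemma Dten_id_exists (R : realType) : exists F : 'M[R]_3 -> 'M[R]_3,
  forall B, F B = tcontract (Dten B) 1%:M.
Proof. by exists (fun B => tcontract (Dten B) 1%:M). Qed.

Definition Dten_id (R : realType) : 'M[R]_3 -> 'M[R]_3 := sval (cid (Dten_id_exists R)).

Lemma Dten_idE (R : realType) (B : 'M[R]_3) : Dten_id B = tcontract (Dten B) 1%:M.
Proof. exact: (svalP (cid (Dten_id_exists R))). Qed.

Section Inverse.
Variable R : realType.
Implicit Types (T : tensor4 R) (M N H : 'M[R]_3).

Lemma tcontract_linear T (a : R) M N :
  tcontract T (a *: M + N) = a *: tcontract T M + tcontract T N.
Proof.
apply/matrixP => i j; rewrite !mxE big_distrr -big_split; apply: eq_bigr => k _ /=.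
rewrite big_distrr -big_split; apply: eq_bigr => l _ /=; rewrite !mxE; ring.
Qed.

Lemma tcontract0 T : tcontract T 0 = 0.
Proof.
apply/matrixP => i j; rewrite !mxE big1// => k _; rewrite big1// => l _.
by rewrite mxE mulr0.
Qed.

Lemma tcontractZ T (a : R) M : tcontract T (a *: M) = a *: tcontract T M.
Proof. by rewrite -[a *: M]addr0 tcontract_linear tcontract0 addr0. Qed.

Lemma tcontractD T M N : tcontract T (M + N) = tcontract T M + tcontract T N.
Proof. by rewrite -[M]scale1r tcontract_linear !scale1r. Qed.

Lemma tcontractB T M N : tcontract T (M - N) = tcontract T M - tcontract T N.
Proof. by rewrite tcontractD -scaleN1r tcontractZ scaleN1r. Qed.

Variables (rho : R) (B : 'M[R]_3).
Hypothesis eB : ellip rho B.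

Lemma sym_tcontract_Cten M : mx_sym (tcontract (Cten B) M).
Proof.
have t a b c d : int0oo (Cintegrand B a b c d) = int0oo (Cintegrand B b a c d).
  by apply: eq_int0oo => s s0; rewrite /Cintegrand (sym_entry a b (sym_resolvent eB s)).
have c1 a b c d : int0oo (Cintegrand B a b c d) = int0oo (Cintegrand B c d a b).
  by apply: eq_int0oo => s _; rewrite /Cintegrand [_ * resolvent B s c d]mulrC.
apply/matrixP => i j; rewrite !mxE; apply: eq_bigr => k _; apply: eq_bigr => l _.
congr (_ * _); rewrite !(CtenE eB); congr (_ * _).
by rewrite (t j i) (c1 j k) (c1 j l) -!addrA; congr (_ + _); rewrite addrC.
Qed.

(** A quantitative inverse. With [a = 162 rho^4 E], coercivity and Young's inequality bound the sum
    of the squares of the entries of [H] by half of itself plus [9 a^2 / 2], so every entry is at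
    most [3 a]. *)
Lemma Cten_entry_le H (E : R) i j : mx_sym H ->
  (forall k l, `|tcontract (Cten B) H k l| <= E) -> `|H i j| <= 486 * rho ^+ 4 * E.
Proof.
move=> sH HE; have r0 := rho_gt0 eB.
have E0 : 0 <= E by apply: le_trans (HE o0 o0).
have h := Cten_pos eB sH; set a := 162 * rho ^+ 4 * E.
have a0 : 0 <= a by rewrite !mulr_ge0// ?exprn_ge0// ltW.
have r4 : 0 <= 162 * rho ^+ 4 by rewrite mulr_ge0// exprn_ge0// ltW.
rewrite tr_sym_sqr// in h.
have h2 : 162 * rho ^+ 4 * mdot H (tcontract (Cten B) H) <=
    \sum_(k < 3) \sum_(l < 3) (H k l ^+ 2 / 2 + a ^+ 2 / 2).
  rewrite /mdot big_distrr; apply: ler_sum => k _; rewrite /= big_distrr; apply: ler_sum => l _ /=.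
  apply: (@le_trans _ _ (`|H k l| * a)).
    apply: (le_trans (ler_norm _)); rewrite mulrCA normrM ler_wpM2l// normrM ger0_norm//.
    by rewrite /a ler_wpM2l.
  have := sqr_ge0 (`|H k l| - a); rewrite sqrrB real_normK ?num_real//; lra.
have h3 : H i j ^+ 2 <= \sum_(k < 3) \sum_(l < 3) H k l ^+ 2.
  rewrite (bigD1 i)//= (bigD1 j)//= -addrA lerDl addr_ge0//.
    by apply: sumr_ge0 => l _; exact: sqr_ge0.
  by apply: sumr_ge0 => k _; apply: sumr_ge0 => l _; exact: sqr_ge0.
have h4 : `|H i j| ^+ 2 <= (3 * a) ^+ 2.
  have e1 : \sum_(k < 3) \sum_(l < 3) (H k l ^+ 2 / 2 + a ^+ 2 / 2) =
      (\sum_(k < 3) \sum_(l < 3) H k l ^+ 2) / 2 + 9 * a ^+ 2 / 2.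
    by rewrite !sum3; field.
  rewrite real_normK ?num_real//; move: (le_trans h h2) h3; rewrite e1.
  have -> : (3 * a) ^+ 2 = 9 * a ^+ 2 by ring.
  lra.
have -> : 486 * rho ^+ 4 * E = 3 * a by rewrite /a; ring.
by rewrite -(@ler_pXn2r _ 2)// ?nnegrE// mulr_ge0.
Qed.

Lemma Cten_inj H : mx_sym H -> tcontract (Cten B) H = 0 -> H = 0.
Proof.
move=> sH H0; apply/matrixP => i j; rewrite mxE; apply/eqP; rewrite -normr_le0.
rewrite -(mulr0 (486 * rho ^+ 4)); apply: Cten_entry_le => // k l.
by rewrite H0 mxE normr0.
Qed.

Lemma Cten_surj N : mx_sym N -> exists2 M, mx_sym M & tcontract (Cten B) M = N.
Proof.
(* [Cten B] annihilates antisymmetric matrices. Adding [M - M^T] gives an injective endomorphism of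
   the whole matrix space, hence a surjective one, and a symmetric image forces a symmetric preimage
   ([finj]). *)
pose f M := tcontract (Cten B) M + (M - M^T).
have lf : linear f.
  move=> a u v; rewrite /f tcontract_linear linearD/= linearZ/=.
  by apply/matrixP => i j; rewrite !mxE; ring.
pose F : {linear 'M[R]_3 -> 'M[R]_3} := HB.pack f (GRing.isLinear.Build _ _ _ _ f lf).
have finj M N' : mx_sym N' -> f M = N' -> mx_sym M.
  move=> sN' fM; have := sym_tcontract_Cten M; rewrite /mx_sym => sC.
  have E : M - M^T = N' - tcontract (Cten B) M by rewrite -fM /f addrAC subrr add0r.
  have : (M - M^T)^T = M - M^T by rewrite E linearB/= sN' sC.
  rewrite linearB/= trmxK => E2; apply/matrixP => i j.
  by have := congr1 (fun Z : 'M[R]_3 => Z i j) E2; rewrite !mxE; lra.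
have sz : mx_sym (0 : 'M[R]_3) by rewrite /mx_sym trmx0.
have uF : lin_mx F \in unitmx.
  rewrite -row_free_unit; apply: inj_row_free => v; rewrite mul_rV_lin => /eqP.
  rewrite -[X in _ == X](linear0 mxvec) (can_eq mxvecK) => /eqP fv.
  have sv := finj _ _ sz fv.
  rewrite -[v]vec_mxK (Cten_inj sv) ?linear0//.
  by move: fv; rewrite /= /f sv subrr addr0.
move=> sN; pose M := vec_mx (mxvec N *m invmx (lin_mx F)).
have fM : f M = N.
  have := mul_rV_lin F (mxvec N *m invmx (lin_mx F)); rewrite mulmxKV// => /eqP.
  by rewrite (can_eq mxvecK) => /eqP ->.
exists M; first exact: finj sN fM.
by rewrite -[RHS]fM /f (finj _ _ sN fM) subrr addr0.
Qed.

Lemma Dten_spec : is_Dten B (Dten B).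
Proof.
apply: ClassicalEpsilon.epsilon_spec.
(* The inverse tensor is assembled from preimages of the symmetrised matrix units. Both minor
   symmetries are then immediate, and injectivity turns the right inverse into a left one. *)
pose E (k l : 'I_3) : 'M[R]_3 := 2^-1 *: (delta_mx k l + delta_mx l k).
have sE k l : mx_sym (E k l).
  by rewrite /mx_sym linearZ/= linearD/= !trmx_delta addrC.
have EC k l : E k l = E l k by rewrite /E addrC.
have /choice[g hg] : forall N : 'M[R]_3, exists M : 'M[R]_3, mx_sym N ->
    mx_sym M /\ tcontract (Cten B) M = N.
  move=> N; have [sN|nN] := pselect (mx_sym N); last by exists 0.
  by have [M sM CM] := Cten_surj sN; exists M.
have sg k l : mx_sym (g (E k l)) by case: (hg _ (sE k l)).
have Cg k l : tcontract (Cten B) (g (E k l)) = E k l by case: (hg _ (sE k l)).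
pose D : tensor4 R := fun i j k l => g (E k l) i j.
have DE N : tcontract D N = \sum_(k < 3) \sum_(l < 3) N k l *: g (E k l).
  apply/matrixP => i j; rewrite mxE summxE; apply: eq_bigr => k _; rewrite summxE.
  by apply: eq_bigr => l _; rewrite mxE mulrC.
have sD N : mx_sym (tcontract D N).
  apply/matrixP => i j; rewrite !mxE; apply: eq_bigr => k _; apply: eq_bigr => l _.
  by rewrite /D (sym_entry i j (sg k l)).
have CD N : mx_sym N -> tcontract (Cten B) (tcontract D N) = N.
  move=> sN; rewrite DE.
  have tsum (h : 'I_3 -> 'M[R]_3) : tcontract (Cten B) (\sum_k h k) = \sum_k tcontract (Cten B) (h k).
    by rewrite !sum3 !tcontractD.
  rewrite tsum; under eq_bigr do rewrite tsum.
  under eq_bigr do under eq_bigr do rewrite tcontractZ Cg.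
  transitivity (2^-1 *: (N + N^T)).
    have ne : (((o0 == o1) = false) * ((o1 == o0) = false) * ((o0 == o2) = false)
      * ((o2 == o0) = false) * ((o1 == o2) = false) * ((o2 == o1) = false))%type by [].
    apply/matrixP; apply: ord3_ind; apply: ord3_ind;
      rewrite !sum3 /E !mxE !ne !eqxx /=; ring.
  by rewrite sN; apply/matrixP => i j; rewrite !mxE; lra.
exists D; split.
  by move=> i j k l; split; [exact: sym_entry (sg k l)|rewrite /D EC].
move=> M sM; split; first exact: CD.
apply/eqP; rewrite -subr_eq0; apply/eqP; apply: Cten_inj.
  by rewrite /mx_sym linearB/= sD sM.
by rewrite tcontractB CD ?subrr//; exact: sym_tcontract_Cten.
Qed.

Lemma sym_Dten N : mx_sym (tcontract (Dten B) N).
Proof.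
apply/matrixP => i j; rewrite !mxE; apply: eq_bigr => k _; apply: eq_bigr => l _.
by congr (_ * _); have [/(_ j i k l)[] ] := Dten_spec.
Qed.

Lemma sym_one : mx_sym (1%:M : 'M[R]_3).
Proof. by rewrite /mx_sym tr_scalar_mx. Qed.

Lemma sym_Dten_id : mx_sym (Dten_id B).
Proof. by rewrite Dten_idE; exact: sym_Dten. Qed.

Lemma Cten_Dten_id : tcontract (Cten B) (Dten_id B) = 1%:M.
Proof. by rewrite Dten_idE; have [_ /(_ _ sym_one)[]] := Dten_spec. Qed.

Lemma Dten_Amap : tcontract (Dten B) (Amap B) = (2 / 3) *: B.
Proof.
have sB : mx_sym B by case: eB.
have [_ /(_ _ sB)[_ ]] := Dten_spec; rewrite (Cten_self eB) tcontractZ => E.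
by rewrite -[in RHS]E scalerA (_ : 2 / 3 * (3 / 2) = 1) ?scale1r//; field.
Qed.

Lemma tr_Dten_id_ge0 : 0 <= \tr (Dten_id B).
Proof.
have sF := sym_Dten_id; have r0 := rho_gt0 eB.
have := Cten_pos eB sF; rewrite Cten_Dten_id mdot_tr// mulmx1.
have := tr_sym_sqr_ge0 sF; move=> h1 h2; have := le_trans h1 h2.
by rewrite pmulr_rge0// mulr_gt0// exprn_gt0.
Qed.

(** With [F = Dten_id B], self-adjointness gives [3 = tr I = <I, C : F> = <C : I, F>], and
    [Cten_one] evaluates [C : I]. *)
Lemma tr_inv_Dten_id : \tr (invmx B *m (Dten_id B)) = 6 * Num.sqrt (\det B).
Proof.
have sB : mx_sym B by case: eB.
have s0 : Num.sqrt (\det B) != 0 by rewrite gt_eqF// sqrtr_gt0 posdef_det//; exact: ellip_spd eB.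
have := Cten_adj eB 1%:M (Dten_id B); rewrite (Cten_one eB) Cten_Dten_id.
rewrite mdot_tr; last exact: sym_one.
rewrite mul1mx mxtrace1 mdot_tr; last first.
  by rewrite /mx_sym linearZ/= (sym_inv sB).
rewrite -scalemxAl mxtraceZ => h.
apply: (mulfI (_ : 2^-1 / Num.sqrt (\det B) != 0)).
  by rewrite mulf_neq0// ?invr_neq0.
by rewrite -h; field.
Qed.

Lemma Dten_id_le i j : `|(Dten_id B) i j| <= 486 * rho ^+ 4.
Proof.
rewrite -[leRHS]mulr1; apply: Cten_entry_le; first exact: sym_Dten_id.
move=> k l; rewrite Cten_Dten_id !mxE; case: (k == l); rewrite ?mulr1n ?mulr0n ?normr0 ?normr1//.
Qed.
End Inverse.

Section FmLipschitz.
Variable R : realType.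

Definition Dten_id_lipconst (rho : R) : R :=
  486 * rho ^+ 4 * (9 * (540 * rho ^+ 8 * (486 * rho ^+ 4))).

(** The difference satisfies [C(B1) : (F1 - F2) = (C(B2) - C(B1)) : F2]. The right side is small by
    [Cten_lip], and [Cten_entry_le] inverts [C(B1)]. *)
Lemma Dten_id_lip (rho e : R) (B1 B2 : 'M[R]_3) i j : ellip rho B1 -> ellip rho B2 ->
  (forall i j, `|B1 i j - B2 i j| <= e) ->
  `|Dten_id B1 i j - Dten_id B2 i j| <= Dten_id_lipconst rho * e.
Proof.
move=> e1 e2 B12.
have -> : Dten_id_lipconst rho * e = 486 * rho ^+ 4 * (9 * (540 * rho ^+ 8 * e * (486 * rho ^+ 4))).
  by rewrite /Dten_id_lipconst; ring.
have subE (X Y : 'M[R]_3) : X i j - Y i j = (X - Y) i j by rewrite !mxE.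
rewrite subE.
apply: (Cten_entry_le e1).
  by rewrite /mx_sym linearB/= (sym_Dten_id e1) (sym_Dten_id e2).
move=> k l; rewrite tcontractB (Cten_Dten_id e1) -(Cten_Dten_id e2) !mxE -sumrB.
apply: (le_trans (ler_norm_sum _ _ _)).
apply: (@le_trans _ _ (\sum_(m < 3) \sum_(n < 3) (540 * rho ^+ 8 * e * (486 * rho ^+ 4)))); last first.
  by rewrite !sum3; lra.
apply: ler_sum => m _; rewrite -sumrB; apply: (le_trans (ler_norm_sum _ _ _)).
apply: ler_sum => n _; rewrite -mulrBl normrM ler_pM//; last exact: Dten_id_le e2 m n.
by rewrite distrC; exact: Cten_lip.
Qed.
End FmLipschitz.

(** * Positivity along paths and the cutoff *)

Section PositivityPath.
Variable R : realType.
Implicit Types (X : 'M[R]_3).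

(** A vanishing diagonal entry with nonnegative minors kills its whole row. *)
Lemma det_sym3_le0 (a b c x y z : R) : a = 0 -> 0 <= a * b - x * x -> 0 <= a * c - y * y ->
  a * (b * c - z * z) - x * (x * c - z * y) + y * (x * z - b * y) <= 0.
Proof.
move=> -> hx hy.
have -> : x = 0 by apply/eqP; rewrite -sqrf_eq0 expr2; apply/eqP; have := sqr_ge0 x; rewrite expr2; lra.
have -> : y = 0 by apply/eqP; rewrite -sqrf_eq0 expr2; apply/eqP; have := sqr_ge0 y; rewrite expr2; lra.
lra.
Qed.

(** From the identity [a det = (a b - x^2) (a c - y^2) - (a z - x y)^2]. *)
Lemma det_sym3_minor (a b c x y z : R) : a * b - x * x = 0 -> 0 <= a * c - y * y ->
  a * (a * (b * c - z * z) - x * (x * c - z * y) + y * (x * z - b * y)) <= 0.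
Proof.
move=> h h2.
have -> : a * (a * (b * c - z * z) - x * (x * c - z * y) + y * (x * z - b * y)) =
  (a * b - x * x) * (a * c - y * y) - (a * z - x * y) ^+ 2 by ring.
by rewrite h mul0r sub0r oppr_le0 sqr_ge0.
Qed.

(** A continuous scalar test for positive definiteness. All principal minors of orders 1 and 2
    enter, not just the leading ones: their joint nonnegativity is what excludes a zero when the
    determinant is positive. *)
Definition pminor X : R :=
  Num.min (Num.min (X o0 o0) (Num.min (X o1 o1) (X o2 o2)))
    (Num.min (minor2 X o0 o1) (Num.min (minor2 X o0 o2) (minor2 X o1 o2))).

Lemma pminor_gt0 X : mx_spd X -> 0 < pminor X.
Proof.
move=> sp; rewrite /pminor !lt_min; have pX := sp.2.
by rewrite !posdef_diag// !posdef_minor2.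
Qed.

Lemma pminor_neq0 X : mx_sym X -> 0 < \det X -> pminor X != 0.
Proof.
move=> sX d0; apply/eqP => p0.
have : 0 <= pminor X by rewrite p0.
rewrite /pminor !le_min => /andP[/andP[a0 /andP[b0 c0]] /andP[m1 /andP[m2 m3]]].
have E10 := sym_entry o0 o1 sX; have E20 := sym_entry o0 o2 sX; have E21 := sym_entry o1 o2 sX.
move: d0 m1 m2 m3; rewrite det3 /minor2 E10 E20 E21 => d0 m1 m2 m3.
set a := X o0 o0 in d0 a0 m1 m2 m3 *; set b := X o1 o1 in d0 b0 m1 m2 m3 *.
set c := X o2 o2 in d0 c0 m1 m2 m3 *; set x := X o0 o1 in d0 m1 m2 m3 *.
set y := X o0 o2 in d0 m1 m2 m3 *; set z := X o1 o2 in d0 m1 m2 m3 *.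
have a1 : a != 0.
  by apply/eqP => h; have := det_sym3_le0 z h m1 m2; lra.
have b1 : b != 0.
  apply/eqP => h; have h1 : 0 <= b * a - x * x by lra.
  by have := det_sym3_le0 y h h1 m3; lra.
have c1 : c != 0.
  apply/eqP => h; have h1 : 0 <= c * a - y * y by lra.
  have h2 : 0 <= c * b - z * z by lra.
  by have := det_sym3_le0 x h h1 h2; lra.
have ap : 0 < a by rewrite lt_neqAle eq_sym a1.
have bp : 0 < b by rewrite lt_neqAle eq_sym b1.
have m1' : a * b - x * x != 0.
  by apply/eqP => h; have := det_sym3_minor z h m2; rewrite pmulr_rle0//; lra.
have m2' : a * c - y * y != 0.
  by apply/eqP => h; have := det_sym3_minor z h m1; rewrite pmulr_rle0//; lra.
have m3' : b * c - z * z != 0.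
  apply/eqP => h; have h1 : 0 <= b * a - x * x by lra.
  by have := det_sym3_minor y h h1; rewrite pmulr_rle0//; lra.
have : 0 < pminor X.
  rewrite /pminor !lt_min /minor2 -/a -/b -/c -/x -/y -/z ap bp.
  by rewrite !lt_neqAle ![0 == _]eq_sym c1 m1' m2' m3' c0 m1 m2 m3.
by rewrite p0 ltxx.
Qed.

(** [pminor] along the path is continuous, positive at time 0 and never zero, so the intermediate
    value theorem keeps it positive. *)
Lemma spd_path (X : R -> 'M[R]_3) (T : R) : 0 <= T ->
  (forall t i j, 0 <= t -> {for t, continuous (fun s => X s i j)}) ->
  (forall t, 0 <= t -> mx_sym (X t)) -> (forall t, 0 <= t -> 0 < \det (X t)) ->
  mx_spd (X 0) -> mx_spd (X T).
Proof.
move=> T0 cX sX dX s0.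
have cm t i j : 0 <= t -> {for t, continuous (fun s => minor2 (X s) i j)}.
  move=> t0; apply: continuousB; apply: continuousM; exact: cX.
have cp t : 0 <= t -> {for t, continuous (fun s => pminor (X s))}.
  move=> t0; rewrite /pminor; repeat apply: continuous_min; by [exact: cX|exact: cm].
suff : 0 < pminor (X T).
  rewrite /pminor !lt_min => /andP[/andP[a0 _] /andP[m0 _]].
  by apply: minors_spd => //; [exact: sX|exact: dX].
rewrite ltNge; apply/negP => h.
have p0 := pminor_gt0 s0.
have [||c] := @IVT _ (fun s => pminor (X s)) 0 T 0 T0.
- apply: continuous_in_subspaceT => t; rewrite inE/= in_itv/= => /andP[t0 _]; exact: cp.
- by rewrite ge_min h orbT/= le_max ltW.
rewrite in_itv/= => /andP[c0 _] /eqP; apply/negP.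
by apply: pminor_neq0; [exact: sX|exact: dX].
Qed.

Lemma entry_le_tr X i j : mx_spd X -> `|X i j| <= \tr X.
Proof.
move=> sp; have d k : 0 < X k k by exact: posdef_diag sp.2.
have dt k : X k k <= \tr X.
  rewrite /mxtrace (bigD1 k)//= lerDl; apply: sumr_ge0 => l _; exact: ltW.
have [->|ij] := eqVneq i j; first by rewrite gtr0_norm.
have t0 : 0 <= \tr X by rewrite (le_trans (ltW (d o0))).
have := posdef_minor2 sp ij; rewrite /minor2 subr_gt0 -expr2 => h.
rewrite -(@ler_pXn2r _ 2)// ?nnegrE// real_normK ?num_real//.
by rewrite (le_trans (ltW h))// expr2 ler_pM// ltW.
Qed.
End PositivityPath.

(** * The Lipschitz cutoff and the truncated diffusion term *)

Section Cutoff.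
Variable R : realType.
Implicit Types (B : 'M[R]_3) (rho e x y : R).

Definition clip x : R := Num.max 0 (Num.min 1 x).

Lemma clip_ge0 x : 0 <= clip x.
Proof. by rewrite le_max lexx. Qed.

Lemma clip_le1 x : clip x <= 1.
Proof. by rewrite ge_max ler01 ge_min lexx. Qed.

Lemma clip_eq1 x : 1 <= x -> clip x = 1.
Proof. by move=> h; rewrite /clip min_l// max_r. Qed.

Lemma clip_neq0 x : clip x != 0 -> 0 < x.
Proof.
apply: contraNT; rewrite -leNgt => x0; rewrite /clip min_r ?(le_trans x0)// max_l//.
Qed.

Lemma clip_lip x y : `|clip x - clip y| <= `|x - y|.
Proof.
wlog xy : x y / x <= y.
  by move=> h; have [/h//|/ltW /h] := leP x y; rewrite distrC [`|y - x|]distrC.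
rewrite distrC [`|x - y|]distrC.
have m : clip x <= clip y.
  rewrite /clip ge_max clip_ge0 le_max; apply/orP; right.
  by rewrite le_min !ge_min lexx xy orbT.
rewrite !ger0_norm ?subr_ge0//.
rewrite /clip; case: (leP 1 x) => hx; case: (leP 1 y) => hy;
  rewrite ?(min_l hx) ?(min_l hy) ?(min_r (ltW hx)) ?(min_r (ltW hy)); rewrite /Num.max;
  repeat case: ifP => ?; lra.
Qed.

Lemma continuous_clip : continuous clip.
Proof.
move=> x; apply: continuous_max; first exact: cst_continuous.
by apply: continuous_min; [exact: cst_continuous|exact: id].
Qed.

(** Its supremum [mu B] is the smallest eigenvalue of the symmetric part of [B], in variational
    form; the Lipschitz bound [mu_lip] then comes straight from [qf_bound]. *)
Definition lowset B : set R := [set m | forall v, m * sqnorm v <= qf B v].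
Definition mu B : R := sup (lowset B).

Lemma lowset_nonempty B : lowset B !=set0.
Proof.
pose b := \sum_(i < 3) \sum_(j < 3) `|B i j|.
have hb i j : `|B i j| <= b.
  rewrite /b (bigD1 i)//= (bigD1 j)//= -addrA lerDl addr_ge0 ?sumr_ge0// => k _.
  by rewrite sumr_ge0.
by exists (- (3 * b)) => v; have := qf_bound v hb; rewrite ler_norml mulNr => /andP[].
Qed.

Lemma lowset_ub B : has_ubound (lowset B).
Proof.
exists (B o0 o0) => m /(_ (delta_mx o0 0)); rewrite sqnormE /qf trmx_delta -rowE -colE !mxE /=.
by rewrite expr1n expr0n !addr0 mulr1.
Qed.

Lemma mu_le B v : mu B * sqnorm v <= qf B v.
Proof.
have [->|v0] := eqVneq v 0.
  by rewrite /qf /sqnorm !mulmx0 !mxE mulr0.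
have n0 := sqnorm_gt0 v0; rewrite -ler_pdivlMr//; apply: ge_sup; first exact: lowset_nonempty.
by move=> m hm; rewrite ler_pdivlMr.
Qed.

Lemma mu_ge B m : (forall v, m * sqnorm v <= qf B v) -> m <= mu B.
Proof. by move=> h; apply: ub_le_sup => //; exact: lowset_ub. Qed.

Lemma mu_lip B1 B2 e : (forall i j, `|B1 i j - B2 i j| <= e) -> `|mu B1 - mu B2| <= 3 * e.
Proof.
move=> h.
have key (A C : 'M[R]_3) : (forall i j, `|A i j - C i j| <= e) -> mu A - 3 * e <= mu C.
  move=> hAC; apply: mu_ge => v.
  have -> : qf C v = qf A v + qf (C - A) v by rewrite -qfD addrC subrK.
  have := @qf_bound _ (C - A) v e; rewrite ler_norml => hb.
  have /hb/andP[h1 _] : forall i j, `|(C - A) i j| <= e by move=> i j; rewrite !mxE distrC.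
  have := mu_le A v; lra.
have := key _ _ h; have := key B2 B1; rewrite ler_norml.
have h' i j : `|B2 i j - B1 i j| <= e by rewrite distrC.
by move=> /(_ h'); lra.
Qed.

(** Equal to 1 when [tr B <= rho] and [mu B >= 1 / rho], and to 0 as soon as [tr B >= 2 rho] or
    [mu B <= 1 / (2 rho)]; hence the constant [2 * rho] in [chi_ellip]. *)
Definition chi rho B : R := clip (2 - \tr B / rho) * clip (2 * rho * mu B - 1).

Lemma chi_ge0 rho B : 0 <= chi rho B.
Proof. by rewrite mulr_ge0// clip_ge0. Qed.

Lemma chi_le1 rho B : chi rho B <= 1.
Proof. by rewrite mulr_ile1 ?clip_ge0 ?clip_le1. Qed.

Lemma chi_ellip rho B : 1 <= rho -> mx_sym B -> chi rho B != 0 -> ellip (2 * rho) B.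
Proof.
move=> r1 sB; have r0 : 0 < rho by exact: lt_le_trans r1.
rewrite mulf_eq0 negb_or => /andP[/clip_neq0 h1 /clip_neq0 h2].
have lB v : sqnorm v <= 2 * rho * qf B v.
  have h3 := mu_le B v; have h4 := sqnorm_ge0 v.
  apply: (@le_trans _ _ (2 * rho * mu B * sqnorm v)); first by rewrite ler_peMl//; lra.
  by rewrite -mulrA ler_wpM2l// mulr_ge0// ltW.
have sp : mx_spd B.
  split=> // v /sqnorm_gt0 v0; have := lt_le_trans v0 (lB v).
  by rewrite pmulr_rgt0// mulr_gt0.
split=> //; first by lra.
move=> i j; rewrite (le_trans (entry_le_tr i j sp))//.
by move: h1; rewrite subr_gt0 ltr_pdivrMr// => /ltW.
Qed.

Lemma chi_eq1 rho B : 0 < rho -> \tr B <= rho -> (forall v, sqnorm v <= rho * qf B v) ->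
  chi rho B = 1.
Proof.
move=> r0 tB lB; rewrite /chi !clip_eq1 ?mulr1//.
  have : rho^-1 <= mu B by apply: mu_ge => v; rewrite ler_pdivrMl.
  by rewrite -[rho^-1]mul1r ler_pdivrMr//; lra.
have : \tr B / rho <= 1 by rewrite ler_pdivrMr// mul1r.
lra.
Qed.

Lemma chi_lip rho B1 B2 e : 1 <= rho -> (forall i j, `|B1 i j - B2 i j| <= e) ->
  `|chi rho B1 - chi rho B2| <= 9 * rho * e.
Proof.
move=> r1 h; have r0 : 0 < rho by exact: lt_le_trans r1.
have e0 : 0 <= e by apply: le_trans (h o0 o0).
have t : `|clip (2 - \tr B1 / rho) - clip (2 - \tr B2 / rho)| <= 3 * e.
  apply: (le_trans (clip_lip _ _)).
  have -> : 2 - \tr B1 / rho - (2 - \tr B2 / rho) = (\tr B2 - \tr B1) / rho.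
    by field; rewrite gt_eqF.
  rewrite normrM [`|rho^-1|]gtr0_norm ?invr_gt0//.
  apply: (@le_trans _ _ `|\tr B2 - \tr B1|); first by rewrite ler_piMr// invf_le1.
  rewrite distrC /mxtrace -sumrB; apply: (le_trans (ler_norm_sum _ _ _)).
  by rewrite sum3; have := h o0 o0; have := h o1 o1; have := h o2 o2; lra.
have u : `|clip (2 * rho * mu B1 - 1) - clip (2 * rho * mu B2 - 1)| <= 6 * rho * e.
  apply: (le_trans (clip_lip _ _)).
  have -> : 2 * rho * mu B1 - 1 - (2 * rho * mu B2 - 1) = 2 * rho * (mu B1 - mu B2) by ring.
  rewrite normrM gtr0_norm ?mulr_gt0// (_ : 6 * rho * e = 2 * rho * (3 * e)); last by ring.
  by rewrite ler_wpM2l ?mulr_ge0 ?(ltW r0)// mu_lip.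
have c1 x : `|clip x| <= 1 by rewrite ger0_norm ?clip_ge0 ?clip_le1.
apply: (le_trans (mul_diff (c1 _) (c1 _) t u)); rewrite mulr1 mul1r.
have : e <= rho * e by rewrite ler_peMl.
lra.
Qed.

Definition diffusion B : 'M[R]_3 := 2 *: Dten_id B - 4 *: B.

Lemma diffusionE B i j : diffusion B i j = 2 * Dten_id B i j - 4 * B i j.
Proof. by rewrite /diffusion; move: (Dten_id B) => F; rewrite !mxE. Qed.

Definition diffusion_bound rho : R := 2 * (486 * rho ^+ 4) + 4 * rho.
Definition diffusion_lipconst rho : R := 2 * Dten_id_lipconst rho + 4.
Definition cutoff_lipconst rho : R := 9 * rho * diffusion_bound (2 * rho) + diffusion_lipconst (2 * rho).

Lemma diffusion_le rho B i j : ellip rho B -> `|diffusion B i j| <= diffusion_bound rho.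
Proof.
move=> eB; rewrite !diffusionE /diffusion_bound; have := Dten_id_le eB i j.
have [_ _ _ /(_ i j)] := eB; rewrite !ler_norml; lra.
Qed.

Lemma diffusion_lip rho e B1 B2 i j : ellip rho B1 -> ellip rho B2 ->
  (forall i j, `|B1 i j - B2 i j| <= e) -> `|diffusion B1 i j - diffusion B2 i j| <= diffusion_lipconst rho * e.
Proof.
move=> e1 e2 h; rewrite !diffusionE; have := Dten_id_lip i j e1 e2 h; have := h i j.
rewrite /diffusion_lipconst mulrDl !ler_norml.
by move: (Dten_id B1 i j) (Dten_id B2 i j) (B1 i j) (B2 i j) (Dten_id_lipconst rho) => x1 x2 y1 y2 z; lra.
Qed.

Lemma diffusion_bound_ge0 rho : 0 <= rho -> 0 <= diffusion_bound rho.
Proof. by move=> r0; have r4 := exprn_ge0 4 r0; rewrite /diffusion_bound; lra. Qed.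

Lemma Dten_id_lipconst_ge0 rho : 0 <= rho -> 0 <= Dten_id_lipconst rho.
Proof.
move=> r0; have p (n : nat) (x : R) : 0 <= x -> 0 <= n%:R * x.
  by move=> x0; apply: mulr_ge0 => //; exact: ler0n.
have r4 := exprn_ge0 4 r0; have r8 := exprn_ge0 8 r0.
apply: mulr_ge0; first exact: (p _ _ r4).
by apply: (p _); apply: mulr_ge0; [exact: (p _ _ r8)|exact: (p _ _ r4)].
Qed.

Lemma diffusion_lipconst_ge0 rho : 0 <= rho -> 0 <= diffusion_lipconst rho.
Proof. by move=> /Dten_id_lipconst_ge0 h; rewrite /diffusion_lipconst; lra. Qed.

Lemma chi_diffusion_lip rho e B1 B2 i j : 1 <= rho -> mx_sym B1 -> mx_sym B2 ->
  (forall i j, `|B1 i j - B2 i j| <= e) ->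
  `|chi rho B1 * diffusion B1 i j - chi rho B2 * diffusion B2 i j| <= cutoff_lipconst rho * e.
Proof.
move=> r1 s1 s2 h; have r0 : 0 <= 2 * rho by lra.
have e0 : 0 <= e by apply: le_trans (h o0 o0).
have cl := chi_lip r1 h.
have K0 := diffusion_bound_ge0 r0; have L0 := diffusion_lipconst_ge0 r0.
(* Where the cutoff vanishes at [C], the diffusion at [C] is out of control but multiplied by 0; the
   Lipschitz bound makes the cutoff at [A] small, and the diffusion at [A] is bounded. *)
have half (A C : 'M[R]_3) : mx_sym A -> chi rho C = 0 -> `|chi rho A - chi rho C| <= 9 * rho * e ->
    `|chi rho A * diffusion A i j| <= cutoff_lipconst rho * e.
  move=> sA c0; rewrite c0 subr0 => hA.
  have [->|cA] := eqVneq (chi rho A) 0.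
    by rewrite mul0r normr0 mulr_ge0// addr_ge0// mulr_ge0//; lra.
  rewrite normrM /cutoff_lipconst mulrDl mulrAC.
  apply: (@le_trans _ _ (9 * rho * e * diffusion_bound (2 * rho))); last by rewrite lerDl mulr_ge0.
  by rewrite ler_pM// diffusion_le//; exact: chi_ellip.
have [c2|c2] := eqVneq (chi rho B2) 0.
  by rewrite c2 mul0r subr0; apply: (half B1 B2).
have [c1|c1] := eqVneq (chi rho B1) 0.
  by rewrite c1 mul0r sub0r normrN; apply: (half B2 B1) => //; rewrite distrC.
have e1 := chi_ellip r1 s1 c1; have e2 := chi_ellip r1 s2 c2.
have ch : `|chi rho B2| <= 1 by rewrite ger0_norm ?chi_ge0 ?chi_le1.
apply: (le_trans (mul_diff ch (diffusion_le i j e1) cl (diffusion_lip i j e1 e2 h))).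
have -> : cutoff_lipconst rho * e = 9 * rho * e * diffusion_bound (2 * rho) + 1 * (diffusion_lipconst (2 * rho) * e) by rewrite /cutoff_lipconst; ring.
by [].
Qed.
End Cutoff.

(** * Global flow *)

Section Flow.
Variable R : realType.
Variables (lam m : R) (Om Ga : R -> 'M[R]_3) (D : R -> R) (B0 : 'M[R]_3).
Hypothesis cOm : forall i j, continuous (fun t => Om t i j).
Hypothesis cGa : forall i j, continuous (fun t => Ga t i j).
Hypothesis cD : continuous D.
Hypothesis Om_le : forall t i j, `|Om t i j| <= m.
Hypothesis Ga_le : forall t i j, `|Ga t i j| <= m.
Hypothesis D_le : forall t, `|D t| <= m.
Hypothesis sOm : forall t, mx_skew (Om t).
Hypothesis sGa : forall t, mx_sym (Ga t).
Hypothesis tGa : forall t, \tr (Ga t) = 0.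
Hypothesis D0 : forall t, 0 <= D t.
Hypothesis spB0 : mx_spd B0.
Hypothesis dB0 : \det B0 = 1.

Let m0 : 0 <= m := le_trans (normr_ge0 _) (D_le 0).

Definition strain t (S : 'M[R]_3) : 'M[R]_3 :=
  S *m (Om t + lam *: Ga t) + (- Om t + lam *: Ga t) *m S.

(** [9 m |lam|] bounds the contribution of [lam tr (B Gamma)] entry by entry; [4 m] comes from the
    term [- 4 B] of the diffusion. *)
Definition trace_rate : R := 9 * m * `|lam| + 4 * m.
Definition trace_bound (t : R) : R := \tr B0 * expR (trace_rate * t).
(** With trace bound [T] and determinant 1, the entries of the inverse are at most [2 T^2], so
    [qf_lower] asks for [6 T^2]; [T] dominates the entries and 1 secures [1 <= rho]. *)
Definition ellip_bound (t : R) : R := 6 * trace_bound t ^+ 2 + trace_bound t + 1.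

(** The cutoff controls symmetric matrices only, whereas Picard iteration needs a field that is
    Lipschitz on all matrices. *)
Definition sympart (M : 'M[R]_3) : 'M[R]_3 := 2^-1 *: (M + M^T).

Definition cutoff_field t (M : 'M[R]_3) : 'M[R]_3 :=
  - (2^-1 *: strain t (sympart M)) - (D t * chi (ellip_bound t) (sympart M)) *: diffusion (sympart M).

Let trace_rate_ge0 : 0 <= trace_rate.
Proof. by rewrite addr_ge0 ?mulr_ge0. Qed.

Let tB0 : 0 < \tr B0.
Proof.
by rewrite /mxtrace sum3 !addr_gt0// posdef_diag//; case: spB0.
Qed.

Let trace_bound_gt0 t : 0 < trace_bound t.
Proof. by rewrite mulr_gt0// expR_gt0. Qed.

Let ellip_bound_ge1 t : 1 <= ellip_bound t.
Proof. by have := trace_bound_gt0 t; have := sqr_ge0 (trace_bound t); rewrite /ellip_bound; lra. Qed.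

Let trace_bound_mono s t : s <= t -> trace_bound s <= trace_bound t.
Proof. by move=> st; rewrite ler_wpM2l ?ler_expR ?ler_wpM2l// ltW. Qed.

Lemma ellip_bound_mono s t : s <= t -> ellip_bound s <= ellip_bound t.
Proof.
move=> /trace_bound_mono h; have t0 := trace_bound_gt0 s.
have : trace_bound s ^+ 2 <= trace_bound t ^+ 2 by rewrite ler_pXn2r// nnegrE ltW// (lt_le_trans t0).
by rewrite /ellip_bound; lra.
Qed.

Lemma contD (f g : R -> R) : continuous f -> continuous g -> continuous (fun t => f t + g t).
Proof. by move=> cf cg t; apply: continuousD; [exact: cf|exact: cg]. Qed.

Lemma contM (f g : R -> R) : continuous f -> continuous g -> continuous (fun t => f t * g t).
Proof. by move=> cf cg t; apply: continuousM; [exact: cf|exact: cg]. Qed.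

Lemma contC (a : R) : continuous (fun _ : R => a).
Proof. by move=> t; exact: cst_continuous. Qed.

Lemma contN (f : R -> R) : continuous f -> continuous (fun t => - f t).
Proof. by move=> cf t; apply: continuousN; exact: cf. Qed.

Lemma contX (f : R -> R) n : continuous f -> continuous (fun t => f t ^+ n).
Proof.
move=> cf; elim: n => [|n IH]; first exact: contC.
rewrite (_ : (fun t => _) = fun t => f t * f t ^+ n); first exact: contM.
by apply/funext => t; rewrite exprS.
Qed.

Let continuous_trace_bound : continuous trace_bound.
Proof.
have c1 : continuous (fun t : R => trace_rate * t).
  by apply: contM; [exact: contC|move=> t; exact: id].
apply: contM; first exact: contC.
by move=> t; exact: (@continuous_comp R R R (fun t => trace_rate * t) expR t (c1 t) (@continuous_expR _ _)).
Qed.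

Let continuous_ellip_bound : continuous ellip_bound.
Proof.
apply: contD; last exact: contC.
apply: contD => //; apply: contM; first exact: contC.
exact: contX.
Qed.

Let continuous_cutoff_lipconst (f : R -> R) : continuous f -> continuous (fun t => cutoff_lipconst (f t)).
Proof.
move=> cf; have c2 : continuous (fun t => 2 * f t) by exact: contM (@contC 2) cf.
have k (n : nat) p : continuous (fun t => n%:R * (2 * f t) ^+ p).
  by apply: contM; [exact: contC|exact: contX].
have cK : continuous (fun t => diffusion_bound (2 * f t)).
  rewrite /diffusion_bound; apply: contD; apply: contM; [exact: contC|exact: k|exact: contC|exact: c2].
have cLF : continuous (fun t => Dten_id_lipconst (2 * f t)).
  rewrite /Dten_id_lipconst; apply: contM; first exact: k.
  apply: contM; first exact: contC.
  by apply: contM; exact: k.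
rewrite /cutoff_lipconst /diffusion_lipconst; apply: contD.
  by apply: contM; [apply: contM; [exact: contC|exact: cf]|exact: cK].
by apply: contD; [apply: contM; [exact: contC|exact: cLF]|exact: contC].
Qed.

Lemma sympart_id M : mx_sym M -> sympart M = M.
Proof. by move=> sM; rewrite /sympart sM; apply/matrixP => i j; rewrite !mxE; lra. Qed.

Lemma sym_sympart M : mx_sym (sympart M).
Proof. by rewrite /mx_sym /sympart linearZ/= linearD/= trmxK addrC. Qed.

Lemma sympart_diff (M N : 'M[R]_3) e : (forall i j, `|M i j - N i j| <= e) ->
  forall i j, `|sympart M i j - sympart N i j| <= e.
Proof.
move=> h i j; rewrite !mxE; have := h i j; have := h j i; rewrite !ler_norml; lra.
Qed.

Let c0 : R := m * (1 + `|lam|).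

Let coef_le (a : R) t i j : a = 1 \/ a = -1 -> `|a * Om t i j + lam * Ga t i j| <= c0.
Proof.
move=> ha; apply: (le_trans (ler_normD _ _)); rewrite /c0 mulrDr mulr1 lerD//.
  by rewrite normrM; case: ha => ->; rewrite ?normrN normr1 mul1r.
by rewrite normrM mulrC ler_wpM2r.
Qed.

Lemma strainE t S i j : strain t S i j = \sum_(k < 3) S i k * (1 * Om t k j + lam * Ga t k j)
  + \sum_(k < 3) (-1 * Om t i k + lam * Ga t i k) * S k j.
Proof.
by rewrite !mxE; congr (_ + _); apply: eq_bigr => k _; rewrite !mxE ?mul1r ?mulN1r.
Qed.

Lemma strain_diff t (S1 S2 : 'M[R]_3) e i j : (forall i j, `|S1 i j - S2 i j| <= e) ->
  `|strain t S1 i j - strain t S2 i j| <= 6 * c0 * e.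
Proof.
move=> h; rewrite !strainE opprD addrACA -!sumrB.
apply: (le_trans (ler_normD _ _)).
have -> : 6 * c0 * e = \sum_(k < 3) e * c0 + \sum_(k < 3) c0 * e by rewrite !sum3; ring.
apply: lerD; apply: (le_trans (ler_norm_sum _ _ _)); apply: ler_sum => k _.
  by rewrite -mulrBl normrM ler_pM//; apply: coef_le; left.
by rewrite -mulrBr normrM ler_pM//; apply: coef_le; right.
Qed.

Lemma cutoff_fieldE t M i j : cutoff_field t M i j = - (2^-1 * strain t (sympart M) i j)
   - D t * (chi (ellip_bound t) (sympart M) * diffusion (sympart M) i j).
Proof.
rewrite /cutoff_field; move: (strain t _) (diffusion _) (chi _ _) => X Y c; rewrite !mxE; ring.
Qed.

Let field_lipconst t : R := 3 * c0 + m * cutoff_lipconst (ellip_bound t).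

Lemma cutoff_field_lip (t e : R) (a b : 'M[R]_3) : (forall i j, `|a i j - b i j| <= e) ->
  forall i j, `|cutoff_field t a i j - cutoff_field t b i j| <= field_lipconst t * e.
Proof.
move=> /sympart_diff h i j; rewrite !cutoff_fieldE.
have h1 := strain_diff t i j h.
have h2 := chi_diffusion_lip i j (ellip_bound_ge1 t) (sym_sympart a) (sym_sympart b) h.
have h3 : `|D t * (chi (ellip_bound t) (sympart a) * diffusion (sympart a) i j)
   - D t * (chi (ellip_bound t) (sympart b) * diffusion (sympart b) i j)| <= m * (cutoff_lipconst (ellip_bound t) * e).
  by rewrite -mulrBr normrM ler_pM.
have -> : field_lipconst t * e = 2^-1 * (6 * c0 * e) + m * (cutoff_lipconst (ellip_bound t) * e) by rewrite /field_lipconst; field.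
move: h1 h3; move: (strain t (sympart a) i j) (strain t (sympart b) i j) => x1 x2.
move: (D t * (chi (ellip_bound t) (sympart a) * _)) (D t * (chi (ellip_bound t) (sympart b) * _)) => y1 y2.
by rewrite !ler_norml; lra.
Qed.

Lemma continuous_cutoff_field a i j : continuous (fun t => cutoff_field t a i j).
Proof.
rewrite (_ : (fun t => _) = fun t => - (2^-1 * (\sum_(k < 3) sympart a i k * (1 * Om t k j + lam * Ga t k j)
  + \sum_(k < 3) (-1 * Om t i k + lam * Ga t i k) * sympart a k j))
  + - (D t * (clip (2 + - (\tr (sympart a) * (ellip_bound t)^-1)) * clip (2 * ellip_bound t * mu (sympart a) + - 1)
     * diffusion (sympart a) i j))); last first.
  by apply/funext => t; rewrite cutoff_fieldE strainE.
have cr : continuous (fun t : R => (ellip_bound t)^-1).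
  move=> t; apply: continuousV; last exact: continuous_ellip_bound.
  by rewrite gt_eqF// (lt_le_trans _ (ellip_bound_ge1 t)).
have cc (f : R -> R) : continuous f -> continuous (fun t : R => clip (f t)).
  move=> cf t; exact: (@continuous_comp R R R f (@clip R) t (cf t) (@continuous_clip _ _)).
have c1 : continuous (fun t : R => \sum_(k < 3) sympart a i k * (1 * Om t k j + lam * Ga t k j)).
  have e k : continuous (fun t : R => sympart a i k * (1 * Om t k j + lam * Ga t k j)).
    apply: contM; first exact: contC.
    by apply: contD; apply: contM; [exact: contC|exact: cOm|exact: contC|exact: cGa].
  exact: (@continuous_sum_seq R _ _ (fun k t => sympart a i k * (1 * Om t k j + lam * Ga t k j)) e).
have c2 : continuous (fun t : R => \sum_(k < 3) (-1 * Om t i k + lam * Ga t i k) * sympart a k j).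
  have e k : continuous (fun t : R => (-1 * Om t i k + lam * Ga t i k) * sympart a k j).
    apply: contM; last exact: contC.
    by apply: contD; apply: contM; [exact: contC|exact: cOm|exact: contC|exact: cGa].
  exact: (@continuous_sum_seq R _ _ (fun k t => (-1 * Om t i k + lam * Ga t i k) * sympart a k j) e).
have c3 : continuous (fun t : R => clip (2 + - (\tr (sympart a) * (ellip_bound t)^-1))).
  apply: cc; apply: contD; first exact: contC.
  by apply: contN; apply: contM; [exact: contC|exact: cr].
have c4 : continuous (fun t : R => clip (2 * ellip_bound t * mu (sympart a) + - 1)).
  apply: cc; apply: contD; last exact: contC.
  apply: contM; last exact: contC.
  by apply: contM; [exact: contC|exact: continuous_ellip_bound].
apply: contD; apply: contN; apply: contM.
- exact: contC.
- by apply: contD; [exact: c1|exact: c2].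
- exact: cD.
- by apply: contM; [apply: contM; [exact: c3|exact: c4]|exact: contC].
Qed.

Let field_lipconst_ge0 t : 0 <= field_lipconst t.
Proof.
have r1 := ellip_bound_ge1 t; have rr : 0 <= ellip_bound t by lra.
have r0 : 0 <= 2 * ellip_bound t by lra.
have v : 0 <= cutoff_lipconst (ellip_bound t).
  by rewrite /cutoff_lipconst; exact: addr_ge0 (mulr_ge0 (mulr_ge0 (ler0n R 9) rr) (diffusion_bound_ge0 r0)) (diffusion_lipconst_ge0 r0).
have c : 0 <= c0 by exact: mulr_ge0 m0 (addr_ge0 ler01 (normr_ge0 lam)).
exact: addr_ge0 (mulr_ge0 (ler0n R 3) c) (mulr_ge0 m0 v).
Qed.

Let continuous_field_lipconst : continuous field_lipconst.
Proof.
apply: contD; first exact: contC.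
by apply: contM; [exact: contC|exact: continuous_cutoff_lipconst continuous_ellip_bound].
Qed.

Lemma sym_strain t S : mx_sym S -> mx_sym (strain t S).
Proof.
move=> sS; rewrite /mx_sym /strain linearD/= !trmx_mul sS !linearD/= !linearZ/= linearN/=.
by rewrite sOm sGa opprK addrC.
Qed.

Lemma sym_cutoff_field t M : mx_sym (cutoff_field t M).
Proof.
have sS := sym_sympart M; apply/matrixP => i j.
rewrite mxE !cutoff_fieldE (sym_entry i j (sym_strain t sS)); congr (_ - _ * _).
have [->|c1] := eqVneq (chi (ellip_bound t) (sympart M)) 0; first by rewrite !mul0r.
have e := chi_ellip (ellip_bound_ge1 t) sS c1.
by rewrite !diffusionE (sym_entry i j (sym_Dten_id e)) (sym_entry i j sS).
Qed.

Lemma tr_skew (X : 'M[R]_3) : mx_skew X -> \tr X = 0.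
Proof. by move=> sX; have := mxtrace_tr X; rewrite sX raddfN/=; lra. Qed.

Lemma tr_coef t : \tr (Om t + lam *: Ga t) = 0.
Proof. by rewrite raddfD/= mxtraceZ tGa mulr0 addr0 tr_skew. Qed.

Lemma tr_coefN t : \tr (- Om t + lam *: Ga t) = 0.
Proof. by rewrite raddfD/= raddfN/= mxtraceZ tGa mulr0 addr0 tr_skew// oppr0. Qed.

Lemma mul_mx_adj3 X : X *m adj3 X = (\det X)%:M :> 'M[R]_3.
Proof.
apply/matrixP; apply: ord3_ind; apply: ord3_ind; rewrite !mxE sum3 !mxE /cyc3 /= det3; ring.
Qed.

(** Cycling the trace brings [S] next to its adjugate, which leaves [det S] times the traces of the
    two coefficient matrices; both are traceless. *)
Lemma tr_adj_strain t S : \tr (adj3 S *m strain t S) = 0.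
Proof.
rewrite /strain mulmxDr mulmxA mul_adj3_mx mul_scalar_mx raddfD/= mxtraceZ tr_coef mulr0 add0r.
by rewrite mulmxA mxtrace_mulC mulmxA mul_mx_adj3 mul_scalar_mx mxtraceZ tr_coefN mulr0.
Qed.

(** By [tr_inv_Dten_id] the diffusion contributes [det S * (2 * 6 sqrt (det S) - 4 * 3)], so
    [det S = 1] is an equilibrium of the determinant. *)
Lemma tr_adj_cutoff_field t S : mx_sym S -> \tr (adj3 S *m cutoff_field t S) =
  - (D t * chi (ellip_bound t) S * (12 * \det S * (Num.sqrt (\det S) - 1))).
Proof.
move=> sS; rewrite /cutoff_field sympart_id// mulmxBr mulmxN -!scalemxAr raddfB/= raddfN/= !mxtraceZ.
rewrite tr_adj_strain mulr0 oppr0 sub0r; congr (- _).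
have [->|c1] := eqVneq (chi (ellip_bound t) S) 0; first by rewrite mulr0 !mul0r.
have e := chi_ellip (ellip_bound_ge1 t) sS c1; congr (_ * _).
have d0 := posdef_det (ellip_spd e); have d1 : \det S != 0 by rewrite gt_eqF.
rewrite /diffusion mulmxBr -!scalemxAr raddfB/= !mxtraceZ mul_adj3_mx.
have -> : adj3 S = \det S *: invmx S by rewrite invmx3// scalerA mulfV// scale1r.
by rewrite -scalemxAl mxtraceZ (tr_inv_Dten_id e) mxtrace_scalar; ring.
Qed.

Lemma closure_flow : exists B : R -> 'M[R]_3, B 0 = B0 /\
  (forall t : R, 0 <= t -> forall i j, is_derive t 1 (fun s => B s i j)
     (- (2^-1 * strain t (B t) i j) - D t * diffusion (B t) i j)) /\
  (forall t : R, 0 <= t -> ellip (ellip_bound t) (B t) /\ \det (B t) = 1).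
Proof.
have [B [BI dB]] := picard B0 continuous_field_lipconst field_lipconst_ge0 cutoff_field_lip continuous_cutoff_field.
have cB (t : R) i j : 0 <= t -> {for t, continuous (fun s => B s i j)}.
  by move=> t0; exact: derivable_continuous_at (dB t t0 i j).
(* The field takes symmetric values everywhere, so the antisymmetric part of [B] has zero
   derivative. *)
have sB t : 0 <= t -> mx_sym (B t).
  move=> t0; apply/matrixP => i j; rewrite mxE.
  have := @derive_norm_le _ (fun s => B s j i - B s i j) (fun=> 0) (fun=> 0) (fun=> 0) t t0.
  rewrite BI (sym_entry i j spB0.1) !subrr subr0 => h.
  have {}h : `|B t j i - B t i j| <= 0.
    apply: h => [s /andP[s0 _]|s _]; last by rewrite normr0.
    have := is_drv_sub (dB s s0 j i) (dB s s0 i j).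
    by rewrite (sym_entry i j (sym_cutoff_field s (B s))) subrr.
  by apply/eqP; rewrite -subr_eq0 -normr_le0.
(* Positive definiteness is not yet available here; it is only needed where the cutoff is nonzero,
   and [chi_ellip] supplies it there. *)
have dt t : 0 <= t -> \det (B t) = 1.
  move=> t0.
  pose h (s : R) := - ((\det (B s) - 1) * (\det (B s) - 1)).
  have dd (s : R) : 0 <= s -> is_derive s 1 (fun z => \det (B z))
      (- (D s * chi (ellip_bound s) (B s) * (12 * \det (B s) * (Num.sqrt (\det (B s)) - 1)))).
    by move=> s0; rewrite -(tr_adj_cutoff_field s (sB s s0)); exact: derive_det (dB s s0).
  have : h 0 <= h t.
    pose d' (s : R) := - (D s * chi (ellip_bound s) (B s) * (12 * \det (B s) * (Num.sqrt (\det (B s)) - 1))).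
    apply: (@derive_nondecreasing _ h (fun s => - (d' s * (\det (B s) - 1) + (\det (B s) - 1) * d' s))) => //.
      move=> s /andP[s0 _]; have d1 := is_drv_sub (dd s s0) (is_drv_cst 1 s); rewrite subr0 in d1.
      exact: is_drv_opp (is_drv_mul d1 d1).
    move=> s /andP[s0 _]; rewrite /d'.
    have [->|c1] := eqVneq (chi (ellip_bound s) (B s)) 0; first by rewrite mulr0 !mul0r oppr0 mul0r mulr0 addr0 oppr0.
    have e := chi_ellip (ellip_bound_ge1 s) (sB s s0) c1.
    have d0 := posdef_det (ellip_spd e); have Ds := D0 s; have ch := chi_ge0 (ellip_bound s) (B s).
    set x := Num.sqrt (\det (B s)); have x0 : 0 < x by rewrite sqrtr_gt0.
    have xE : \det (B s) = x ^+ 2 by rewrite sqr_sqrtr// ltW.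
    (* With [x = sqrt (det B)], the sign comes from [(x - 1) (x^2 - 1) = (x - 1)^2 (x + 1)]. *)
    have -> : - (- (D s * chi (ellip_bound s) (B s) * (12 * \det (B s) * (x - 1))) * (\det (B s) - 1) +
       (\det (B s) - 1) * - (D s * chi (ellip_bound s) (B s) * (12 * \det (B s) * (x - 1)))) =
       24 * (D s * chi (ellip_bound s) (B s) * (\det (B s) * ((x - 1) ^+ 2 * (x + 1)))).
      by rewrite xE; ring.
    apply: mulr_ge0; first exact: ler0n.
    apply: mulr_ge0; first exact: mulr_ge0.
    apply: mulr_ge0; first exact: ltW.
    exact: mulr_ge0 (sqr_ge0 _) (addr_ge0 (ltW x0) ler01).
  rewrite /h BI dB0 subrr mulr0 oppr0 -expr2 oppr_ge0 => h2.
  have : (\det (B t) - 1) ^+ 2 == 0 by rewrite eq_le h2 sqr_ge0.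
  by rewrite sqrf_eq0 subr_eq0 => /eqP.
have spB t : 0 <= t -> mx_spd (B t).
  move=> t0; apply: (spd_path t0 cB sB); last by rewrite BI.
  by move=> s s0; rewrite dt.
have trB t : 0 <= t -> \tr (B t) <= trace_bound t.
  move=> t0.
  have dtr (s : R) : 0 <= s -> is_derive s 1 (fun z => \tr (B z)) (\tr (cutoff_field s (B s))).
    move=> s0; rewrite (_ : (fun z => _) = fun z => B z o0 o0 + B z o1 o1 + B z o2 o2); last first.
      by apply/funext => z; rewrite /mxtrace sum3.
    rewrite /mxtrace sum3; exact: is_drv_add (is_drv_add (dB s s0 _ _) (dB s s0 _ _)) (dB s s0 _ _).
  have trG s : 0 <= s -> \tr (cutoff_field s (B s)) <= trace_rate * \tr (B s).
    move=> s0; have sp := spB s s0; have eS := sB s s0.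
    have t1 : 0 <= \tr (B s) by apply: le_trans (entry_le_tr o0 o0 sp).
    rewrite /cutoff_field sympart_id// raddfB/= raddfN/= !mxtraceZ.
    have tK : `|2^-1 * \tr (strain s (B s))| <= 9 * m * `|lam| * \tr (B s).
      have -> : \tr (strain s (B s)) = 2 * (lam * \tr (B s *m Ga s)).
        rewrite /strain raddfD/= [\tr ((- _ + _) *m _)]mxtrace_mulC !mulmxDr !raddfD/= mulmxN raddfN/=.
        by rewrite -!scalemxAr !mxtraceZ; ring.
      rewrite mulKf ?pnatr_eq0// normrM.
      have -> : 9 * m * `|lam| * \tr (B s) = `|lam| * (9 * (\tr (B s) * m)) by ring.
      rewrite ler_wpM2l// -(mdot_tr _ eS) /mdot.
      apply: (le_trans (ler_norm_sum _ _ _)).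
      apply: (@le_trans _ _ (\sum_(i < 3) \sum_(j < 3) (\tr (B s) * m))); last by rewrite !sum3; lra.
      apply: ler_sum => i _; apply: (le_trans (ler_norm_sum _ _ _)); apply: ler_sum => j _.
      by rewrite normrM ler_pM// entry_le_tr.
    have tW : - (D s * chi (ellip_bound s) (B s) * \tr (diffusion (B s))) <= 4 * m * \tr (B s).
      have [->|c1] := eqVneq (chi (ellip_bound s) (B s)) 0.
        by rewrite mulr0 mul0r oppr0 !mulr_ge0.
      have e := chi_ellip (ellip_bound_ge1 s) eS c1; have F0 := tr_Dten_id_ge0 e.
      have Ds := D0 s; have ch := chi_ge0 (ellip_bound s) (B s); have ch1 := chi_le1 (ellip_bound s) (B s).
      have Dm : D s * chi (ellip_bound s) (B s) <= m.
        rewrite (le_trans _ (D_le s))// ger0_norm// ler_piMr//.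
      have Dc0 : 0 <= D s * chi (ellip_bound s) (B s) by rewrite mulr_ge0.
      rewrite /diffusion raddfB/= !mxtraceZ -mulrN opprB.
      apply: (@le_trans _ _ (D s * chi (ellip_bound s) (B s) * (4 * \tr (B s)))).
        by rewrite ler_wpM2l//; lra.
      rewrite [leRHS]mulrAC [leRHS]mulrC ler_wpM2r//; lra.
    by move: tK; rewrite ler_norml /trace_rate => /andP[]; lra.
  (* Gronwall's argument: by [trG] the trace times the integrating factor is nonincreasing. *)
  pose g (s : R) := - (\tr (B s) * expR (- trace_rate * s)).
  have dE (s : R) : is_derive s 1 (fun z => expR (- trace_rate * z)) (- trace_rate * expR (- trace_rate * s)).
    have d := is_drv_scale (- trace_rate) (is_drv_id s).
    have := @is_derive1_comp _ expR (fun z => - trace_rate * z) s _ _ (is_derive_expR _) d.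
    by rewrite mulr1 mulrC.
  have : g 0 <= g t.
    apply: (@derive_nondecreasing _ g (fun s => - (\tr (cutoff_field s (B s)) * expR (- trace_rate * s)
        + \tr (B s) * (- trace_rate * expR (- trace_rate * s))))) => //.
      move=> s /andP[s0 _]; exact: is_drv_opp (is_drv_mul (dtr s s0) (dE s)).
    move=> s /andP[s0 _].
    have -> : - (\tr (cutoff_field s (B s)) * expR (- trace_rate * s) + \tr (B s) * (- trace_rate * expR (- trace_rate * s))) =
      (trace_rate * \tr (B s) - \tr (cutoff_field s (B s))) * expR (- trace_rate * s) by ring.
    by rewrite mulr_ge0 ?expR_ge0// subr_ge0 trG.
  rewrite /g mulr0 expR0 mulr1 lerN2 BI mulNr expRN ler_pdivrMr ?expR_gt0//.
have lB t : 0 <= t -> forall v, sqnorm v <= ellip_bound t * qf (B t) v.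
  move=> t0 v; have sp := spB t t0; have T0 := trace_bound_gt0 t.
  have q0 := qf_ge0 v sp.2.
  have eb i j : `|B t i j| <= trace_bound t by rewrite (le_trans (entry_le_tr i j sp))// trB.
  (* Since the determinant is 1, the inverse is the adjugate, whose entries are two by two
     minors. *)
  have ib i j : `|invmx (B t) i j| <= 2 * trace_bound t ^+ 2.
    rewrite invmx3 dt// ?oner_eq0// invr1 scale1r mxE (le_trans (ler_normB _ _))//.
    by rewrite [2 * _]mulr_natl mulr2n expr2 lerD// normrM ler_pM.
  have b0 : 0 < 2 * trace_bound t ^+ 2 by rewrite mulr_gt0// exprn_gt0.
  apply: (le_trans (qf_lower v sp b0 ib)); rewrite ler_wpM2r// /ellip_bound; lra.
have eB t : 0 <= t -> ellip (ellip_bound t) (B t).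
  move=> t0; split; [exact: ellip_bound_ge1|exact: sB|exact: lB|].
  move=> i j; rewrite (le_trans (entry_le_tr i j (spB t t0)))// (le_trans (trB t t0))//.
  by have := sqr_ge0 (trace_bound t); rewrite /ellip_bound; lra.
exists B; split=> //; split=> [t t0 i j|t t0]; last by split; [exact: eB|exact: dt].
have := dB t t0 i j; rewrite cutoff_fieldE sympart_id; last exact: sB.
(* [trB] and [lB] place the solution in the region where the cutoff of this radius is identically 1,
   so the truncation disappears. *)
have -> : chi (ellip_bound t) (B t) = 1.
  apply: chi_eq1 => //; last exact: (lB t t0).
    by rewrite (lt_le_trans _ (ellip_bound_ge1 t)).
  by rewrite (le_trans (trB t t0))//; have := sqr_ge0 (trace_bound t); rewrite /ellip_bound; lra.
by rewrite mul1r.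
Qed.
End Flow.

(** * From the flow of [B] to the closure system *)

Lemma continuous_extend (R : realType) (f : R -> R) :
  {within `[0, +oo[, continuous f} -> continuous (fun t : R => f (Num.max t 0)).
Proof.
move=> /subspace_continuousP cf t.
have A (t' : R) : `[0, +oo[%classic (Num.max t' 0 : R) by rewrite /= in_itv/= andbT max0_ge0.
apply/cvgrPdist_le => e e0.
have /cvgrPdist_le/(_ _ e0) h := cf _ (A t).
have := @continuous_max0 R t _ h; rewrite /= !nbhs_simpl/=.
by apply: filterS => z /(_ (A z)).
Qed.

Lemma ellip_mono (R : realType) (r r' : R) (B : 'M[R]_3) : r <= r' -> ellip r B -> ellip r' B.
Proof.
move=> rr' eB; have sp := ellip_spd eB; case: eB => r1 sB lB uB; split=> //.
- exact: le_trans rr'.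
- by move=> v; rewrite (le_trans (lB v))// ler_wpM2r// qf_ge0//; case: sp.
- by move=> i j; rewrite (le_trans (uB i j)).
Qed.

Section Closure.
Variable R : realType.
Variables (rho : R) (B : 'M[R]_3).
Hypothesis eB : ellip rho B.

Let N : 'M[R]_3 := 2 *: 1%:M - 6 *: Amap B.

Lemma sym_closure_source : mx_sym N.
Proof.
have s1 := @sym_one R; have sA := sym_Amap eB; apply/matrixP => i j.
by rewrite /N; move: (Amap B) sA => A sA; rewrite !mxE (sym_entry i j sA) eq_sym.
Qed.

Lemma Dten_source : tcontract (Dten B) N = diffusion B.
Proof.
rewrite /N tcontractB !tcontractZ (Dten_Amap eB) -Dten_idE /diffusion scalerA.
by congr (_ - _ *: _); field.
Qed.

Lemma Cten_diffusion : tcontract (Cten B) (diffusion B) = N.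
Proof. by rewrite -Dten_source; have [_ /(_ _ sym_closure_source)[]] := Dten_spec eB. Qed.
End Closure.

Theorem theorem1 (R : realType) (lambda : R)
  (Omega Gamma : R -> 'M[R]_3) (Dr : R -> R) (B0 : 'M[R]_3) :
  (* continuity on [0, +oo) *)
  (forall i j : 'I_3, {within `[0, +oo[, continuous (fun t => Omega t i j)}) ->
  (forall i j : 'I_3, {within `[0, +oo[, continuous (fun t => Gamma t i j)}) ->
  {within `[0, +oo[, continuous Dr} ->
  (* boundedness on [0, +oo) *)
  (exists M : R, forall t, 0 <= t -> forall i j : 'I_3,
       `|Omega t i j| <= M /\ `|Gamma t i j| <= M /\ `|Dr t| <= M) ->
  (* structure *)
  (forall t, 0 <= t -> mx_skew (Omega t)) ->
  (forall t, 0 <= t -> mx_sym (Gamma t) /\ \tr (Gamma t) = 0) ->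
  (forall t, 0 <= t -> 0 <= Dr t) ->
  mx_spd B0 -> \det B0 = 1 ->
  exists (A B : R -> 'M[R]_3),
    A 0 = Amap B0 /\ B 0 = B0 /\
    (forall i j : 'I_3, {within `[0, +oo[, continuous (fun t => A t i j)}) /\
    (forall i j : 'I_3, {within `[0, +oo[, continuous (fun t => B t i j)}) /\
    (forall t, 0 < t ->
      let K := B t *m (Omega t + lambda *: Gamma t)
               + (- Omega t + lambda *: Gamma t) *m B t in
      let N := 2%:R *: 1%:M - 6%:R *: A t in
      forall i j : 'I_3,
        is_derive t 1 (fun s => A s i j)
          ((2%:R^-1 *: tcontract (Cten (B t)) K + Dr t *: N) i j) /\
        is_derive t 1 (fun s => B s i j)
          ((- (2%:R^-1 *: K) - Dr t *: tcontract (Dten (B t)) N) i j)) /\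
    (forall t, 0 <= t ->
      mx_spd (B t) /\ \det (B t) = 1 /\
      A t = Amap (B t) /\ mx_posdef (A t) /\ \tr (A t) = 1).
Proof.
move=> cO cG cD [m bm] sO sG D0 sp dB0.
(* The data are only given for [t >= 0]; freezing them at negative times meets the hypotheses of
   [closure_flow] on the whole line. *)
pose Om (t : R) := Omega (Num.max t 0); pose Ga (t : R) := Gamma (Num.max t 0).
pose D (t : R) := Dr (Num.max t 0).
have mx t := @max0_ge0 R t.
have Om_le t i j : `|Om t i j| <= m by case: (bm _ (mx t) i j).
have Ga_le t i j : `|Ga t i j| <= m by case: (bm _ (mx t) i j) => _ [].
have D_le t : `|D t| <= m by case: (bm _ (mx t) o0 o0) => _ [].
have sOm t : mx_skew (Om t) by exact: sO.
have sGa t : mx_sym (Ga t) by case: (sG _ (mx t)).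
have tGa t : \tr (Ga t) = 0 by case: (sG _ (mx t)).
have [B [BI [dB eB]]] := @closure_flow R lambda m Om Ga D B0
  (fun i j => continuous_extend (cO i j)) (fun i j => continuous_extend (cG i j))
  (continuous_extend cD) Om_le Ga_le D_le sOm sGa tGa (fun t => D0 _ (mx t)) sp dB0.
pose r := ellip_bound lambda m B0.
have m0 : 0 <= m := le_trans (normr_ge0 _) (D_le 0).
have r_mono s t : s <= t -> r s <= r t by exact: ellip_bound_mono.
pose Bt (t : R) := B (Num.max t 0).
have Bte t : 0 <= t -> Bt t = B t by move=> t0; rewrite /Bt max_l.
have eBt t u : Num.max t 0 <= u -> ellip (r u) (Bt t).
  by move=> tu; apply: ellip_mono (r_mono _ _ tu) _; case: (eB _ (mx t)).
have cB i j : continuous (fun t => Bt t i j).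
  move=> t; exact: (@continuous_comp R R R (fun t => Num.max t 0) (fun z => B z i j) t
    (@continuous_max0 R t) (derivable_continuous_at (dB _ (mx t) i j))).
have cA i j : continuous (fun t => Amap (Bt t) i j).
  move=> t; apply/cvgrPdist_le => e e0.
  (* Looking one unit of time ahead gives one ellipticity constant for all [Bt z] with [z] near [t],
     as [Amap_lip] requires. *)
  pose q := r (Num.max t 0 + 1); pose c := 513 * q ^+ 7.
  have eq : ellip q (Bt t) by apply: eBt; rewrite lerDl.
  have c0 : 0 < c by apply: mulr_gt0; [rewrite ltr0n|exact: exprn_gt0 (rho_gt0 eq)].
  have N : \forall z \near t, forall k l, `|Bt t k l - Bt z k l| <= e / c.
    apply: (@filter_forall R 'I_3 (fun k z => forall l, `|Bt t k l - Bt z k l| <= e / c) (nbhs t) _) => k.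
    apply: (@filter_forall R 'I_3 (fun l z => `|Bt t k l - Bt z k l| <= e / c) (nbhs t) _) => l.
    by have := cB k l t; move/cvgrPdist_le; apply; rewrite divr_gt0.
  near=> z.
  have hz : Num.max z 0 <= Num.max t 0 + 1.
    by near: z; apply: (cvgr_le _ (@continuous_max0 R t)); rewrite ltrDl.
  have h : forall k l, `|Bt t k l - Bt z k l| <= e / c by near: z; exact: N.
  have := Amap_lip eq (eBt z _ hz) h i j; rewrite -/q -/c mulrC divfK// gt_eqF//.
have KE t : 0 <= t -> strain lambda Om Ga t (Bt t) = Bt t *m (Omega t + lambda *: Gamma t)
    + (- Omega t + lambda *: Gamma t) *m Bt t.
  by move=> t0; rewrite /strain /Om /Ga max_l.
pose H (t : R) : 'M[R]_3 := - (2^-1 *: strain lambda Om Ga t (Bt t)) - D t *: diffusion (Bt t).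
have HE (t : R) i j : H t i j = - (2^-1 * strain lambda Om Ga t (Bt t) i j) - D t * diffusion (Bt t) i j.
  by rewrite /H; move: (strain _ _ _ _ _) (diffusion _) => X Y; rewrite !mxE.
have dBt (t : R) : 0 < t -> forall i j, is_derive t 1 (fun s => Bt s i j) (H t i j).
  (* [Bt] and [B] agree at nonnegative times only, so the two-sided derivative is transferred for
     [t > 0]. *)
  move=> t0 i j; apply: (@near_eq_is_derive _ _ _ (fun s => B s i j)).
    near=> s; rewrite Bte// ltW//; near: s; exact: lt_nbhsr.
  by rewrite HE Bte ?ltW//; exact: dB (ltW t0) i j.
have dA (t : R) : 0 < t -> forall i j,
    is_derive t 1 (fun s => Amap (Bt s) i j) (- tcontract (Cten (Bt t)) (H t) i j).
  move=> t0 i j.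
  (* The interval [(0, t + 1)] serves for [derive_Amap]: [q] is an ellipticity constant on all of
     it, and [beta] adds the bounds of the strain and diffusion parts of [H]. *)
  pose q := r (t + 1); pose beta := 2^-1 * (6 * (m * (1 + `|lambda|)) * q) + m * diffusion_bound q.
  have eq s : 0 < s < t + 1 -> ellip q (Bt s).
    by move=> /andP[s0 st]; apply: eBt; rewrite max_l ltW.
  apply: (@derive_Amap R Bt H 0 (t + 1) t q beta).
  - by rewrite t0/= ltrDl ltr01.
  - exact: eq.
  - by move=> s /andP[s0 _]; exact: dBt.
  - move=> s hs k l; rewrite HE.
    have eqs := eq s hs.
    have h1 : `|strain lambda Om Ga s (Bt s) k l| <= 6 * (m * (1 + `|lambda|)) * q.
      have K0 : strain lambda Om Ga s 0 k l = 0 by rewrite /strain mul0mx mulmx0 addr0 mxE.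
      rewrite -[X in `|X|]subr0 -K0; apply: strain_diff => // a b.
      by rewrite mxE subr0; case: eqs.
    have h2 := diffusion_le k l eqs.
    apply: (le_trans (ler_normB _ _)); rewrite normrN /beta lerD//.
      by rewrite normrM ger0_norm ?invr_ge0// ler_wpM2l// invr_ge0.
    by rewrite normrM ler_pM.
  - have eqt := eq t; apply/matrixP => k l; rewrite mxE !HE.
    have et : ellip q (Bt t) by apply: eq; rewrite t0/= ltrDl ltr01.
    have sBt : mx_sym (Bt t) by case: et.
    by rewrite (sym_entry k l (sym_strain lambda sOm sGa t sBt)) !diffusionE (sym_entry k l (sym_Dten_id et)) (sym_entry k l sBt).
exists (fun t => Amap (Bt t)), Bt.
have B00 : Bt 0 = B0 by rewrite Bte.
split; first by rewrite B00.
split=> //; split; first by move=> i j; exact: continuous_subspaceT.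
split; first by move=> i j; exact: continuous_subspaceT.
split=> [t t0 K N i j|t t0].
  have e := eBt t _ (lexx _).
  have DE : D t = Dr t by rewrite /D max_l// ltW.
  have KKE' := KE t (ltW t0).
  have HK : H t = - (2^-1 *: K) - Dr t *: diffusion (Bt t) by rewrite /H KKE' DE.
  split.
    have := dA t t0 i j; move/is_derive_eq; apply.
    rewrite HK -!scaleNr tcontractD !tcontractZ (Cten_diffusion e) -/N.
    by move: (tcontract _ K) N => X Y; rewrite !mxE; ring.
  have := dBt t t0 i j; move/is_derive_eq; apply.
  by rewrite HK (Dten_source e).
have e := eBt t _ (lexx _); have d1 : \det (Bt t) = 1 by case: (eB _ (mx t)).
split; first exact: ellip_spd e.
split=> //; split=> //; split; first exact: posdef_Amap e.
exact: trAmap e d1.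
Unshelve. all: by end_near. Qed.
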